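(* Let $\underline M$ be a simple pure Anderson motive of rank $r$ and dimension $d$ over the field $L=\mathbb F_q$, with Frobenius endomorphism $\pi$. Then (1) $\mathrm{End}(\underline M)$ is commutative and $E:=\mathrm{End}(\underline M)\otimes_AQ=Q(\pi)$. (2) All orders $R$ in $Q(\pi)$ containing $\pi$ are endomorphism rings of pure Anderson motives isogenous to $\underline M$. Any such order automatically contains $N(\pi)/\pi=N_{Q(\pi)/Q}(\pi)/\pi$. (3) For each such $R$ the isomorphism classes of pure Anderson motives isogenous to $\underline M$ with endomorphism ring $R$ correspond bijectively to the isomorphism classes of $A$-lattices in $E$ with order $R$.
   Context: Setting. $C$ is a smooth projective geometrically irreducible curve over the finite field $\mathbb F_q$, $\infty\in C(\mathbb F_q)$ a fixed point, $A=\Gamma(C\setminus\{\infty\},\mathcal O_C)$, $Q=\mathrm{Quot}(A)$. For a field $L\supset\mathbb F_q$: $C_L=C\times_{\mathbb F_q}L$, $A_L=A\otimes_{\mathbb F_q}L$, $\sigma^*$ the endomorphism $a\otimes b\mapsto a\otimes b^q$ of $A_L$ (also the corresponding pullback on $C_L$), $\sigma^*M=M\otimes_{A_L,\sigma^*}A_L$. Pure Anderson motives. Fix an $\mathbb F_q$-homomorphism $c^*:A\to L$ and let $J=(a\otimes1-1\otimes c^*(a):a\in A)\subset A_L$. A pure Anderson motive $\underline M=(M,\tau)$ of rank $r$, dimension $d$ and characteristic $c^*$ over $L$ is a locally free $A_L$-module $M$ of rank $r$ with an injective $A_L$-homomorphism $\tau:\sigma^*M\to M$ such that $\mathrm{coker}\,\tau$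 has $L$-dimension $d$ and is annihilated by $J^d$, and $M$ extends to a locally free sheaf $\mathcal M$ of rank $r$ on $C_L$ such that for some integers $k,l>0$ the map $\tau^l=\tau\circ\sigma^*\tau\circ\cdots\circ(\sigma^* )^{l-1}\tau$ induces an isomorphism of stalks $(\sigma^* )^l\mathcal M_\infty\to\mathcal M(k\cdot\infty)_\infty$. Morphisms (same $c^*$) are $A_L$-homomorphisms $f:M\to M'$ with $f\circ\tau=\tau'\circ\sigma^*f$; an isogeny is an injective morphism with torsion cokernel. $\underline M$ is simple if it is non-zero and has no factor motives (targets of surjective morphisms) other than $0$ and itself up to isomorphism. For $L=\mathbb F_q$ one has $\sigma^*M=M$ and the Frobenius endomorphism is $\pi=\tau\in\mathrm{End}(\underline M)$. Conventions. ''Order'' means $A$-order. If $f:\underline M'\to\underline M$ is an isogeny, $\mathrm{End}(\underline M')$ is identified with the order $f\cdot\mathrm{End}(\underline M')\cdot f^{-1}$ of $E$ (independent of $f$ since $E$ is commutative). The order of an $A$-lattice $\Lambda\subset E$ is $\{x\in E:x\Lambda\subset\Lambda\}$; lattices with order $R$ are isomorphic if they are isomorphic as $R$-modules. $N$ is the reduced norm from $E$ to $Q$, here equal to the norm $N_{Q(\pi)/Q}$. *)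

(* Defs.v *)
From HB Require Import structures.
From mathcomp Require Import all_boot all_order all_algebra all_field.
From mathcomp Require Import boolp classical_sets functions cardinality.

Set Implicit Arguments.
Unset Strict Implicit.
Unset Printing Implicit Defensive.

Import Order.TTheory GRing.Theory Num.Theory.
Local Open Scope classical_set_scope.
Local Open Scope ring_scope.

(* Curves.  A smooth projective geometrically irreducible curve C over a      *)
(* finite field F is given by its function field Q, a function field of one   *)
(* variable over F in which F is algebraically closed.  The closed points of  *)
(* C are the normalised discrete valuations of Q that are trivial on F, and   *)
(* the local ring of C at P is the valuation ring of P.                       *)

(* The valuation of 0 should be +oo; it is set to 0, so that a place is       *)
(* determined by its valuation on nonzero elements and the valuation ring is  *)
(* {x | 0 <= ord x}.                                                          *)
Record place (F : finFieldType) (Q : fieldType)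
    (base_emb : {rmorphism F -> Q}) :=
  Place {
    ord : Q -> int;
    ord_zero : ord 0 = 0;
    ord_cst : forall a : F, ord (base_emb a) = 0;
    ord_mul : forall x y, x != 0 -> y != 0 -> ord (x * y) = ord x + ord y;
    ord_add : forall x y, x != 0 -> y != 0 -> x + y != 0 ->
      Num.min (ord x) (ord y) <= ord (x + y);
    ord_onto : exists2 t, t != 0 & ord t = 1 }.

Definition local_ring F Q base_emb (P : @place F Q base_emb) : set Q :=
  [set x | 0 <= ord P x].

Definition max_ideal F Q base_emb (P : @place F Q base_emb) : set Q :=
  [set x | x = 0 \/ 0 < ord P x].

Definition rational_place F Q base_emb (P : @place F Q base_emb) : Prop :=
  forall x, local_ring P x -> exists a : F, max_ideal P (x - base_emb a).

(* Some x is transcendental over F and Q is a finite extension of F(x).       *)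
Definition one_variable (F : finFieldType) (Q : fieldType)
    (base_emb : {rmorphism F -> Q}) : Prop :=
  exists x : Q,
    (forall p : {poly F}, p != 0 -> (map_poly base_emb p).[x] != 0) /\
    (exists (n : nat) (b : 'I_n -> Q), forall y : Q,
       exists (q : {poly F}) (p : 'I_n -> {poly F}),
         q != 0 /\
         (map_poly base_emb q).[x] * y =
         \sum_i (map_poly base_emb (p i)).[x] * b i).

Definition alg_closed_in (F : finFieldType) (Q : fieldType)
    (base_emb : {rmorphism F -> Q}) : Prop :=
  forall (x : Q) (p : {poly F}), p != 0 -> root (map_poly base_emb p) x ->
    exists a : F, x = base_emb a.

Record curve (F : finFieldType) := Curve {
  funfield : fieldType;
  base_emb : {rmorphism F -> funfield};
  curve_one_variable : one_variable base_emb;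
  curve_geom_irreducible : alg_closed_in base_emb;
  infty : place base_emb;
  infty_rational : rational_place infty }.

Section CoordinateRing.
Variables (F : finFieldType) (C : curve F).
Local Notation Q := (funfield C).

Definition affine_points : set (place (base_emb C)) := [set P | P <> infty C].

Definition regular : pred Q :=
  fun x => `[< forall P, affine_points P -> local_ring P x >].

Fact ord_one (P : place (base_emb C)) : ord P 1 = 0.
Proof. by rewrite -(rmorph1 (base_emb C)) ord_cst. Qed.

Fact ord_opp (P : place (base_emb C)) (x : Q) : ord P (- x) = ord P x.
Proof.
have [->|x0] := eqVneq x 0; first by rewrite oppr0.
rewrite -mulN1r ord_mul ?oppr_eq0 ?oner_eq0 //.
by rewrite -(rmorphN1 (base_emb C)) ord_cst add0r.
Qed.

Fact regular_subring_closed : subring_closed regular.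
Proof.
split.
- by apply/asboolP => P _; rewrite /local_ring/= ord_one.
- move=> x y /asboolP Ax /asboolP Ay; apply/asboolP => P nP.
  have {}Ax := Ax P nP; have {}Ay := Ay P nP.
  rewrite /local_ring/= in Ax Ay *.
  have [->|x0] := eqVneq x 0; first by rewrite add0r ord_opp.
  have [->|y0] := eqVneq y 0; first by rewrite subr0.
  have [->|xy0] := eqVneq (x - y) 0; first by rewrite ord_zero.
  have ny0 : - y != 0 by rewrite oppr_eq0.
  apply: le_trans (ord_add P x0 ny0 xy0).
  by rewrite ord_opp le_min Ax.
- move=> x y /asboolP Ax /asboolP Ay; apply/asboolP => P nP.
  have {}Ax := Ax P nP; have {}Ay := Ay P nP.
  rewrite /local_ring/= in Ax Ay *.
  have [->|x0] := eqVneq x 0; first by rewrite mul0r ord_zero.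
  have [->|y0] := eqVneq y 0; first by rewrite mulr0 ord_zero.
  by rewrite ord_mul// addr_ge0.
Qed.

(* A = Gamma(C \ {oo}, O_C).                                                  *)
Record coord_ring :=
  CoordRing { coord_val : Q; coord_valP : coord_val \in regular }.

HB.instance Definition _ := [isSub for coord_val].
HB.instance Definition _ := [Choice of coord_ring by <:].
HB.instance Definition _ :=
  GRing.SubChoice_isSubComNzRing.Build Q regular coord_ring
    regular_subring_closed.

Fact cst_regular (a : F) : base_emb C a \in regular.
Proof. by apply/asboolP => P _; rewrite /local_ring/= ord_cst. Qed.

Definition coord_cst (a : F) : coord_ring := CoordRing (cst_regular a).

End CoordinateRing.

Arguments affine_points {F}.

Definition ideal_gen (A : comNzRingType) (S : set A) : set A :=
  [set x | exists (n : nat) (b s : 'I_n -> A),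
     (forall i, S (s i)) /\ x = \sum_i b i * s i].

Definition ideal_pow (A : comNzRingType) (I : set A) (d : nat) : set A :=
  ideal_gen [set x | exists s : 'I_d -> A,
                       (forall j, I (s j)) /\ x = \prod_j s j].

Section LocallyFree.
Variables (A : comNzRingType) (M : lmodType A).

(* M[1/f] is free of rank r over A[1/f].  After multiplication by powers of   *)
(* f, a basis may be taken in the image of M; equalities in a localisation    *)
(* at f are equalities up to a power of f.                                    *)
Definition free_away (r : nat) (f : A) : Prop :=
  exists e : 'I_r -> M,
    (forall m, exists (n : nat) (a : 'I_r -> A),
       f ^+ n *: m = \sum_i a i *: e i) /\
    (forall (n : nat) (a : 'I_r -> A), f ^+ n *: (\sum_i a i *: e i) = 0 ->
       forall i, exists k : nat, f ^+ k * a i = 0).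

(* The open sets D(f), f in s, cover Spec A iff s generates the unit ideal.   *)
Definition locally_free (r : nat) : Prop :=
  exists s : set A, ideal_gen s 1 /\ forall f, s f -> free_away r f.

End LocallyFree.

(* Locally free sheaves of rank r on C.  Such a sheaf, with a basis of its    *)
(* generic stalk chosen, is the same as the family of its stalks inside the   *)
(* generic stalk Q^r, subject to: near each closed point there is a basis of  *)
(* Q^r that is an O_P-basis of the stalk at P.  Neighbourhoods are cofinite.  *)
Section Bundle.
Variables (F : finFieldType) (C : curve F) (r : nat).
Local Notation Q := (funfield C).

Definition local_span (P : place (base_emb C)) (e : 'M[Q]_r) : set 'rV[Q]_r :=
  [set v | exists2 a : 'rV[Q]_r,
             forall i, local_ring P (a ord0 i) & v = a *m e].

Record bundle := Bundle {
  stalk : place (base_emb C) -> set 'rV[Q]_r;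
  stalk_locally_free : forall P,
    exists (U : set (place (base_emb C))) (e : 'M[Q]_r),
    [/\ finite_set (~` U), U P, e \in unitmx
      & forall P', U P' -> stalk P' = local_span P' e] }.

Definition sections (B : bundle) (U : set (place (base_emb C))) :
    set 'rV[Q]_r :=
  [set v | forall P, U P -> stalk B P v].

(* The stalk of B(k.P) at P.                                                  *)
Definition twisted_stalk (B : bundle) (P : place (base_emb C)) (k : nat) :
    set 'rV[Q]_r :=
  [set v | exists2 t, ord P t = 1 & stalk B P (t ^+ k *: v)].

End Bundle.

(* Pure Anderson motives over L = F.  Here A_L = A and sigma^* is the         *)
(* identity, so sigma^* M = M and tau^l is the l-th iterate of tau.           *)
Section Motive.
Variables (F : finFieldType) (C : curve F).
Local Notation Q := (funfield C).
Local Notation A := (coord_ring C).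
Variable c : {rmorphism A -> F}.

Definition char_ideal : set A :=
  ideal_gen [set x | exists a : A, x = a - coord_cst C (c a)].

Section Conditions.
Variables (M : lmodType A) (tau : {linear M -> M}).

(* The classes of the e i form an F-basis of coker tau.                       *)
Definition coker_dim (d : nat) : Prop :=
  exists e : 'I_d -> M,
    (forall m, exists (a : 'I_d -> F) (m' : M),
       m = \sum_i coord_cst C (a i) *: e i + tau m') /\
    (forall (a : 'I_d -> F) (m' : M),
       \sum_i coord_cst C (a i) *: e i = tau m' -> forall i, a i = 0).

(* phi identifies M with the sections of B over C \ {oo}, and T is the map    *)
(* induced by tau on the generic stalk.                                       *)
Definition is_pure (r : nat) : Prop :=
  exists (B : bundle C r) (phi : {additive M -> 'rV[Q]_r}) (T : 'M[Q]_r),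
    [/\ forall (a : A) m, phi (a *: m) = coord_val a *: phi m,
        set_bij setT (sections B (affine_points C)) phi,
        forall m, phi (tau m) = phi m *m T
      & exists k l : nat, [/\ (0 < k)%N, (0 < l)%N
          & set_bij (stalk B (infty C)) (twisted_stalk B (infty C) k)
                    (fun v => v *m T ^+ l)]].

End Conditions.

Record motive := Motive {
  mot_mod :> lmodType A;
  tau : {linear mot_mod -> mot_mod};
  rank : nat;
  dimension : nat;
  mot_locally_free : locally_free mot_mod rank;
  tau_inj : injective tau;
  mot_coker_dim : coker_dim tau dimension;
  mot_char : forall a, ideal_pow char_ideal dimension a ->
    forall m, exists m', a *: m = tau m';
  mot_pure : is_pure tau rank }.

Definition is_hom (M N : motive) : pred (M -> N) :=
  fun f => `[< linear f /\ forall m, f (tau M m) = tau N (f m) >].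

Record hom (M N : motive) :=
  MotHom { hom_fun :> M -> N; hom_funP : hom_fun \in @is_hom M N }.

HB.instance Definition _ M N := [isSub for @hom_fun M N].
HB.instance Definition _ M N := [Choice of hom M N by <:].

Fact is_hom_submod_closed (M N : motive) : submod_closed (@is_hom M N).
Proof.
split.
  apply/asboolP; split; first by move=> a x y /=; rewrite scaler0 addr0.
  by move=> m; rewrite linear0.
move=> a f g /asboolP[flin ftau] /asboolP[glin gtau]; apply/asboolP; split.
  move=> b x y; rewrite !fctE flin glin !scalerDr !scalerA (mulrC b a).
  by rewrite addrACA.
by move=> m; rewrite !fctE ftau gtau linearP.
Qed.

HB.instance Definition _ (M N : motive) :=
  GRing.SubChoice_isSubLmodule.Build A (M -> N) (@is_hom M N) (hom M N)
    (GRing.submod_closed_semi (@is_hom_submod_closed M N)).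

Section Endo.
Variable M : motive.

Fact hom_id_subproof : id \in @is_hom M M.
Proof. by apply/asboolP; split. Qed.

Fact hom_comp_subproof (f g : hom M M) : (f \o g) \in @is_hom M M.
Proof.
have /asboolP[flin ftau] := hom_funP f; have /asboolP[glin gtau] := hom_funP g.
apply/asboolP; split=> [a x y|m] /=; first by rewrite glin flin.
by rewrite gtau ftau.
Qed.

Definition hom_id : hom M M := MotHom hom_id_subproof.
Definition hom_comp (f g : hom M M) : hom M M :=
  MotHom (hom_comp_subproof f g).

Fact hom_compA : associative hom_comp.
Proof. by move=> f g h; apply: val_inj. Qed.
Fact hom_comp1 : left_id hom_id hom_comp.
Proof. by move=> f; apply: val_inj. Qed.
Fact hom_comp1r : right_id hom_id hom_comp.
Proof. by move=> f; apply: val_inj. Qed.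
Fact hom_compDl : left_distributive hom_comp +%R.
Proof. by move=> f g h; apply: val_inj. Qed.
Fact hom_compDr : right_distributive hom_comp +%R.
Proof.
move=> f g h; apply: val_inj; apply/funext => m /=.
have /asboolP[flin _] := hom_funP f.
by have := flin 1 (g m) (h m); rewrite !scale1r.
Qed.

HB.instance Definition _ := GRing.Zmodule_isPzRing.Build (hom M M)
  hom_compA hom_comp1 hom_comp1r hom_compDl hom_compDr.

Fact frob_subproof : (tau M : M -> M) \in @is_hom M M.
Proof. by apply/asboolP; split=> // a x y; rewrite linearP. Qed.

Definition frob : hom M M := MotHom frob_subproof.

End Endo.

Definition isogeny (M N : motive) (f : hom M N) : Prop :=
  injective f /\ forall n : N, exists2 a : A, a != 0 & exists m, a *: n = f m.

Definition mot_isom (M N : motive) : Prop :=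
  exists f : hom M N, bijective f.

Definition is_zero (M : motive) : Prop := forall m : M, m = 0.

Definition factor_motive (M N : motive) : Prop :=
  exists f : hom M N, forall n, exists m, f m = n.

Definition simple_motive (M : motive) : Prop :=
  ~ is_zero M /\
  forall N, factor_motive M N -> is_zero N \/ mot_isom N M.

End Motive.

Notation endo M := (hom M M).

Definition field_norm (Q : fieldType) (E : fieldExtType Q) (x : E) : Q :=
  \det (passmx.mxof (vbasis {:E}) (vbasis {:E}) (amull x)).

Section Lattices.
Variables (F : finFieldType) (C : curve F).
Local Notation Q := (funfield C).
Local Notation A := (coord_ring C).
Variable E : fieldExtType Q.

Definition A_lattice (L : set E) : Prop :=
  exists (n : nat) (b : n.-tuple E),
    <<b>>%VS = fullv /\
    L = [set x | exists a : 'I_n -> A, x = \sum_i coord_val (a i) *: tnth b i].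

Definition A_order (R : set E) : Prop :=
  [/\ A_lattice R, R 1 & forall x y, R x -> R y -> R (x * y)].

Definition order_of (L : set E) : set E :=
  [set x | forall y, L y -> L (x * y)].

Definition lattice_iso (R L L' : set E) : Prop :=
  exists phi : E -> E,
    [/\ set_bij L L' phi,
        forall x y, L x -> L y -> phi (x + y) = phi x + phi y
      & forall a x, R a -> L x -> phi (a * x) = a * phi x].

Definition lattice_with_order (R L : set E) : Prop :=
  A_lattice L /\ order_of L = R.

End Lattices.

Section EndomorphismAlgebra.
Variables (F : finFieldType) (C : curve F).
Local Notation Q := (funfield C).
Local Notation A := (coord_ring C).
Variables (c : {rmorphism A -> F}) (M : motive c) (E : fieldExtType Q).
Variable j : {rmorphism endo M -> E}.

(* j exhibits E as End(M) (x)_A Q, the localisation of the A-algebra End(M)   *)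
(* at the nonzero elements of A; E and j are unique up to unique isomorphism. *)
Definition fraction_algebra : Prop :=
  [/\ forall (a : A) f, j (a *: f) = coord_val a *: j f,
      forall f, j f = 0 -> exists2 a : A, a != 0 & a *: f = 0
    & forall x : E, exists2 a : A, a != 0 &
        exists f, x = (coord_val a)^-1 *: j f].

(* f . End(M') . f^-1 in E, for an isogeny f : M' -> M.  The inverse of f is  *)
(* a^-1 g, for any g : M -> M' and nonzero a in A with f o g = a.             *)
Definition End_image (M' : motive c) (f : hom M' M) : set E :=
  [set x | exists (u : endo M') (a : A) (g : hom M M') (h : endo M),
     [/\ a != 0, forall m, f (g m) = a *: m, forall m, h m = f (u (g m))
       & x = (coord_val a)^-1 *: j h]].

Definition isogenous_with_End (R : set E) (M' : motive c) : Prop :=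
  exists f : hom M' M, isogeny f /\ End_image f = R.

End EndomorphismAlgebra.

(* Phi induces a bijection from the eX-classes of elements satisfying PX to   *)
(* the eY-classes of elements satisfying PY.                                  *)
Definition bijection_of_classes (X Y : Type)
    (PX : X -> Prop) (eX : X -> X -> Prop)
    (PY : Y -> Prop) (eY : Y -> Y -> Prop) (Phi : X -> Y) : Prop :=
  [/\ forall x, PX x -> PY (Phi x),
      forall x x', PX x -> PX x' -> (eX x x' <-> eY (Phi x) (Phi x'))
    & forall y, PY y -> exists2 x, PX x & eY (Phi x) y].

(* Main.v *)
(* A motive is an A-lattice in Q^r (sections of the bundle away from oo)      *)
(* together with a matrix T preserving it; purity at oo only involves T and   *)
(* the stalk at oo.  If the motive is simple, Q^r is irreducible under T,     *)
(* since for a T-stable subspace W the image of the lattice in Q^r / W is     *)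
(* again a pure motive.  Hence the characteristic polynomial of T is          *)
(* irreducible, E = Q[X]/(char_poly T) = Q(pi), Q^r is a line over E, and     *)
(* endomorphisms, which commute with T, are multiplications by elements of E. *)
(* Up to isomorphism the motives isogenous to M are thus the A-lattices in E  *)
(* stable under pi, isogenies being multiplications, and the endomorphism     *)
(* ring of such a motive is the order of its lattice.  That every pi-stable   *)
(* lattice is a motive with the right characteristic follows from             *)
(* Cayley-Hamilton, and N(pi)/pi lies in A[pi] for the same reason.           *)
(*                                                                            *)
(* The arithmetic of A rests on two facts: for a subring S of Q containing F  *)
(* and 0 != t in S, the quotient S/tS is finite; and every proper nonzero     *)
(* ideal of a subring containing F is dominated by a place, which Zorn's      *)
(* lemma and the first fact provide.  A non-constant element of A comes from  *)
(* purity: T has poles at oo, whereas its coefficients on M lie in A.         *)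

Require Import Defs.
From HB Require Import structures.
From mathcomp Require Import all_boot all_order all_algebra all_field.
From mathcomp Require Import boolp classical_sets functions cardinality.
From mathcomp Require Import ring zify.

Set Implicit Arguments.
Unset Strict Implicit.
Unset Printing Implicit Defensive.

Import Order.TTheory GRing.Theory Num.Theory.
Local Open Scope classical_set_scope.
Local Open Scope ring_scope.

(** * Function fields and their places *)

(** A motive over the finite field is linear algebra over A: its module is a lattice in Q^r and tau
    is a matrix T. [motive_motivic] extracts the pair, [motivic_realized] builds a motive from such
    a pair, and the purity condition involves T alone. A T-stable subspace W produces a factor
    motive in Q^r / W ([motivic_quotient]), so simplicity makes T irreducible
    ([simple_irreducible]), and [irreducible_field] identifies Q^r with a field E = Q(z) on which T
    is multiplication by z. Motives then become lattices in E ([embeds]). A homomorphism commutes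
    with z, hence is multiplication by an element of E ([hom_mult]); conversely every e with eL
    inside L' gives one ([mult_hom]). So endomorphisms commute, and they fill E after inverting A
    because every x in E sends a lattice into itself up to a factor from A ([A_lattice_scale]). The
    same commensurability makes any two motives embedded as lattices isogenous, and
    [isogeny_End_image] reads the endomorphism ring as the order of the lattice. That all z-stable
    lattices occur is [motivic_transfer]; [order_norm] treats N(pi)/pi, and [isogeny_classes] the
    bijection. The rest is arithmetic. The curve is given by its valuations only, so the Dedekind
    properties of A have to be established: fraction field Q, localisations equal to the local rings
    of C, finitely many zeros. All of them come from [finite_quotient] and [place_of_ideal], once
    [motive_infty_pole] has provided an element of A with a pole at infinity. *)

Lemma linear_dependence (F : fieldType) (I J : finType) (X : I -> J -> F) :
  (#|J| < #|I|)%N ->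
  exists u : I -> F, (exists i, u i != 0) /\ forall j, \sum_i u i * X i j = 0.
Proof.
move=> ltJI; pose B := \matrix_(i < #|I|, j < #|J|) X (enum_val i) (enum_val j).
have /rowV0Pn[v /sub_kermxP vB0 v0] : kermx B != 0.
  rewrite -mxrank_eq0 mxrank_ker -lt0n subn_gt0.
  exact: leq_ltn_trans (rank_leq_col B) ltJI.
exists (fun i => v 0 (enum_rank i)); split.
  have /rV0Pn[k vk0] := v0.
  by exists (enum_val k); rewrite enum_valK.
move=> j; have /rowP/(_ (enum_rank j)) := vB0; rewrite !mxE => vBj.
rewrite -[RHS]vBj (reindex (@enum_val I predT)) /=;
  last exact/onW_bij/enum_val_bij.
by apply: eq_bigr => i _; rewrite enum_valK !mxE enum_rankK.
Qed.

(** * Linear dependence over F[t] in a function field of one variable *)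

Section OneVariable.
Variables (F : finFieldType) (Q : fieldType) (emb : {rmorphism F -> Q}).
Hypothesis Q1 : one_variable emb.

Local Notation ev t p := (map_poly emb p).[t].

(** For transcendental [t] this bounds the degree of Q over F(t). After clearing denominators the
    products t^i z_j lie in spaces over F whose dimension grows by [m * e] with each further power
    of [t], so [m * e + 1] elements z_j give too many products to be independent. *)
Lemma finite_over_rational (t : Q) :
  exists n : nat, forall z : 'I_n -> Q, exists p : 'I_n -> {poly F},
    (exists i, p i != 0) /\ \sum_i ev t (p i) * z i = 0.
Proof.
case: Q1 => x [tr_x [m [b gen_b]]].
(* A space over F of dimension at most [m * s]: polynomial coordinates of degree below [s] on the
   generators [b]. *)
pose V s y := exists2 p : 'I_m -> {poly F},
  forall i, (size (p i) <= s)%N & y = \sum_i ev x (p i) * b i.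
have VW s s' y : (s <= s')%N -> V s y -> V s' y.
  by move=> le_ss' [p sp ->]; exists p => // i; exact: leq_trans (sp i) _.
have V0 s : V s 0.
  exists (fun=> 0) => [i|]; first by rewrite size_poly0.
  by rewrite big1 // => i _; rewrite rmorph0 horner0 mul0r.
have VD s y y' : V s y -> V s y' -> V s (y + y').
  move=> [p sp ->] [p' sp' ->]; exists (fun i => p i + p' i) => [i|].
    by rewrite (leq_trans (size_polyD _ _)) // geq_max sp sp'.
  by rewrite -big_split; apply: eq_bigr => i _ /=;
    rewrite rmorphD hornerD mulrDl.
have VM s e (q : {poly F}) y : (size q <= s)%N -> V e y ->
  V (s + e)%N (ev x q * y).
  move=> sq [p sp ->]; exists (fun i => q * p i) => [i|].
    rewrite (leq_trans (size_polyMleq _ _)) //.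
    by rewrite (leq_trans (leq_pred _)) // leq_add // sp.
  by rewrite big_distrr; apply: eq_bigr => i _ /=;
    rewrite rmorphM hornerM mulrA.
have common (I : finType) (y : I -> Q) :
    exists (q : {poly F}) e, [/\
      q != 0, (size q <= e)%N & forall i, V e (ev x q * y i)].
  have /choice[q /choice[p pP]] i := gen_b (y i).
  pose P := \prod_i q i.
  have Vi i : exists e, V e (ev x P * y i).
    have [qi0 qiE] := pP i.
    exists (\max_l size ((\prod_(j | j != i) q j * p i l) : {poly F})%R).
    exists (fun l => \prod_(j | j != i) q j * p i l) => [l|].
      exact: leq_bigmax.
    rewrite /P (bigD1 i) //= rmorphM hornerM mulrAC qiE mulrC big_distrr /=.
    by apply: eq_bigr => l _; rewrite [in RHS]rmorphM hornerM mulrA.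
  have {Vi}/choice[e eP] := Vi.
  exists P, (maxn (size P) (\max_i e i)); split; last 2 first.
  - exact: leq_maxl.
  - move=> i; apply: VW (eP i).
    by rewrite (leq_trans _ (leq_maxr _ _)) // (leq_bigmax i).
  - by apply/prodf_neq0 => i _; case: (pP i).
have [q [e [q0 sq Vtb]]] := common _ (fun i => t * b i).
(* Multiplication by [q t] raises the degree bound by a constant, which makes the growth linear. *)
have Vt s y : V s y -> V (s + e)%N (ev x q * t * y).
  case=> p sp ->; rewrite big_distrr /=.
  elim/big_ind: _ => [||i _]; [exact: V0|exact: VD|].
  rewrite mulrCA -[_ * _ * b i]mulrA; exact: VM.
exists (m * e).+1 => z; set n := (m * e).+1.
have [qz [ez [qz0 _ Vz]]] := common _ z.
(* With [D] powers of [t] there are [D * n] products in dimension [m * (ez + D * e)]; the difference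
   is [D - m * ez], positive for this choice. *)
pose D := (m * ez).+1.
have Vz_le k : forall i j, (i <= k)%N ->
    V (ez + k * e)%N (ev x (q ^+ k * qz) * (t ^+ i * z j)).
  elim: k => [|k IH] i j; first by rewrite leqn0 => /eqP->;
    rewrite !expr0 !mul1r addn0.
  rewrite leq_eqVlt mulSn addnCA exprS => /predU1P[->|lti].
    have -> : ev x (q * q ^+ k * qz) * (t ^+ k.+1 * z j) =
      ev x q * t * (ev x (q ^+ k * qz) * (t ^+ k * z j)).
      by rewrite exprS !rmorphM !hornerM; ring.
    by rewrite addnC; apply: Vt; exact: IH.
  by rewrite -mulrA rmorphM hornerM -mulrA; apply: VM => //; exact: IH.
have /choice[c cP] (ij : 'I_D * 'I_n) : exists c : 'I_m -> {poly F},
    (forall l, (size (c l) <= ez + D * e)%N) /\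
    ev x (q ^+ D * qz) * (t ^+ ij.1 * z ij.2) = \sum_l ev x (c l) * b l.
  have [p sp pE] := Vz_le D ij.1 ij.2 (ltnW (ltn_ord ij.1)).
  by exists p.
have [|u [[[i0 j0] /= u0] uP]] := @linear_dependence F
    ('I_D * 'I_n)%type ('I_m * 'I_(ez + D * e))%type
    (fun ij lk => (c ij lk.1)`_lk.2).
  rewrite !card_prod !card_ord /n /D; nia.
exists (fun j => \poly_(i < D) u (inord i, j)); split.
  exists j0; apply/eqP => /polyP/(_ i0);
    rewrite coef_poly ltn_ord coef0 inord_val.
  exact/eqP.
have nz : ev x (q ^+ D * qz) != 0 by apply: tr_x; rewrite mulf_neq0 ?expf_neq0.
apply: (mulfI nz); rewrite mulr0 big_distrr /=.
transitivity (\sum_ij emb (u (ij.1, ij.2)) * (ev x (q ^+ D * qz) * (t ^+ ij.1 *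
  z ij.2))).
  rewrite -(pair_bigA _ (fun i j => emb (u (i, j)) *
     (ev x (q ^+ D * qz) * (t ^+ i * z j)))) exchange_big /=.
  apply: eq_bigr => j _; rewrite poly_def rmorph_sum horner_sum.
  rewrite big_distrl big_distrr /=; apply: eq_bigr => i _.
  by rewrite map_polyZ map_polyXn hornerZ hornerXn inord_val; ring.
under eq_bigr do rewrite -surjective_pairing (cP _).2 big_distrr /=.
rewrite exchange_big /= big1 // => l _.
under eq_bigr do rewrite mulrA.
rewrite -big_distrl /=.
rewrite [X in X * _](_ : _ = 0) ?mul0r //.
transitivity (ev x (\sum_ij u ij *: c ij l)).
  by rewrite rmorph_sum horner_sum; apply: eq_bigr => ij _;
    rewrite /= map_polyZ hornerZ.
rewrite [X in map_poly _ X](_ : _ = 0) ?rmorph0 ?horner0 //.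
apply/polyP => k; rewrite coef0 coef_sum.
have [ltk|lek] := ltnP k (ez + D * e).
  rewrite -[RHS](uP (l, Ordinal ltk)); apply: eq_bigr => ij _.
  by rewrite coefZ.
rewrite big1 // => ij _; rewrite coefZ nth_default ?mulr0 //.
exact: leq_trans ((cP ij).1 l) lek.
Qed.

End OneVariable.

(** * Finiteness of S/tS for subrings S of the function field *)

Section Places.
Variables (F : finFieldType) (Q : fieldType) (emb : {rmorphism F -> Q}).
Hypothesis Q1 : one_variable emb.
Hypothesis Qc : alg_closed_in emb.

Local Notation ev t p := (map_poly emb p).[t].

Lemma transcendental (t : Q) (p : {poly F}) :
  (forall a, t <> emb a) -> p != 0 -> ev t p != 0.
Proof.
move=> tF p0; apply/negP => /eqP pt0.
by have [|a /tF] := Qc p0 (x := t); first exact/rootP.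
Qed.

Definition is_subring (S : set Q) : Prop :=
  [/\ S 1, forall x y, S x -> S y -> S (x - y)
    & forall x y, S x -> S y -> S (x * y)].

Definition is_ideal (S J : set Q) : Prop :=
  [/\ J `<=` S, J 0, forall x y, J x -> J y -> J (x - y)
    & forall x y, S x -> J y -> J (x * y)].

Section Subring.
Variable S : set Q.
Hypothesis Sr : is_subring S.

Lemma subring1 : S 1. Proof. by case: Sr. Qed.
Lemma subringB x y : S x -> S y -> S (x - y). Proof. by case: Sr => _ + _;
  exact. Qed.
Lemma subringM x y : S x -> S y -> S (x * y). Proof. by case: Sr => _ _;
  exact. Qed.
Lemma subring0 : S 0.
Proof. by rewrite -(subrr 1); apply: subringB; exact: subring1. Qed.
Lemma subringN x : S x -> S (- x).
Proof. by move=> Sx; rewrite -sub0r; apply: subringB => //;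
  exact: subring0. Qed.
Lemma subringD x y : S x -> S y -> S (x + y).
Proof. by move=> Sx Sy; rewrite -[y]opprK; apply: subringB => //;
  exact: subringN. Qed.
Lemma subringX x n : S x -> S (x ^+ n).
Proof.
move=> Sx; elim: n => [|n IH]; first exact: subring1.
by rewrite exprS; exact: subringM.
Qed.
Lemma subring_sum I r (P : pred I) f :
  (forall i, P i -> S (f i)) -> S (\sum_(i <- r | P i) f i).
Proof. by move=> Sf; apply: big_ind => //;
  [exact: subring0|exact: subringD]. Qed.
Lemma subring_prod I r (P : pred I) f :
  (forall i, P i -> S (f i)) -> S (\prod_(i <- r | P i) f i).
Proof. by move=> Sf; apply: big_ind => //;
  [exact: subring1|exact: subringM]. Qed.

Section Ideal.
Variable J : set Q.
Hypothesis Ji : is_ideal S J.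
Lemma idealS : J `<=` S. Proof. by case: Ji. Qed.
Lemma ideal0 : J 0. Proof. by case: Ji. Qed.
Lemma idealB x y : J x -> J y -> J (x - y). Proof. by case: Ji => _ _ + _;
  exact. Qed.
Lemma idealM x y : S x -> J y -> J (x * y). Proof. by case: Ji => _ _ _;
  exact. Qed.
Lemma idealMr x y : J x -> S y -> J (x * y).
Proof. by move=> Jx Sy; rewrite mulrC; exact: idealM. Qed.
Lemma idealN x : J x -> J (- x).
Proof. by move=> Jx; rewrite -sub0r; apply: idealB => //; exact: ideal0. Qed.
Lemma idealD x y : J x -> J y -> J (x + y).
Proof. by move=> Jx Jy; rewrite -[y]opprK; apply: idealB => //;
  exact: idealN. Qed.
Lemma ideal_sum I r (P : pred I) f :
  (forall i, P i -> J (f i)) -> J (\sum_(i <- r | P i) f i).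
Proof. by move=> Jf; apply: big_ind => //; [exact: ideal0|exact: idealD]. Qed.
End Ideal.

(* If z_1, ..., z_k in S are linearly independent over F modulo tS, then they *)
(* are linearly independent over F[t], so k is bounded.                       *)
Lemma finite_quotient t : (forall a, S (emb a)) -> S t -> t != 0 ->
  exists s : seq Q, forall y, S y -> exists2 z, z \in s & S z /\
    S ((y - z) / t).
Proof.
move=> SF St t0; have [n dep_n] := finite_over_rational Q1 t.
pose indep k := exists2 z : 'I_k -> Q, forall i, S (z i) &
  forall u : 'I_k -> F, S ((\sum_i emb (u i) * z i) / t) -> forall i, u i = 0.
have evE (p : {poly F}) : ev t p = t * ev t (drop_poly 1 p) + emb p`_0.
  rewrite -{1}[p](poly_take_drop 1) expr1 rmorphD rmorphM /= map_polyX hornerD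
    hornerM.
  rewrite hornerX addrC mulrC; congr (_ + _).
  have -> : take_poly 1 p = (p`_0)%:P.
    by apply/polyP => -[|i]; rewrite coef_take_poly coefC.
  by rewrite map_polyC hornerC.
have ltk_n k : indep k -> (k <= n)%N.
  move=> [z Sz z_indep]; rewrite leqNgt; apply/negP => ltnk.
  pose w (i : 'I_n) := z (widen_ord (ltnW ltnk) i).
  have Sw i : S (w i) by exact: Sz.
  have w_indep (u : 'I_n -> F) :
      S ((\sum_i emb (u i) * w i) / t) -> forall i, u i = 0.
    move=> Su i; have := z_indep (fun j => oapp u 0 (insub (j : nat))).
    rewrite (_ : \sum_i _ = \sum_i emb (u i) * w i).
      by move=> /(_ Su (widen_ord (ltnW ltnk) i)); rewrite valK.
    rewrite (bigID (fun j : 'I_k => j < n)%N) /= addrC big1 ?add0r; last first.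
      by move=> j /negPf ltjn; rewrite insubF // rmorph0 mul0r.
    rewrite (big_ord_narrow (ltnW ltnk)); apply: eq_bigr => j _.
    by rewrite valK.
  have [p [[i0 /negP pi0] pw]] := dep_n w; apply: pi0; apply/eqP.
  (* Induction on the degree: modulo [t] only the constant coefficients survive, independence kills
     them, and the remaining relation can be divided by [t]. *)
  suff H m : forall p : 'I_n -> {poly F}, (forall i, size (p i) <= m)%N ->
      \sum_i ev t (p i) * w i = 0 -> forall i, p i = 0.
    apply: (H (\max_i size (p i))%N) => // i.
    exact: (leq_bigmax (F := fun i => size (p i))).
  elim: m => [|m IH] {pw}p sp pw.
    by move=> i; apply/eqP; rewrite -size_poly_leq0.
  move=> i.
  have St_ev (q : {poly F}) : S (ev t q).
    rewrite (horner_coef_wide _ (leqnn _)); apply: subring_sum => k' _.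
    by rewrite coef_map /=; apply: subringM; [exact: SF|exact: subringX].
  have pw' : \sum_i emb (p i)`_0 * w i = - t * \sum_i ev t (drop_poly 1 (p i))
    * w i.
    apply/eqP; rewrite mulNr -addr_eq0 addrC; apply/eqP; rewrite -[RHS]pw.
    rewrite big_distrr -big_split /=; apply: eq_bigr => j _.
    by rewrite [in RHS]evE mulrDl mulrA.
  have p0 j : (p j)`_0 = 0.
    apply: (w_indep (fun j => (p j)`_0)).
    rewrite pw' mulNr mulrC mulrN mulKf //.
    by apply: subringN; apply: subring_sum => l _; exact: subringM.
  have dp0 : forall j, drop_poly 1 (p j) = 0.
    apply: IH => [j|]; first by rewrite size_drop_poly leq_subLR.
    apply: (mulfI t0); rewrite mulr0; apply/eqP; rewrite -oppr_eq0 -mulNr -pw'.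
    by rewrite big1 // => j _; rewrite p0 rmorph0 mul0r.
  rewrite -[p i](poly_take_drop 1) dp0 mul0r addr0.
  by apply/polyP => -[|j]; rewrite coef_take_poly coef0 ?p0.
have indep0 : exists k, `[< indep k >].
  by exists 0%N; apply/asboolP; exists (fun=> 0) => [_|u _ []//];
    exact: subring0.
case: (ex_maxnP indep0 (fun k Hk => ltk_n k (asboolW Hk))) =>
  k /asboolP[z Sz z_indep] max_k.
(* The representatives are the combinations over F of a maximal independent family, finitely many
   because F is finite. By maximality, [y] joined to the family satisfies a relation modulo tS, in
   which its own coefficient is nonzero. *)
exists [seq \sum_i emb (u i) * z i | u : {ffun 'I_k -> F}] => y Sy.
pose z' (j : 'I_k.+1) := oapp z y (unlift ord0 j).
have [u [Su [j /eqP uj]]] : exists u : 'I_k.+1 -> F,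
    S ((\sum_i emb (u i) * z' i) / t) /\ exists j, u j <> 0.
  apply: contrapT => H.
  suff /asboolP /max_k : indep k.+1 by rewrite ltnn.
  exists z' => [j|u Su j].
    by rewrite /z'; case: unliftP => [i _|_] /=; [exact: Sz|].
  by apply: contrapT => uj; apply: H; exists u; split=> //; exists j.
move: Su; rewrite big_ord_recl /z' unlift_none /=.
under eq_bigr do rewrite liftK /=.
move=> Su.
have u0 : u ord0 != 0.
  apply: contraNneq uj => u0; rewrite u0 rmorph0 mul0r add0r in Su.
  have {}Su := z_indep _ Su.
  by case: (unliftP ord0 j) => [l|] ->; rewrite ?Su ?u0.
have Eu0 : emb (u ord0) != 0 by rewrite fmorph_eq0.
exists (\sum_i emb (- u (lift ord0 i) / u ord0) * z i).
  apply/mapP; exists [ffun i => - u (lift ord0 i) / u ord0];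
    rewrite ?mem_enum //.
  by apply: eq_bigr => i _; rewrite ffunE.
split; first by apply: subring_sum => i _; exact: subringM.
have -> : (y - \sum_i emb (- u (lift ord0 i) / u ord0) * z i) / t =
    emb (u ord0)^-1 * ((emb (u ord0) * y + \sum_i emb (u (lift ord0 i)) * z i)
      / t).
  rewrite mulrA; congr (_ / _);
    rewrite mulrDr mulrA -rmorphM mulVf // rmorph1 mul1r.
  congr (_ + _); rewrite -sumrN big_distrr; apply: eq_bigr => i _ /=.
  by rewrite mulrA -rmorphM mulrC mulNr rmorphN mulrN opprK mulrC [_ / _]mulrC.
exact: subringM.
Qed.

(** Pigeonhole: two powers of [u] share a representative in the finite quotient S/tS. Where
    [1 - u^(k+1)] is invertible, this says that [t] divides a power of [u]. *)
Lemma power_congruence t u : (forall a, S (emb a)) -> S t -> t != 0 -> S u ->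
  exists i k, S (u ^+ i * (1 - u ^+ k.+1) / t).
Proof.
move=> SF St t0 Su; have [s sP] := finite_quotient SF St t0.
have /choice[r rP] k : exists z, [/\ z \in s, S z & S ((u ^+ k - z) / t)].
  by have [z zs []] := sP _ (subringX k Su); exists z.
pose f (k : 'I_(size s).+1) := r k.
have : ~~ injectiveb f.
  apply/negP => f_inj.
  have : (size (codom f) <= size s)%N.
    by apply: uniq_leq_size => // _ /codomP[i ->]; case: (rP i).
  by rewrite size_codom card_ord ltnn.
move=> /injectivePn[i [j neq_ij E]].
wlog lt_ij : i j neq_ij E / (i < j)%N.
  move=> H; case: (ltngtP i j) => [|lt_ji|/ord_inj eij]; first exact: H.
    by apply: (H j i) => //; rewrite eq_sym.
  by rewrite eij eqxx in neq_ij.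
have fE : r i = r j := E.
exists i, (j - i.+1)%N; have [_ _ Si] := rP i; have [_ _ Sj] := rP j.
have := subringB Si Sj; rewrite -mulrBl fE opprB addrA subrK.
by congr (S (_ / _)); rewrite mulrBr mulr1 -exprD subnSK // subnKC // ltnW.
Qed.

End Subring.
End Places.

(** * Chevalley's extension theorem: maximal pairs are valuation rings *)

Section PlaceExistence.
Variables (F : finFieldType) (Q : fieldType) (emb : {rmorphism F -> Q}).

Definition proper_pair (S J : set Q) : Prop :=
  [/\ is_subring S, is_ideal S J & ~ J 1].

Definition maximal_pair (S J : set Q) : Prop :=
  proper_pair S J /\ forall S' J', proper_pair S' J' ->
    S `<=` S' -> J `<=` J' -> S' `<=` S /\ J' `<=` J.

Lemma maximal_pair_exists (B I : set Q) : proper_pair B I ->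
  exists S J, [/\ maximal_pair S J, B `<=` S & I `<=` J].
Proof.
(* A pair is coded as one subset of Q x bool, the tag telling ring from ideal, so that Zorn's lemma
   for inclusion applies. *)
move=> BI; pose ring_part (X : set (Q * bool)) : set Q := [set x | X (x, true)].
pose ideal_part (X : set (Q * bool)) : set Q := [set x | X (x, false)].
pose good X := [/\ proper_pair (ring_part X) (ideal_part X),
  B `<=` ring_part X & I `<=` ideal_part X].
pose mk (S J : set Q) : set (Q * bool) :=
  [set x | if x.2 then S x.1 else J x.1].
have [|X [PX maxX]] := @Zorn_bigcup _ (fun X => X = set0 \/ good X).
  move=> FF FFg FFtot.
  have [/asboolP [X0 FX0 gX0]|/asboolPn none] :=
      boolP `[< exists2 X, FF X & good X >]; last first.
    left; rewrite -subset0 => x [X FX Xx].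
    have [X0|gX] := FFg X FX; first by rewrite X0 in Xx.
    by case: none; exists X.
  right; set U := \bigcup_(_ in _) _.
  have UP x y : U x -> U y -> exists X, [/\ FF X, good X, X x & X y].
    move=> [X FX Xx] [Y FY Yy].
    have gX : good X by have [X_0|//] := FFg X FX; rewrite X_0 in Xx.
    have gY : good Y by have [Y_0|//] := FFg Y FY; rewrite Y_0 in Yy.
    by have [XY|YX] := FFtot X Y FX FY; [exists Y|exists X]; split=> //;
      [exact: XY|exact: YX].
  have XU X x : FF X -> X x -> U x by move=> FX Xx; exists X.
  have [[Sr0 Ji0 J10] B0 I0] := gX0.
  split; [split; [split|split|]| |].
  - by apply: (XU X0) => //; exact: (subring1 Sr0).
  - move=> x y Ux Uy; have [X [FX [[Sr _ _] _ _] Xx Xy]] := UP _ _ Ux Uy.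
    by apply: (XU X) => //; exact: (subringB Sr).
  - move=> x y Ux Uy; have [X [FX [[Sr _ _] _ _] Xx Xy]] := UP _ _ Ux Uy.
    by apply: (XU X) => //; exact: (subringM Sr).
  - move=> x Ux; have [X [FX [[Sr Ji _] _ _] Xx _]] := UP _ _ Ux Ux.
    by apply: (XU X) => //; exact: (idealS Ji).
  - by apply: (XU X0) => //; exact: (ideal0 Ji0).
  - move=> x y Ux Uy; have [X [FX [[Sr Ji _] _ _] Xx Xy]] := UP _ _ Ux Uy.
    by apply: (XU X) => //; exact: (idealB Ji).
  - move=> x y Ux Uy; have [X [FX [[Sr Ji _] _ _] Xx Xy]] := UP _ _ Ux Uy.
    by apply: (XU X) => //; exact: (idealM Ji).
  - by move=> U1; have [X [FX [[Sr Ji X1] _ _] Xx _]] := UP _ _ U1 U1;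
    exact: X1.
  - by move=> x Bx; apply: (XU X0) => //; exact: B0.
  - by move=> x Ix; apply: (XU X0) => //; exact: I0.
have gmk S J : proper_pair S J -> B `<=` S -> I `<=` J -> good (mk S J) by [].
have {PX} gX : good X.
  case: PX => // X0; have := maxX (mk B I); case.
    rewrite X0; split; first exact: sub0set.
    by move=> /(_ (1, true)); apply; case: BI => -[].
  by right; exact: gmk.
have [XP BX IX] := gX.
exists (ring_part X), (ideal_part X); split=> //; split=> // S' J' S'P SS' JJ'.
apply: contrapT => H; apply: (maxX (mk S' J')); last first.
  by right; apply: gmk => //; [exact: subset_trans SS'|exact: subset_trans JJ'].
split; first by move=> [x []] Xx; [exact: SS'|exact: JJ'].
by move=> sub; apply: H; split=> x xS; exact: (sub (x, _)).
Qed.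

Section MaximalPair.
Variables S J : set Q.
Hypothesis SJ : maximal_pair S J.

Let Sr : is_subring S. Proof. by case: SJ => -[]. Qed.
Let Ji : is_ideal S J. Proof. by case: SJ => -[]. Qed.
Let J1 : ~ J 1. Proof. by case: SJ => -[]. Qed.

Definition adjoin (T : set Q) (w : Q) : set Q :=
  [set y | exists2 p : {poly Q}, (forall i, T p`_i) & y = p.[w]].

(** If 1 is not in J[w], the pair (S[w], J[w]) is proper and extends (S, J), so S[w] = S. *)
Lemma maximal_adjoin w : ~ adjoin J w 1 -> S w.
Proof.
move=> J1w.
have adjP : proper_pair (adjoin S w) (adjoin J w).
  split=> //; split.
  - exists 1; last by rewrite hornerC.
    by move=> i; rewrite coef1; case: eqP => _;
      [exact: subring1|exact: subring0].
  - move=> _ _ [p Sp ->] [q Sq ->]; exists (p - q);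
    last by rewrite hornerD hornerN.
    by move=> i; rewrite coefB; exact: subringB.
  - move=> _ _ [p Sp ->] [q Sq ->]; exists (p * q); last by rewrite hornerM.
    by move=> i; rewrite coefM; apply: subring_sum => // k _; exact: subringM.
  - by move=> _ [p Jp ->]; exists p => // i; exact: (idealS Ji).
  - by exists 0; [move=> i; rewrite coef0; exact: (ideal0 Ji)|rewrite horner0].
  - move=> _ _ [p Sp ->] [q Sq ->]; exists (p - q);
    last by rewrite hornerD hornerN.
    by move=> i; rewrite coefB; exact: (idealB Ji).
  - move=> _ _ [p Sp ->] [q Sq ->]; exists (p * q); last by rewrite hornerM.
    by move=> i; rewrite coefM; apply: (ideal_sum Ji) => // k _;
      exact: (idealM Ji).
have cstP T x : T 0 -> T x -> adjoin T w x.
  by move=> T0 Tx; exists x%:P; [move=> [|i]; rewrite coefC|rewrite hornerC].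
have [||sub _] := SJ.2 _ _ adjP.
- by move=> x; apply: cstP; exact: subring0.
- by move=> x; apply: cstP; exact: (ideal0 Ji).
apply: sub; exists 'X; last by rewrite hornerX.
by move=> i; rewrite coefX; case: eqP => _; [exact: subring1|exact: subring0].
Qed.

(** Otherwise 1 is a polynomial in 1/(1 - j) with coefficients in J; clearing denominators puts a
    power of 1 - j into J, although it is congruent to 1 modulo J. *)
Lemma maximal_unit j : J j -> 1 - j != 0 /\ S (1 - j)^-1.
Proof.
move=> Jj; have j1 : 1 - j != 0 by rewrite subr_eq0; apply: contra_notN J1 =>
  /eqP->.
split=> //; apply: maximal_adjoin => -[p Jp p1].
have S1j : S (1 - j) by apply: subringB => //;
  [exact: subring1|exact: (idealS Ji)].
have JX n : J (1 - (1 - j) ^+ n).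
  elim: n => [|n IH]; first by rewrite subrr; exact: (ideal0 Ji).
  have -> : 1 - (1 - j) ^+ n.+1 = (1 - (1 - j) ^+ n) + (1 - j) ^+ n * j.
    by rewrite exprS; ring.
  by apply: (idealD Ji) => //; apply: (idealM Ji) => //; exact: subringX.
have : J ((1 - j) ^+ (size p)).
  rewrite -[X in J X]mulr1 [X in _ * X]p1 horner_coef big_distrr /=.
  apply: (ideal_sum Ji) => i _.
  rewrite mulrCA exprVn -expfB_cond; last by rewrite (negPf j1);
    exact: (ltnW (ltn_ord i)).
  by apply: (idealMr Ji) => //; exact: subringX.
move=> Jp'; apply: J1; rewrite -[1](subrK ((1 - j) ^+ size p)).
exact: (idealD Ji).
Qed.

(** J + Sz is strictly larger than J, so it contains 1 by maximality; a multiple of z is then of the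
    form 1 - a with a in J, which is a unit. Thus S is local with maximal ideal J. *)
Lemma maximal_inv z : S z -> ~ J z -> S z^-1.
Proof.
move=> Sz Jz; pose J' :=
  [set x | exists2 a, J a & exists2 s, S s & x = a + s * z].
have [[a Ja [s Ss E]]|J'1] := pselect (J' 1).
  have [a1 Sa1] := maximal_unit Ja.
  have E' : 1 - a = s * z by rewrite {1}E addrC addKr.
  have z0 : z != 0 by apply: contra_neq a1 => z0; rewrite E' z0 mulr0.
  have -> : z^-1 = s * (1 - a)^-1.
    have s0 : s != 0 by apply: contra_neq a1 => s0; rewrite E' s0 mul0r.
    by rewrite E' invfM mulVKf.
  exact: subringM.
case: Jz.
have [|//|x Jx|_] := SJ.2 S J'; last 1 first.
- by apply; exists 0; [exact: (ideal0 Ji)|exists 1;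
  [exact: subring1|rewrite mul1r add0r]].
- split=> //; split.
  + move=> _ [b Jb [s Ss ->]]; apply: subringD => //; first exact: (idealS Ji).
    exact: subringM.
  + exists 0; first exact: (ideal0 Ji).
    by exists 0; [exact: subring0|rewrite mul0r addr0].
  + move=> _ _ [b Jb [s Ss ->]] [c Jc [u Su ->]].
    exists (b - c); first exact: (idealB Ji).
    by exists (s - u); [exact: subringB|ring].
  + move=> x _ Sx [c Jc [u Su ->]].
    exists (x * c); first exact: (idealM Ji).
    by exists (x * u); [exact: subringM|ring].
- by exists x => //; exists 0; [exact: subring0|rewrite mul0r addr0].
Qed.

(** If neither z nor 1/z is in S, then 1 lies in both J[z] and J[1/z]. Of the two relations, the one
    of smaller degree removes the leading term of the other, which is impossible forever; the
    induction is on the sum of the sizes. *)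
Lemma maximal_total z : S z \/ S z^-1.
Proof.
suff H n : forall (p q : {poly Q}) z, (size p + size q <= n)%N ->
    (forall i, J p`_i) -> (forall i, J q`_i) -> p.[z] = 1 -> q.[z^-1] = 1 ->
      False.
  have [[p Jp p1]|/maximal_adjoin] := pselect (adjoin J z 1); last by left.
  have [[q Jq q1]|/maximal_adjoin] := pselect (adjoin J z^-1 1); last by right.
  by case: (H _ p q z (leqnn _)).
elim: n => [|n IH] p q {}z.
  rewrite leqn0 addn_eq0 size_poly_eq0 => /andP[/eqP-> _ _ _].
  by rewrite horner0 => /esym/eqP; rewrite oner_eq0.
wlog le_qp : p q z / (size q <= size p)%N.
  move=> H; have [|/ltnW] := leqP (size q) (size p); first exact: H.
  by move=> le_pq spq Jp Jq p1 q1; apply: (H q p z^-1); rewrite ?invrK // addnC.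
move=> spq Jp Jq p1 q1.
have [u0 Su] := maximal_unit (Jq 0%N).
case sp : (size p) => [|m].
  by move/eqP: sp p1; rewrite size_poly_eq0 => /eqP->; rewrite horner0 =>
    /esym/eqP; rewrite oner_eq0.
case: m sp => [|m] sp.
  by apply: J1; rewrite -p1 (horner_coef_wide _ (leqnn _)) sp big_ord1 mulr1.
have z0 : z != 0.
  apply/eqP => z0; apply: J1; rewrite -p1 z0.
  by rewrite horner_coef0.
pose c := p`_m.+1; set u := (1 - q`_0)^-1 in Su.
(* The relation q(1/z) = 1, multiplied by z^(m+1) and divided by the unit 1 - q_0, writes the
   leading term of p(z) through lower powers of z with coefficients in J. *)
pose r := \poly_(i < m.+1) (u * c * q`_(m.+1 - i)).
have rz : r.[z] = c * z ^+ m.+1.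
  have E : (1 - q`_0) * z ^+ m.+1 = \sum_(i < m.+1) q`_(m.+1 - i) * z ^+ i.
    have qz : \sum_(i < m.+2) q`_i * z ^- i = 1.
      rewrite -[RHS]q1 (@horner_coef_wide _ m.+2) -?sp //.
      by apply: eq_bigr => i _; rewrite exprVn.
    rewrite big_ord_recl expr0 invr1 mulr1 in qz.
    rewrite -{1}qz addrC addKr big_distrl (reindex_inj rev_ord_inj) /=.
    apply: eq_bigr => i _; rewrite /bump leq0n add1n subSS -subSn ?leq_ord //.
    rewrite -mulrA; congr (_ * _).
    have le_im : (i <= m.+1)%N by exact: ltnW.
    by rewrite -[in X in _ * X](subnK le_im) exprD mulKf ?expf_neq0.
  have -> : c * z ^+ m.+1 = u * c * ((1 - q`_0) * z ^+ m.+1).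
    by rewrite mulrA [u * c]mulrC -[c * u * _]mulrA mulVf ?mulr1.
  by rewrite horner_poly E big_distrr; apply: eq_bigr => i _ /=; rewrite mulrA.
have ltr : (size r <= m.+1)%N by exact: size_poly.
have Jr i : J r`_i.
  rewrite coef_poly; case: ifP => _; last exact: (ideal0 Ji).
  apply: (idealM Ji) => //; apply: subringM => //; exact/(idealS Ji)/Jp.
apply: (IH (take_poly m.+1 p + r) q z) => //.
- rewrite -ltnS; apply: leq_trans spq; rewrite sp addSn ltnS leq_add2r.
  rewrite (leq_trans (size_polyD _ _)) // geq_max ltr andbT.
  exact: size_take_poly.
- move=> i; rewrite coefD; apply: (idealD Ji) => //.
  by rewrite coef_take_poly; case: ifP => // _; exact: (ideal0 Ji).
- rewrite hornerD rz -p1 -[in RHS](poly_take_drop m.+1 p) hornerD hornerM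
  hornerXn.
  congr (_ + _ * _).
  rewrite (@size1_polyC _ (drop_poly m.+1 p)) ?hornerC ?coef_drop_poly //.
  by rewrite size_drop_poly sp subSn // subnn.
Qed.

End MaximalPair.
End PlaceExistence.

(** * Discreteness: a maximal pair yields a place *)

Section PlaceOfMaximalPair.
Variables (F : finFieldType) (Q : fieldType) (emb : {rmorphism F -> Q}).
Hypothesis Q1 : one_variable emb.
Hypothesis Qc : alg_closed_in emb.
Variables (S J : set Q) (t : Q).
Hypothesis SJ : maximal_pair S J.
Hypothesis SF : forall a, S (emb a).
Hypotheses (Jt : J t) (t0 : t != 0).

Local Notation ev t p := (map_poly emb p).[t].

Let Sr : is_subring S. Proof. by case: SJ => -[]. Qed.
Let Ji : is_ideal S J. Proof. by case: SJ => -[]. Qed.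
Let J1 : ~ J 1. Proof. by case: SJ => -[]. Qed.
Let SJx x : J x -> S x. Proof. exact: (idealS Ji). Qed.

Let JnotS x : J x -> x != 0 -> ~ S x^-1.
Proof. by move=> Jx x0 /(idealM Ji)/(_ Jx); rewrite mulVf. Qed.

Let tF a : t <> emb a.
Proof.
move=> E; apply: (JnotS Jt t0); rewrite E -fmorphV; exact: SF.
Qed.

(** By finiteness of S/tS, J is generated by [t] and finitely many representatives; in a valuation
    ring one of these divides all the others. *)
Lemma uniformizer_exists :
  exists u, [/\ J u, u != 0 & forall w, J w -> S (w / u)].
Proof.
have [s sP] := finite_quotient Q1 Sr SF (SJx Jt) t0.
have minl l : all (fun z => z != 0) (t :: l) ->
    exists2 u, u \in t :: l & forall w, w \in t :: l -> S (w / u).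
  elim: l => [|z l IH] /=.
    move=> _; exists t; rewrite ?mem_head // => w; rewrite inE => /eqP->.
    by rewrite divff //; exact: subring1.
  move=> /and3P[_ z0 l0]; have [|u ul umin] := IH; first by rewrite /= t0.
  have [zu|uz] := maximal_total SJ (z / u).
    exists u => [|w]; first by move: ul; rewrite !inE => /orP[->|->];
      rewrite ?orbT.
    rewrite !inE orbCA => /orP[/eqP-> //|wl]; apply: umin; by rewrite inE.
  exists z => [|w]; first by rewrite !inE eqxx orbT.
  have u0 : u != 0 by apply: (allP (_ : all (fun z => z != 0) (t :: l))) =>
    //=; rewrite t0.
  rewrite !inE orbCA => /orP[/eqP->|wl]; first by rewrite divff //;
    exact: subring1.
  have -> : w / z = (w / u) * (z / u)^-1 by rewrite invf_div mulrA divfK.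
  by apply: (subringM Sr) => //; apply: umin; rewrite inE.
have [|u ul umin] := minl [seq z <- s | (z != 0) && `[< J z >]].
  by rewrite /= t0; apply/allP => z; rewrite mem_filter => /andP[/andP[]].
have /andP[u0 Ju] : (u != 0) && `[< J u >].
  move: ul; rewrite inE mem_filter => /orP[/eqP->|/andP[]//].
  by rewrite t0; exact/asboolP.
exists u; split=> //; first exact/asboolP.
move=> w Jw; have [z zs [Sz Swz]] := sP w (SJx Jw).
have tu : S (t / u) by apply: umin; rewrite mem_head.
have -> : w / u = (w - z) / t * (t / u) + z / u.
  by rewrite mulrA divfK // mulrBl subrK.
apply: (subringD Sr); first exact: (subringM Sr).
have [->|z0] := eqVneq z 0; first by rewrite mul0r; exact: subring0.
apply: umin; rewrite inE mem_filter zs z0 /= andbT; apply/orP; right;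
  apply/asboolP.
rewrite -[z](subKr w); apply: (idealB Ji) => //.
by rewrite -(divfK t0 (w - z)); exact: (idealM Ji).
Qed.

Lemma place_of_maximal_pair :
  exists P : place emb, S `<=` local_ring P /\ J `<=` max_ideal P.
Proof.
have [u [Ju u0 uP]] := uniformizer_exists.
have Su := SJx Ju; have uVS := JnotS Ju u0.
(* Here 1 - u^(k+1) is a unit because [u] lies in J, so the power congruence makes [t] divide a
   power of [u]. *)
have [e te] : exists e, S (u ^+ e / t).
  have [i [k Sik]] := power_congruence Q1 Sr SF (SJx Jt) t0 Su.
  exists i; have Juk : J (u ^+ k.+1).
    by rewrite exprS; apply: (idealMr Ji) => //; exact: subringX.
  have [n1 /(subringM Sr Sik)] := maximal_unit SJ Juk.
  by rewrite [_ * _ / t]mulrAC mulfK.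
have Sev (p : {poly F}) : S (ev t p).
  rewrite (horner_coef_wide _ (leqnn _)); apply: (subring_sum Sr) => k' _.
  by rewrite coef_map; apply: (subringM Sr);
    [exact: SF|exact/(subringX Sr)/SJx].
(* A polynomial in [t] with nonzero constant term is a unit of S; otherwise a factor [t] splits
   off. *)
have poly_div (p : {poly F}) : p != 0 -> exists k, S (t ^+ k / ev t p).
  elim/poly_ind: p => [|p c IH]; first by rewrite eqxx.
  rewrite rmorphD rmorphM /= map_polyX map_polyC hornerD hornerM hornerX
    hornerC.
  have [->|c0 _] := eqVneq c 0; last first.
    exists 0%N; rewrite expr0 div1r.
    have Ec0 : emb c != 0 by rewrite fmorph_eq0.
    have J' : J (- (emb c^-1 * (ev t p * t))).
      by apply: (idealN Ji); do 2!apply: (idealM Ji) => //.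
    have [_ ] := maximal_unit SJ J'; rewrite opprK => /(subringM Sr (SF c^-1)).
    by congr (S _); rewrite !fmorphV -invfM mulrDr mulr1 mulVKf // addrC.
  rewrite polyC0 (raddf0 emb) !addr0 => pX0; have [|k kP] := IH.
    by apply: contra_neq pX0 => ->; rewrite mul0r.
  by exists k.+1; rewrite exprSr invfM mulrACA divff // mulr1.
(* In a relation over F[t] between powers of [q], the lowest nonzero coefficient is divisible by
   [q]; it divides a power of [t], hence a power of [u]. So no element has infinite order. *)
have upow q : S q -> q != 0 -> exists K, S (u ^+ K / q).
  move=> Sq q0; have [n /(_ (fun i : 'I_n => q ^+ i))] :=
    finite_over_rational Q1 t.
  case=> p [[i0 pi0] pq].
  pose nz k := oapp (fun j : 'I_n => p j != 0) false (insub k).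
  have ex_i : exists k, nz k by exists i0; rewrite /nz valK.
  case: (ex_minnP ex_i) => k; rewrite {1}/nz; case: insubP =>
    //= j _ jk pj minj.
  have [K KP] := poly_div _ pj.
  have Sp : S (ev t (p j) / q).
    have jn := ltn_ord j.
    have E : ev t (p j) = - q * \sum_(i < n | (j < i)%N) ev t (p i) * q ^+ (i -
      j.+1).
      apply: (mulIf (expf_neq0 j q0)).
      rewrite mulNr mulNr mulrAC -exprS big_distrr /=; apply/eqP;
        rewrite -addr_eq0.
      apply/eqP; rewrite -[RHS]pq [RHS](bigD1 j) //=; congr (_ + _).
      rewrite [RHS](bigID (fun i : 'I_n =>
        (j < i)%N)) /= [X in _ = _ + X]big1 ?addr0.
        apply: eq_big => [i|i lt_ji]; last first.
          by rewrite mulrCA -exprD subnKC.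
        rewrite andbC; case: ltnP => //= lt_ji; apply/esym.
        by apply: contraTneq lt_ji => ->; rewrite ltnn.
      move=> i /andP[neq_ij]; rewrite -leqNgt leq_eqVlt =>
        /predU1P[/ord_inj eij|lt_ij].
        by rewrite eij eqxx in neq_ij.
      have [->|pi] := eqVneq (p i) 0; first by rewrite rmorph0 horner0 mul0r.
      have := minj i; rewrite /nz valK /= pi => /(_ isT);
        rewrite leqNgt -jk lt_ij //.
    rewrite {1}E mulrAC mulNr divff // mulN1r; apply: (subringN Sr).
    by apply: (subring_sum Sr) => i _; apply: (subringM Sr) => //;
      exact: subringX.
  exists (e * K)%N.
  have -> : u ^+ (e * K) / q = (u ^+ e / t) ^+ K * (t ^+ K / ev t (p j)) * (ev
    t (p j) / q).
    have pj0 : ev t (p j) != 0 by exact: transcendental.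
    by rewrite expr_div_n -exprM !mulrA !divfK ?expf_neq0.
  apply: (subringM Sr); last exact: Sp.
  apply: (subringM Sr); last exact: KP.
  exact: (subringX Sr).
(* This says that [q] is u^n times a unit of S, so [n] is the order of [q] at the place under
   construction. *)
pose V q (n : int) := S (q / u ^ n) /\ S (u ^ n / q).
have uz n : u ^ n != 0 by exact: expfz_neq0.
have VC q n : q != 0 -> V q n -> forall m, S (q / u ^ m) <-> m <= n.
  move=> q0 [Vqn Vnq] m; split=> [Sm|le_mn].
    rewrite leNgt; apply/negP => lt_nm; apply: uVS.
    have := subringM Sr Sm Vnq.
    rewrite [q / _]mulrC mulrACA divff // mulr1 invr_expz -expfzDr //.
    move=> /(subringM Sr (subringX Sr (absz (m - n - 1)%R) Su)); congr (S _).
    rewrite -[u ^+ _]/(u ^ (absz (m - n - 1)%R : int)) gez0_abs; last by lia.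
    rewrite -expfzDr // -exprN1; congr (_ ^ _); by lia.
  have -> : q / u ^ m = q / u ^ n * u ^ (n - m).
    by rewrite expfzDr // mulrA divfK // invr_expz.
  apply: (subringM Sr) => //; have [k ->] : exists k : nat, n - m = k.
    by exists (absz (n - m)%R); rewrite gez0_abs // subr_ge0.
  exact: subringX.
have V_ex q : q != 0 -> exists n, V q n.
  suff VS q' : S q' -> q' != 0 -> exists n, V q' n.
    move=> q0; have [/VS|/VS] := maximal_total SJ q; first exact.
    rewrite invr_eq0 => /(_ q0)[n [V1 V2]]; exists (- n); split.
      by rewrite -invr_expz invrK mulrC -[q]invrK.
    by rewrite -invr_expz -invfM mulrC invfM.
  move=> Sq' q'0; have [K SK] := upow q' Sq' q'0.
  have exk : exists k, ~~ `[< S (q' / u ^+ k.+1) >].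
    exists K; apply/asboolPn => /(subringM Sr SK) SS; apply: uVS.
    by move: SS; rewrite mulrA divfK // exprS invfM mulrCA divff ?mulr1
      ?expf_neq0.
  case: (ex_minnP exk) => k /asboolPn Sk mink; exists (k : int).
  have Sk' : S (q' / u ^+ k).
    case: k Sk mink => [|k] _ mink; first by rewrite expr0 divr1.
    by apply: contrapT => /asboolPn/mink; rewrite ltnn.
  split=> //; rewrite -invf_div; apply: (maximal_inv SJ) => // /uP.
  by rewrite -mulrA -invfM -exprSr.
have /choice[o oP] q : exists n, (q = 0 -> n = 0) /\ (q != 0 -> V q n).
  have [->|q0] := eqVneq q 0; first by exists 0.
  by have [n Vn] := V_ex q q0; exists n; split=> // q_0; rewrite q_0 eqxx in q0.
have oV q : q != 0 -> V q (o q) by case: (oP q).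
have oC q : q != 0 -> forall m, S (q / u ^ m) <-> m <= o q.
  by move=> q0; exact: VC (oV q q0).
have o_uniq q n : q != 0 -> V q n -> n = o q.
  move=> q0 Vn; apply/eqP; rewrite eq_le; apply/andP; split.
    by apply/(oC q q0); case: Vn.
  by apply/(VC _ _ q0 Vn); case: (oV q q0).
have o0 : o 0 = 0 by case: (oP 0) => + _; exact.
have ocst (a : F) : o (emb a) = 0.
  have [->|a0] := eqVneq a 0; first by rewrite rmorph0.
  apply/esym/o_uniq; first by rewrite fmorph_eq0.
  by rewrite /V expr0z divr1 div1r -fmorphV; split; exact: SF.
have omul x y : x != 0 -> y != 0 -> o (x * y) = o x + o y.
  move=> x0 y0; apply/esym/o_uniq; first by rewrite mulf_neq0.
  have [x1 x2] := oV x x0; have [y1 y2] := oV y y0.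
  by rewrite /V expfzDr // -!mulf_div; split; exact: (subringM Sr).
have oadd x y : x != 0 -> y != 0 -> x + y != 0 ->
  Num.min (o x) (o y) <= o (x + y).
  move=> x0 y0 xy0; apply/(oC _ xy0); rewrite mulrDl.
  by apply: (subringD Sr); [apply/(oC _ x0)|apply/(oC _ y0)];
    rewrite ge_min lexx ?orbT.
have oonto : exists2 x, x != 0 & o x = 1.
  by exists u => //; apply/esym/o_uniq => //; rewrite /V expr1z divff //;
    split; exact: (subring1 Sr).
exists (Place o0 ocst omul oadd oonto); split=> x.
  move=> Sx; rewrite /local_ring /=; have [->|x0] := eqVneq x 0;
    first by rewrite o0.
  by apply/(oC _ x0); rewrite expr0z divr1.
move=> Jx; rewrite /max_ideal /=; have [->|x0] := eqVneq x 0; [by left|right].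
by rewrite -[_ < _]/(1 <= o x); apply/(oC _ x0); rewrite expr1z; exact: uP.
Qed.
End PlaceOfMaximalPair.

Section PlaceOfIdeal.
Variables (F : finFieldType) (Q : fieldType) (emb : {rmorphism F -> Q}).
Hypothesis Q1 : one_variable emb.
Hypothesis Qc : alg_closed_in emb.

Theorem place_of_ideal (B I : set Q) (t : Q) :
  is_subring B -> (forall a, B (emb a)) -> is_ideal B I -> ~ I 1 -> I t ->
    t != 0 ->
  exists P : place emb, B `<=` local_ring P /\ I `<=` max_ideal P.
Proof.
move=> Br BF Ii I1 It t0.
have [S [J [SJ BS IJ]]] := maximal_pair_exists (And3 Br Ii I1).
have [P [SP JP]] := place_of_maximal_pair Q1 Qc SJ (fun a =>
  BS _ (BF a)) (IJ _ It) t0.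
by exists P; split; [exact: subset_trans SP|exact: subset_trans JP].
Qed.

End PlaceOfIdeal.

(** * The coordinate ring *)

Lemma count_lt (T : eqType) (p q : pred T) (s : seq T) (z : T) :
  (forall x, p x -> q x) -> z \in s -> q z -> ~~ p z ->
  (count p s < count q s)%N.
Proof.
move=> pq zs qz pz; elim: s zs => //= x s IH; rewrite inE => /predU1P[<-|zs].
  by rewrite qz (negPf pz) add0n add1n ltnS sub_count.
by rewrite -addnS leq_add ?IH //; case: (p x) (pq x) => // ->.
Qed.

(** * Local rings and maximal ideals of places *)

Section PlaceTheory.
Variables (F : finFieldType) (C : curve F).
Local Notation Q := (funfield C).
Implicit Types P : place (base_emb C).

Lemma ord_inv P x : x != 0 -> ord P x^-1 = - ord P x.
Proof.
move=> x0; apply/eqP; rewrite -addr_eq0 -ord_mul ?invr_eq0 //.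
by rewrite mulVf // ord_one.
Qed.

Lemma ord_exp P x n : ord P (x ^+ n) = ord P x *+ n.
Proof.
have [->|x0] := eqVneq x 0.
  by rewrite expr0n; case: n => [|n] /=; rewrite ?ord_one ?ord_zero ?mul0rn.
elim: n => [|n IH]; first by rewrite expr0 ord_one.
by rewrite exprS ord_mul ?expf_neq0 // IH mulrS.
Qed.

Lemma local_ring_subring P : is_subring (local_ring P).
Proof.
split.
- by rewrite /local_ring /= ord_one.
- move=> x y; rewrite /local_ring /= => ox oy.
  have [->|x0] := eqVneq x 0; first by rewrite add0r ord_opp.
  have [->|y0] := eqVneq y 0; first by rewrite subr0.
  have [->|xy0] := eqVneq (x - y) 0; first by rewrite ord_zero.
  have ny0 : - y != 0 by rewrite oppr_eq0.
  by apply: le_trans (ord_add P x0 ny0 xy0); rewrite ord_opp le_min ox.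
- move=> x y; rewrite /local_ring /= => ox oy.
  have [->|x0] := eqVneq x 0; first by rewrite mul0r ord_zero.
  have [->|y0] := eqVneq y 0; first by rewrite mulr0 ord_zero.
  by rewrite ord_mul // addr_ge0.
Qed.

Lemma max_ideal_ideal P : is_ideal (local_ring P) (max_ideal P).
Proof.
split.
- by move=> x [->|/ltW//]; exact: (subring0 (local_ring_subring P)).
- by left.
- move=> x y [->|ox] [->|oy]; rewrite ?subr0 ?sub0r; [by left|right|right|].
  + by rewrite ord_opp.
  + by [].
  have [xy0|xy0] := eqVneq (x - y) 0; [by left|right].
  have [x0|x0] := eqVneq x 0; first by rewrite x0 sub0r ord_opp.
  have [y0|y0] := eqVneq y 0; first by rewrite y0 subr0.
  have ny0 : - y != 0 by rewrite oppr_eq0.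
  by apply: lt_le_trans (ord_add P x0 ny0 xy0); rewrite ord_opp lt_min ox.
- move=> x y ox [->|oy]; first by rewrite mulr0; left.
  have [->|x0] := eqVneq x 0; first by rewrite mul0r; left.
  have [->|y0] := eqVneq y 0; first by rewrite mulr0; left.
  by right; rewrite ord_mul // ltr_wpDl.
Qed.

Lemma max_ideal_proper P : ~ max_ideal P 1.
Proof. by move=> [/eqP|]; rewrite ?oner_eq0 // ord_one. Qed.

Lemma local_ring_unit P x : local_ring P x -> ~ max_ideal P x ->
  [/\ x != 0, ord P x = 0 & local_ring P x^-1].
Proof.
move=> ox nmx; have x0 : x != 0 by apply/eqP => x0; apply: nmx; left.
have ox0 : ord P x = 0.
  by apply/eqP; rewrite eq_le ox andbT leNgt; apply/negP => ?; apply: nmx;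
    right.
by split=> //; rewrite /local_ring /= ord_inv // ox0.
Qed.

Lemma max_idealV P x : ~ local_ring P x -> x != 0 /\ max_ideal P x^-1.
Proof.
move=> nox; have x0 : x != 0.
  by apply/eqP => x0; apply: nox; rewrite x0;
    exact: (subring0 (local_ring_subring P)).
split=> //; right; rewrite ord_inv // oppr_gt0 ltNge; exact/negP.
Qed.

Lemma max_ideal_prime P x y : local_ring P x -> local_ring P y ->
  max_ideal P (x * y) -> max_ideal P x \/ max_ideal P y.
Proof.
move=> ox oy mxy; have [|nmx] := pselect (max_ideal P x); [by left|right].
have [x0 _ oxV] := local_ring_unit ox nmx.
by rewrite -(mulKf x0 y); exact: (idealM (max_ideal_ideal P)).
Qed.

Lemma place_eq P P' : (forall x, ord P x = ord P' x) -> P = P'.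
Proof.
case: P P' => [o a1 a2 a3 a4 a5] [o' b1 b2 b3 b4 b5] /= /funext oo'.
by case: _ / oo' in b1 b2 b3 b4 b5 *; congr Place; exact: Prop_irrelevance.
Qed.

(** Units of the smaller ring stay units in the larger one, so the two valuations are proportional;
    both are onto the integers, so the factor is 1. *)
Lemma local_ring_sub_eq P P' : local_ring P `<=` local_ring P' -> P = P'.
Proof.
move=> sub; have [t t0 ot] := ord_onto P.
have o't : 0 <= ord P' t by apply: sub; rewrite /local_ring /= ot.
have E x : x != 0 -> ord P' x = ord P x * ord P' t.
  move=> x0.
  have unit_ord y : y != 0 -> ord P y = 0 -> ord P' y = 0.
    move=> y0 oy; apply/eqP; rewrite eq_le -oppr_ge0 -ord_inv //.
    by rewrite !(sub _ _) // /local_ring /= ?ord_inv // oy.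
  have pow (n : nat) y : y != 0 -> ord P y = n -> ord P' y = ord P' t *+ n.
    move=> y0 oy; have tn0 : t ^+ n != 0 by rewrite expf_neq0.
    have := unit_ord (y / t ^+ n).
    rewrite ord_mul ?invr_eq0 // ord_inv // ord_exp ot oy.
    rewrite mulf_neq0 ?invr_eq0 // => /(_ isT).
    rewrite ord_mul ?invr_eq0 // ord_inv // ord_exp => H; apply/eqP.
    by rewrite -subr_eq0 H // -[1 *+ n]/(n%:R) natz subrr.
  case oxE : (ord P x) => [n|n];
    first by rewrite (pow n) // mulrC -mulr_natr natz.
  have := pow n.+1 x^-1; rewrite invr_eq0 ord_inv // oxE => /(_ x0).
  rewrite ord_inv // NegzE opprK => /(_ erefl) /(congr1 -%R); rewrite opprK =>
    ->.
  by rewrite mulNr mulrC -mulr_natr natz.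
have [y y0 oy] := ord_onto P'.
have ot1 : ord P' t = 1.
  move: oy o't; rewrite (E y y0); case: (ord P' t) => // b.
  case: (ord P y) => a /eqP; last by rewrite NegzE; nia.
  by rewrite -PoszM eqz_nat muln_eq1 => /andP[_ /eqP->].
apply: place_eq => x; have [->|x0] := eqVneq x 0; first by rewrite !ord_zero.
by rewrite [RHS]E // ot1 mulr1.
Qed.

End PlaceTheory.

(** * A is integrally closed with fraction field Q, and its localisations are the local rings of
    C *)

Section CoordinateRing.
Variables (F : finFieldType) (C : curve F).
Local Notation Q := (funfield C).
Local Notation emb := (base_emb C).
Implicit Types P : place (base_emb C).

Definition coords : set Q := [set x | x \in @regular F C].

Lemma coordsP x : coords x <-> forall P, affine_points C P -> local_ring P x.
Proof. by split=> /asboolP. Qed.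

Lemma coords_local P : affine_points C P -> coords `<=` local_ring P.
Proof. by move=> Pa x /coordsP; exact. Qed.

Lemma coords_subring : is_subring coords.
Proof.
split.
- by apply/coordsP => P _; exact: (subring1 (local_ring_subring P)).
- move=> x y /coordsP Ax /coordsP Ay; apply/coordsP => P Pa.
  by apply: (subringB (local_ring_subring P)); [exact: Ax|exact: Ay].
- move=> x y /coordsP Ax /coordsP Ay; apply/coordsP => P Pa.
  by apply: (subringM (local_ring_subring P)); [exact: Ax|exact: Ay].
Qed.

Lemma coords_cst a : coords (emb a). Proof. exact: cst_regular. Qed.

Lemma coord_valA (a : coord_ring C) : coords (coord_val a).
Proof. exact: coord_valP. Qed.

Lemma coords_val x : coords x -> exists a : coord_ring C, coord_val a = x.
Proof. by move=> Ax; exists (CoordRing Ax). Qed.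

Let Ar := coords_subring.

(** At a pole of [y], dividing the equation by y^n would put 1 into the maximal ideal. *)
Lemma coords_integral y n (a : 'I_n -> Q) :
  (forall i, coords (a i)) -> y ^+ n = \sum_i a i * y ^+ i -> coords y.
Proof.
move=> Aa yn; apply/coordsP => P Pa; apply: contrapT => /max_idealV[y0 my].
apply: (@max_ideal_proper _ _ P); have yn0 : y ^+ n != 0 by rewrite expf_neq0.
rewrite -(mulfV yn0) {1}yn big_distrl;
  apply: (ideal_sum (max_ideal_ideal P)) => i _ /=.
have -> : a i * y ^+ i / y ^+ n = a i * y^-1 ^+ (n - i.+1) * y^-1.
  rewrite -!mulrA -exprSr subnSK //; congr (_ * _).
  by rewrite exprVn expfB // invf_div.
have Or := local_ring_subring P.
apply: (idealM (max_ideal_ideal P)) => //; apply: (subringM Or).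
  exact: (coords_local Pa).
by apply: (subringX Or); exact: (idealS (max_ideal_ideal P)).
Qed.

Hypothesis infty_pole : exists2 x, coords x & ord (infty C) x < 0.

(** [y] is algebraic over F(x) for an [x] in A with a pole at infinity; the leading coefficient of
    an equation for [y], times [y], is integral over A. *)
Lemma coords_frac y : exists a, [/\ coords a, a != 0 & coords (a * y)].
Proof.
have [x Ax ox] := infty_pole.
have xF a : x <> emb a by move=> E; rewrite E ord_cst ltxx in ox.
have tr (p : {poly F}) : p != 0 -> (map_poly emb p).[x] != 0.
  exact: (transcendental (@curve_geom_irreducible _ C)).
have Aev (p : {poly F}) : coords (map_poly emb p).[x].
  rewrite (horner_coef_wide _ (leqnn _)); apply: (subring_sum Ar) => k _.
  by rewrite coef_map; apply: (subringM Ar);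
    [exact: coords_cst|exact: (subringX Ar)].
have [n /(_ (fun i : 'I_n => y ^+ i))] :=
  finite_over_rational (curve_one_variable C) x.
case=> p [[i0 pi0] pq].
case: (@arg_maxnP _ i0 (fun i => p i != 0) (fun i => i : nat) pi0) => k pk maxk.
set c := (map_poly emb (p k)).[x]; exists c.
have c0 : c != 0 by exact: tr.
split=> //; first exact: Aev.
have E : c * y ^+ k = \sum_(i < k) - (map_poly emb (p (widen_ord (ltnW (ltn_ord
  k)) i))).[x] * y ^+ i.
  apply/eqP; under eq_bigr do rewrite mulNr.
  rewrite sumrN -addr_eq0; apply/eqP; rewrite -[RHS]pq [RHS](bigD1 k) //=;
    congr (_ + _).
  rewrite [RHS](bigID (fun i : 'I_n =>
    (i < k)%N)) /= [X in _ = _ + X]big1 ?addr0.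
    rewrite (big_ord_narrow_cond (ltnW (ltn_ord k))) /=; apply: eq_bigl => i.
    by apply/esym/eqP => /(congr1 val) /= E; have := ltn_ord i; rewrite E ltnn.
  move=> i /andP[neq_ik]; rewrite -leqNgt leq_eqVlt =>
    /predU1P[/ord_inj eij|lt_ki].
    by rewrite -eij eqxx in neq_ik.
  have [->|pi] := eqVneq (p i) 0; first by rewrite rmorph0 horner0 mul0r.
  by have /= := maxk i pi; rewrite leqNgt lt_ki.
case: (posnP k) => [k0|k_gt0].
  move: E; rewrite big1 => [/eqP|i _]; last by exfalso; case: i => m;
    rewrite k0 ltn0.
  by rewrite k0 expr0 mulr1 (negPf c0).
pose a (i : 'I_k) :=
  - (map_poly emb (p (widen_ord (ltnW (ltn_ord k)) i))).[x] * c ^+ (k.-1 - i).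
apply: (@coords_integral _ k a) => [i|].
  by apply: (subringM Ar); [apply: (subringN Ar)|apply: (subringX Ar)];
    exact: Aev.
rewrite exprMn -[in c ^+ _](prednK k_gt0) exprSr -mulrA E big_distrr /=.
apply: eq_bigr => i _; rewrite /a exprMn.
have -> : c ^+ k.-1 = c ^+ (k.-1 - i) * c ^+ i.
  by rewrite -exprD subnK // -ltnS prednK.
by rewrite mulrCA !mulrA mulrAC [_ * c ^+ i]mulrAC -!mulrA; congr (_ * _);
  rewrite mulrCA.
Qed.

Lemma coords_frac_fin (I : finType) (y : I -> Q) :
  exists a, [/\ coords a, a != 0 & forall i, coords (a * y i)].
Proof.
have /choice[a aP] i := coords_frac (y i).
exists (\prod_i a i); split.
- by apply: (subring_prod Ar) => i _; case: (aP i).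
- by apply/prodf_neq0 => i _; case: (aP i).
move=> i; rewrite (bigD1 i) //= mulrAC; apply: (subringM Ar);
  first by case: (aP i).
by apply: (subring_prod Ar) => j _; case: (aP j).
Qed.

Lemma coords_fin_quotient t : coords t -> t != 0 ->
  exists s : seq Q, forall y, coords y ->
    exists2 z, z \in s & coords z /\ coords ((y - z) / t).
Proof. by apply: finite_quotient => //;
  [exact: curve_one_variable|exact: coords_cst]. Qed.

(** The place supplied by [place_of_ideal] has A in its local ring, so it is not infinity, where
    some element of A has a pole. *)
Lemma place_over_ideal (I : set Q) a : is_ideal coords I -> I a -> a != 0 ->
  ~ I 1 ->
  exists2 P, affine_points C P & I `<=` max_ideal P.
Proof.
move=> Ii Ia a0 I1.
have [P [AP IP]] := place_of_ideal (curve_one_variable C)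
  (@curve_geom_irreducible _ C) Ar coords_cst Ii I1 Ia a0.
exists P => //; have [x Ax ox] := infty_pole.
by move=> Pi; have := AP _ Ax; rewrite Pi /local_ring /= leNgt ox.
Qed.

Section AffinePoint.
Variable P : place (base_emb C).
Hypothesis Pa : affine_points C P.

Let mi := max_ideal_ideal P.
Let AP := coords_local Pa.

Lemma max_ideal_coords_neq0 : exists a, [/\ coords a, max_ideal P a & a != 0].
Proof.
have [t t0 ot] := ord_onto P.
have mt : max_ideal P t by right; rewrite ot.
have [b [Ab b0 Abt]] := coords_frac t.
exists (b * t); split=> //; last by rewrite mulf_neq0.
by apply: (idealM mi) => //; exact: AP.
Qed.

(* Among the annihilators in A/aA of the elements b outside aA, a maximal     *)
(* one contained in m_P is m_P itself; z = b/a is then a function with        *)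
(* z m_P <= A.  If z had a pole at P' and z m_P <= m_P, an element of m_P of  *)
(* least order at P' could be improved by multiplication with z.              *)
Lemma max_ideal_locally_principal :
  exists f u, [/\ coords f, ~ max_ideal P f, max_ideal P u, u != 0
    & forall y, coords y -> max_ideal P y -> coords (f * y / u)].
Proof.
have [a [Aa ma a0]] := max_ideal_coords_neq0.
have [s sP] := coords_fin_quotient Aa a0.
pose Ann b : set Q := [set v | coords v /\ coords (v * b / a)].
pose good b := coords b /\ Ann b `<=` max_ideal P.
pose mu b := count (fun z => `[< Ann b z >]) s.
have ex_mu : exists n, `[< exists2 b, good b & mu b = n >].
  exists (mu 1); apply/asboolP; exists 1 => //; split;
    first exact: (subring1 Ar).
  move=> v [_]; rewrite mulr1 => Ava; rewrite -(divfK a0 v).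
  by apply: (idealM mi) => //; exact: AP.
have mu_le n : `[< exists2 b, good b & mu b = n >] -> (n <= size s)%N.
  by move=> /asboolP[b _ <-]; exact: count_size.
case: (ex_maxnP ex_mu mu_le) => _ /asboolP[b [Ab bm] <-] maxb.
(* Membership in an annihilator depends only on the class modulo [a], so the largest count among the
   finitely many representatives means a maximal annihilator. *)
have Ann_max b' : good b' -> Ann b `<=` Ann b' -> Ann b' `<=` Ann b.
  move=> gb' sub u [Au ub']; apply: contrapT => ub.
  have := maxb (mu b'); rewrite leqNgt => /(_ _)/negP[];
    first by apply/asboolP; exists b'.
  have [z zs [Az uz]] := sP u Au.
  have Annz c : coords c -> Ann c u <-> Ann c z.
    move=> Ac; have E : u * c / a = (u - z) / a * c + z * c / a.
      by field.
    have Ac' := subringM Ar uz Ac.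
    split=> -[_ H]; split=> //; last by rewrite E; exact: (subringD Ar).
    by have := subringB Ar H Ac'; rewrite E addrC addKr.
  have Ab' := gb'.1.
  apply: (@count_lt _ _ _ _ z) => //.
  - by move=> x /asboolP ?; apply/asboolP; exact: sub.
  - by apply/asboolP/(Annz _ Ab').
  - by apply/asboolPn => /(Annz _ Ab).
have bA : ~ coords (b / a).
  by move=> Aba; apply/(@max_ideal_proper _ _ P)/bm; split; rewrite ?mul1r //;
    exact: (subring1 Ar).
(* If [b u] is good, maximality lets powers of [u] be cancelled, and the power congruence puts some
   1 - u^(k+1) into m_P, a contradiction. Otherwise some s' outside m_P kills [b u] modulo [a]; then
   [b s'] is good and killed by [u], and maximality applies to it. *)
have mAnn u : coords u -> max_ideal P u -> Ann b u.
  move=> Au mu_u; have [good_bu|] := pselect (good (b * u)).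
    have bu_b : Ann (b * u) `<=` Ann b.
      apply: Ann_max => // v [Av vb]; split=> //.
      by rewrite mulrA mulrAC; exact: (subringM Ar).
    have bui_b i v : coords v -> coords (v * u ^+ i * b / a) ->
      coords (v * b / a).
      elim: i v => [|i IH] v Av; first by rewrite mulr1.
      rewrite exprS mulrA => /(IH _ (subringM Ar Av Au)) H.
      suff: Ann b v by case.
      apply: bu_b; split=> //; by rewrite [b * u]mulrC mulrA.
    have [i [k Aik]] := power_congruence (curve_one_variable C) Ar coords_cst
      Aa a0 Au.
    have A1u : coords (1 - u ^+ k.+1).
      by apply: (subringB Ar); [exact: (subring1 Ar)|exact: (subringX Ar)].
    have := bui_b i (1 - u ^+ k.+1) A1u.
    rewrite [_ * u ^+ i]mulrC mulrAC => /(_ (subringM Ar Aik Ab)) H.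
    have m1 : max_ideal P (1 - u ^+ k.+1) by apply: bm.
    case: (@max_ideal_proper _ _ P); rewrite -[1](subrK (u ^+ k.+1)).
    apply: (idealD mi) => //; rewrite exprS; apply: (idealMr mi) => //.
    by apply: (subringX (local_ring_subring P)); exact: AP.
  move=> ngood; have [s' [As' bus'] ms'] : exists2 s', Ann (b * u) s' & ~
    max_ideal P s'.
    apply: contrapT => H; apply: ngood; split; first exact: (subringM Ar).
    by move=> v Av; apply: contrapT => mv; apply: H; exists v.
  have : Ann (b * s') u.
    by split=> //; rewrite (_ : u * (b * s') = s' * (b * u)) //; ring.
  apply: Ann_max => [|v [Av vb]].
    split=> [|v [Av vb]]; first exact: (subringM Ar).
    have /bm : Ann b (v * s').
      by split; [exact: (subringM Ar)|rewrite (_ : v * s' * b = v * (b * s'))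
        //; ring].
    by case/(max_ideal_prime (AP Av) (AP As')).
  split=> //; rewrite (_ : v * (b * s') / a = v * b / a * s'); last by ring.
  exact: (subringM Ar).
pose z := b / a.
have Az y : coords y -> max_ideal P y -> coords (z * y).
  by move=> Ay /(mAnn _ Ay)[_]; rewrite [z * y]mulrC mulrA.
have [u [Au mu_u mzu]] : exists u, [/\
  coords u, max_ideal P u & ~ max_ideal P (z * u)].
  apply: contrapT => H.
  have {}H y : coords y -> max_ideal P y -> max_ideal P (z * y).
    by move=> Ay my; apply: contrapT => mz; apply: H; exists y.
  have [P' P'a zP'] : exists2 P', affine_points C P' & ~ local_ring P' z.
    apply: contrapT => H'; apply: bA; apply/coordsP => P' P'a;
      apply: contrapT => zP'.
    by apply: H'; exists P'.
  have [z0 _] := max_idealV zP'.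
  have oz : ord P' z < 0 by rewrite ltNge; exact/negP.
  suff no n w : (ord P' w < n%:Z) -> coords w -> max_ideal P w -> w != 0 ->
    False.
    by apply: (no (absz (ord P' a + 1)%R) a) => //; lia.
  elim: n w => [|n IH] w ow Aw mw w0.
    by have := coords_local P'a Aw; rewrite /local_ring /= leNgt ow.
  apply: (IH (z * w)); [|exact: Az|exact: H|by rewrite mulf_neq0].
  by rewrite ord_mul //; lia.
have u0 : u != 0 by apply/eqP => u0; apply: mzu; rewrite u0 mulr0; left.
exists (z * u), u; split=> //; first exact: Az.
by move=> y Ay my; rewrite mulrAC mulfK //; exact: Az.
Qed.

(** Start from any denominator [w] in A. While [w] lies in m_P, [f w / u] is again a denominator and
    has smaller order at P. *)
Lemma local_ring_denominator x : local_ring P x ->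
  exists f, [/\ coords f, ~ max_ideal P f & coords (f * x)].
Proof.
move=> ox; have [w0 [Aw0 w00 Aw0x]] := coords_frac x.
have [f [u [Af mf mu u0 fu]]] := max_ideal_locally_principal.
have [f0 of0 _] := local_ring_unit (AP Af) mf.
have ou : 0 < ord P u by case: mu => // u_0; rewrite u_0 eqxx in u0.
suff H n w : ord P w < n%:Z -> coords w -> w != 0 -> coords (w * x) ->
    exists f, [/\ coords f, ~ max_ideal P f & coords (f * x)].
  by apply: (H (absz (ord P w0 + 1)%R) w0) => //; lia.
elim: n w => [|n IH] w ow Aw nz Awx.
  by have := AP Aw; rewrite /local_ring /= leNgt ow.
have [mw|] := pselect (max_ideal P w); last by exists w.
apply: (IH (f * w / u)).
- by rewrite !ord_mul ?invr_eq0 ?mulf_neq0 // ord_inv // of0; lia.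
- exact: fu.
- by rewrite !mulf_neq0 ?invr_eq0.
rewrite mulrAC -[f * w * x]mulrA; apply: fu => //; exact: (idealMr mi).
Qed.

Lemma local_ring_denominator_fin (I : finType) (x : I -> Q) :
  (forall i, local_ring P (x i)) ->
  exists f, [/\ coords f, ~ max_ideal P f & forall i, coords (f * x i)].
Proof.
move=> ox; have /choice[f fP] i := local_ring_denominator (ox i).
exists (\prod_i f i); split.
- by apply: (subring_prod Ar) => i _; case: (fP i).
- suff [] : coords (\prod_i f i) /\ ~ max_ideal P (\prod_i f i) by [].
  apply: (big_ind (fun y => coords y /\ ~ max_ideal P y)).
  + by split; [exact: (subring1 Ar)|exact: max_ideal_proper].
  + move=> y z [Ay my] [Az mz]; split; first exact: (subringM Ar).
    by case/(max_ideal_prime (AP Ay) (AP Az)).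
  + by move=> i _; case: (fP i).
move=> i; rewrite (bigD1 i) //= mulrAC; apply: (subringM Ar);
  first by case: (fP i).
by apply: (subring_prod Ar) => j _; case: (fP j).
Qed.

End AffinePoint.

(** The denominators that suffice for the local ring at P lie outside m_P, hence are units at P', so
    one local ring contains the other. *)
Lemma affine_place_eq P P' : affine_points C P -> affine_points C P' ->
  (forall a, coords a -> max_ideal P' a -> max_ideal P a) -> P = P'.
Proof.
move=> Pa P'a sub; apply: local_ring_sub_eq => x ox.
have [f [Af mf Afx]] := local_ring_denominator Pa ox.
have [f0 _ oV] : [/\ f != 0, ord P' f = 0 & local_ring P' f^-1].
  by apply: local_ring_unit; [exact: coords_local|move=> /(sub _ Af)].
rewrite -(mulKf f0 x); apply: (subringM (local_ring_subring P')) => //.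
exact: coords_local.
Qed.

(** A zero of [a] is determined by which of the finitely many representatives modulo [a] vanish
    there. *)
Lemma finite_zeros_coords a : coords a -> a != 0 ->
  finite_set [set P : place emb | affine_points C P /\ max_ideal P a].
Proof.
move=> Aa a0; have [s sP] := coords_fin_quotient Aa a0.
pose Z : set (place (base_emb C)) := [set P : place emb | affine_points C P /\
  max_ideal P a].
pose code P : (size s).-tuple bool := map_tuple (fun z =>
  `[< max_ideal P z >]) (in_tuple s).
have code_inj P P' : Z P -> Z P' -> code P = code P' -> P = P'.
  move=> [Pa mPa] [P'a mP'a] /(congr1 val) /= eq_code.
  apply: affine_place_eq => // y Ay mP'y.
  have [z zs [Az yz]] := sP y Ay.
  have E P0 : affine_points C P0 -> max_ideal P0 a -> max_ideal P0 (y - z).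
    move=> P0a m0a; rewrite -(divfK a0 (y - z));
      apply: (idealM (max_ideal_ideal P0)) => //.
    exact: coords_local.
  have mP'z : max_ideal P' z.
    by rewrite -[z](subKr y); apply: (idealB (max_ideal_ideal P')) => //;
      exact: E.
  have /eq_in_map/(_ z zs) := eq_code; rewrite (asboolT mP'z) => /asboolP mPz.
  by rewrite -[y](subrK z); apply: (idealD (max_ideal_ideal P)) => //; exact: E.
have [g gP] : {g : (size s).-tuple bool ->
  place (base_emb C) | forall P, Z P -> g (code P) = P}.
  apply: cid; have /choice[g gP] c : exists P0, forall P, Z P -> code P = c ->
    P0 = P.
    have [[P0 ZP0 cP0]|none] := pselect (exists2 P, Z P & code P = c).
      by exists P0 => P ZP cP; apply: code_inj => //; rewrite cP.
    by exists (infty C) => P ZP cP; case: none; exists P.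
  by exists g => P ZP; exact: gP.
apply: (@sub_finite_set _ _ (g @` [set: (size s).-tuple bool])).
  by move=> P ZP; exists (code P) => //; exact: gP.
exact/finite_image/finite_finset.
Qed.

Lemma finite_poles y : finite_set [set P : place emb | ~ local_ring P y].
Proof.
have [a [Aa a0 Aay]] := coords_frac y.
apply: (@sub_finite_set _ _ ([set infty C] `|` [set P : place emb |
  affine_points C P /\ max_ideal P a])).
  move=> P /= oy; have [->|Pi] := pselect (P = infty C); [by left|right;
    split=> //].
  apply: contrapT => ma; apply: oy.
  have [_ _ aV] := local_ring_unit (coords_local Pi Aa) ma.
  rewrite -(mulKf a0 y); apply: (subringM (local_ring_subring P)) => //.
  exact: coords_local Pi _ Aay.
by rewrite finite_setU; split; [exact: finite_set1|exact: finite_zeros_coords].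
Qed.

Lemma finite_poles_mx m n (X : 'M[Q]_(m, n)) :
  finite_set [set P : place emb | ~ forall i j, local_ring P (X i j)].
Proof.
apply: (@sub_finite_set _ _ (\bigcup_(ij in [set: 'I_m * 'I_n]) [set P : place
  emb | ~ local_ring P (X ij.1 ij.2)])).
  move=> P /= H; apply: contrapT => H'; apply: H => i j; apply: contrapT => H.
  by apply: H'; exists (i, j).
by apply: bigcup_finite => // ij _; exact: finite_poles.
Qed.

End CoordinateRing.

Arguments coords {F C} _.

Section CoordVal.
Variables (F : finFieldType) (C : curve F).
Fact coord_val_additive : zmod_morphism (@coord_val F C).
Proof. by []. Qed.
HB.instance Definition _ :=
  GRing.isZmodMorphism.Build (coord_ring C) (funfield C)
  (@coord_val F C) coord_val_additive.
Fact coord_val_multiplicative : monoid_morphism (@coord_val F C).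
Proof. by []. Qed.
HB.instance Definition _ :=
  GRing.isMonoidMorphism.Build (coord_ring C) (funfield C)
  (@coord_val F C) coord_val_multiplicative.
End CoordVal.

(** * Lattices in Q^r *)

Section MatrixSpan.
Variable Q : fieldType.

Definition mxin (S : set Q) m n (X : 'M[Q]_(m, n)) : Prop :=
  forall i j, S (X i j).

Definition mxspan (S : set Q) n r (G : 'M[Q]_(n, r)) : set 'rV[Q]_r :=
  [set v | exists2 a : 'rV[Q]_n, forall i, S (a ord0 i) & v = a *m G].

Lemma mxin_row (S : set Q) n (a : 'rV[Q]_n) : (forall i, S (a ord0 i)) <->
  mxin S a.
Proof. by split=> [Sa i j|Sa i //]; rewrite ord1. Qed.

Section Subring.
Variable S : set Q.
Hypothesis Sr : is_subring S.

Lemma mxinM m n p (X : 'M[Q]_(m, n)) (Y : 'M[Q]_(n, p)) :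
  mxin S X -> mxin S Y -> mxin S (X *m Y).
Proof.
move=> SX SY i j; rewrite mxE; apply: (subring_sum Sr) => k _.
exact: (subringM Sr).
Qed.

Lemma mxinZ m n a (X : 'M[Q]_(m, n)) : S a -> mxin S X -> mxin S (a *: X).
Proof. by move=> Sa SX i j; rewrite mxE; exact: (subringM Sr). Qed.

Lemma mxinD m n (X Y : 'M[Q]_(m, n)) : mxin S X -> mxin S Y -> mxin S (X + Y).
Proof. by move=> SX SY i j; rewrite mxE; exact: (subringD Sr). Qed.

Lemma mxin0 m n : mxin S (0 : 'M[Q]_(m, n)).
Proof. by move=> i j; rewrite mxE; exact: (subring0 Sr). Qed.

Lemma mxin1 n : mxin S (1%:M : 'M[Q]_n).
Proof.
by move=> i j; rewrite mxE; case: eqP => _;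
  [exact: (subring1 Sr)|exact: (subring0 Sr)].
Qed.

Lemma mxin_rowsub m n p (f : 'I_p -> 'I_m) (X : 'M[Q]_(m, n)) :
  mxin S X -> mxin S (rowsub f X).
Proof. by move=> SX i j; rewrite mxE. Qed.

Lemma mxin_mxX n (X : 'M[Q]_n) k : mxin S X -> mxin S (X ^+ k).
Proof.
by move=> SX; elim: k => [|k IH]; [exact: mxin1|rewrite exprS; exact: mxinM].
Qed.

Lemma mxspanP n r (G : 'M[Q]_(n, r)) v :
  mxspan S G v <-> exists2 a : 'rV_n, mxin S a & v = a *m G.
Proof. by split=> -[a Sa ->]; exists a => //; exact/mxin_row. Qed.

Lemma mxspan_sub m n r (G : 'M[Q]_(m, r)) (G' : 'M[Q]_(n, r)) X :
  mxin S X -> G' = X *m G -> mxspan S G' `<=` mxspan S G.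
Proof.
move=> SX -> v /mxspanP[a Sa ->]; apply/mxspanP.
by exists (a *m X); [exact: mxinM|rewrite mulmxA].
Qed.

Lemma mxspan_row n r (G : 'M[Q]_(n, r)) i : mxspan S G (row i G).
Proof.
apply/mxspanP; exists (row i 1%:M); last by rewrite -row_mul mul1mx.
by move=> a b; rewrite mxE; exact: mxin1.
Qed.

Lemma mxspanD n r (G : 'M[Q]_(n, r)) v w :
  mxspan S G v -> mxspan S G w -> mxspan S G (v + w).
Proof.
move=> /mxspanP[a Sa ->] /mxspanP[b Sb ->]; apply/mxspanP.
by exists (a + b); [exact: mxinD|rewrite mulmxDl].
Qed.

Lemma mxspanZ n r (G : 'M[Q]_(n, r)) x v :
  S x -> mxspan S G v -> mxspan S G (x *: v).
Proof.
move=> Sx /mxspanP[a Sa ->]; apply/mxspanP.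
by exists (x *: a); [exact: mxinZ|rewrite scalemxAl].
Qed.

Lemma mxspan0 n r (G : 'M[Q]_(n, r)) : mxspan S G 0.
Proof. by apply/mxspanP; exists 0; [exact: mxin0|rewrite mul0mx]. Qed.

End Subring.

Lemma mxspan_mono (S S' : set Q) n r (G : 'M[Q]_(n, r)) :
  S `<=` S' -> mxspan S G `<=` mxspan S' G.
Proof. by move=> SS' v [a Sa ->]; exists a => // i; exact: SS'. Qed.

End MatrixSpan.

(** * Local bases and the local-global principle for lattices *)

Section LocalBasis.
Variables (F : finFieldType) (C : curve F).
Local Notation Q := (funfield C).

(* Choosing r rows whose determinant has least order at P, Cramer's rule      *)
(* shows that the other rows have coordinates in the local ring.              *)
Lemma local_basis (P : place (base_emb C)) n r (G : 'M[Q]_(n, r)) : row_full G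
  ->
  exists h : 'I_r -> 'I_n, rowsub h G \in unitmx /\
    mxin (local_ring P) (G *m invmx (rowsub h G)).
Proof.
move=> fullG; pose h0 : {ffun 'I_r -> 'I_n} := fullrankfun fullG.
have unit_h0 : \det (rowsub h0 G) != 0.
  by rewrite -unitfE -unitmxE fullrowsub_unit.
case: (@arg_minP _ _ _ h0 (fun h => \det (rowsub h G) != 0)
  (fun h : {ffun _} => ord P (\det (rowsub h G))) unit_h0) => h det_h min_h.
have unit_h : rowsub h G \in unitmx by rewrite unitmxE unitfE.
exists h; split=> // k i.
pose h' := [ffun l => if l == i then k else h l].
have E : (G *m invmx (rowsub h G)) k i = \det (rowsub h' G) / \det (rowsub h G).
  rewrite /invmx unit_h -scalemxAr mxE mulrC; congr (_ / _).
  rewrite (expand_det_row _ i) mxE; apply: eq_bigr => j _.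
  rewrite !mxE ffunE eqxx; congr (_ * _).
  rewrite /cofactor; congr (_ * \det _); apply/matrixP => a b.
  by rewrite !mxE ffunE eq_sym (negPf (neq_lift _ _)).
rewrite E; have [->|det_h'] := eqVneq (\det (rowsub h' G)) 0.
  by rewrite mul0r; exact: (subring0 (local_ring_subring P)).
rewrite /local_ring /= ord_mul ?invr_eq0 // ord_inv // subr_ge0.
exact: min_h.
Qed.

Lemma local_basis_span (P : place (base_emb C)) n r (G : 'M[Q]_(n, r)) h :
  rowsub h G \in unitmx -> mxin (local_ring P) (G *m invmx (rowsub h G)) ->
  mxspan (local_ring P) G = local_span P (rowsub h G).
Proof.
move=> unit_h XP; have Or := local_ring_subring P; apply/seteqP; split.
  by apply: (mxspan_sub Or XP); rewrite mulmxKV.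
apply: (mxspan_sub Or (X := rowsub h 1%:M));
  last by rewrite mul_rowsub_mx mul1mx.
by apply: mxin_rowsub; exact: mxin1.
Qed.

Hypothesis infty_pole : exists2 x : Q, coords x & ord (infty C) x < 0.
Local Notation A := (@coords F C).
Let Ar := @coords_subring F C.

Lemma coords_frac_mx m n (X : 'M[Q]_(m, n)) :
  exists a, [/\ A a, a != 0 & mxin A (a *: X)].
Proof.
have [a [Aa a0 aX]] := coords_frac_fin infty_pole (fun ij : 'I_m * 'I_n =>
  X ij.1 ij.2).
by exists a; split=> // i j; rewrite mxE; exact: (aX (i, j)).
Qed.

(** The denominators of [v] with respect to the lattice form a nonzero ideal of A. If it were
    proper, it would lie in some m_P, yet local membership at P provides a denominator outside
    m_P. *)
Lemma mxspan_local_global n r (G : 'M[Q]_(n, r)) v : row_full G ->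
  (forall P, affine_points C P -> mxspan (local_ring P) G v) -> mxspan A G v.
Proof.
move=> /row_fullP[B BG] loc; apply: contrapT => Nv.
pose I : set Q := [set a | A a /\ mxspan A G (a *: v)].
have Ii : is_ideal A I.
  split; first by move=> a [].
  - by split; [exact: (subring0 Ar)|rewrite scale0r; exact: mxspan0].
  - move=> a b [Aa av] [Ab bv]; split; first exact: (subringB Ar).
    rewrite scalerBl -scaleN1r; apply: (mxspanD Ar) => //;
      apply: (mxspanZ Ar) => //.
    by apply: (subringN Ar); exact: (subring1 Ar).
  - move=> a b Aa [Ab bv]; split; first exact: (subringM Ar).
    by rewrite -scalerA; exact: (mxspanZ Ar).
have [a [Aa a0 avB]] := coords_frac_mx (v *m B).
have Ia : I a.
  split=> //; apply/(mxspanP); exists (a *: (v *m B)) => //.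
  by rewrite -scalemxAl -mulmxA BG mulmx1.
have [|P Pa IP] := place_over_ideal infty_pole Ii Ia a0.
  by move=> [_]; rewrite scale1r.
have /mxspanP[b bP vE] := loc P Pa.
have [f [Af mf fb]] := local_ring_denominator_fin infty_pole Pa (fun i =>
  bP ord0 i).
apply: mf; apply: IP; split=> //; apply/mxspanP; exists (f *: b).
  by move=> i j; rewrite mxE ord1.
by rewrite vE scalemxAl.
Qed.

End LocalBasis.

(** * Nilpotent action of the characteristic ideal on the cokernel *)

Section NilpotentProduct.
Variables (K : fieldType) (d : nat).

(** Each factor X strictly lowers the rank of a nonzero product Y: otherwise the row space of Y
    would lie in that of Y X^k for all k. So [d] commuting nilpotent matrices of size [d] multiply
    to zero. *)
Lemma prod_commuting_nilpotent_rank (s : seq 'M[K]_d) :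
  (forall X Y, X \in s -> Y \in s -> X * Y = Y * X) ->
  (forall X, X \in s -> exists n, X ^+ n = 0) ->
  (\rank (\prod_(X <- s) X)%R <= d - size s)%N.
Proof.
elim: s => [|X s IH] comm nilp; first by rewrite subn0 rank_leq_row.
have {}IH : (\rank (\prod_(X <- s) X)%R <= d - size s)%N.
  by apply: IH => [Y Z Ys Zs|Y Ys]; [apply: comm|apply: nilp];
    rewrite inE ?Ys ?Zs orbT.
rewrite big_cons; set Y := \prod_(_ <- s) _ in IH *.
have XY : X * Y = Y * X.
  rewrite /Y big_seq; apply: (big_ind (fun Y => X * Y = Y * X)).
  - by rewrite mulr1 mul1r.
  - by move=> Z W XZ XW; rewrite mulrA XZ -mulrA XW mulrA.
  - by move=> Z Zs; apply: comm; rewrite inE ?eqxx ?Zs ?orbT.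
have [Y0|Y0] := eqVneq Y 0; first by rewrite Y0 mulr0 mxrank0.
suff lt : (\rank (X * Y)%R < \rank Y)%N.
  by move: (leq_trans lt IH); rewrite /= subnS; case: (d - size s)%N => // k;
    rewrite ltnS.
have le := mxrankM_maxr X Y; rewrite ltn_neqAle le andbT.
apply: contra_neq Y0 => eq_rank.
have sub : (Y <= X *m Y)%MS by rewrite -(mxrank_leqif_sup (submxMl X Y)).2
  eq_rank.
have [n Xn] := nilp X (mem_head _ _).
have subn : forall k, (Y <= Y *m X ^+ k)%MS.
  elim=> [|k IHk]; first by rewrite mulmx1.
  have XY' : X *m Y = Y *m X := XY.
  rewrite exprS -mulmxE mulmxA -XY'; apply: submx_trans IHk _.
  exact: submxMr.
by have := subn n; rewrite Xn mulmx0 submx0 => /eqP.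
Qed.

End NilpotentProduct.

Section Cokernel.
Variables (F : finFieldType) (C : curve F) (c : {rmorphism coord_ring C -> F}).
Local Notation A := (coord_ring C).
Local Notation cst := (@coord_cst F C).
Variables (M : lmodType A) (tau : {linear M -> M}).

Lemma coord_cst_is_additive : zmod_morphism cst.
Proof. by move=> a b; apply: val_inj; rewrite /= rmorphB. Qed.
HB.instance Definition _ :=
  GRing.isZmodMorphism.Build F A cst coord_cst_is_additive.
Lemma coord_cst_is_multiplicative : monoid_morphism cst.
Proof. by split=> [|a b]; apply: val_inj; rewrite /= ?rmorph1 ?rmorphM. Qed.
HB.instance Definition _ :=
  GRing.isMonoidMorphism.Build F A cst coord_cst_is_multiplicative.

Definition im_tau : set M := [set m | exists m', m = tau m'].

Lemma im_tauD m m' : im_tau m -> im_tau m' -> im_tau (m + m').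
Proof. by move=> [n ->] [n' ->]; exists (n + n'); rewrite linearD. Qed.
Lemma im_tauZ a m : im_tau m -> im_tau (a *: m).
Proof. by move=> [n ->]; exists (a *: n); rewrite linearZ. Qed.
Lemma im_tau0 : im_tau 0. Proof. by exists 0; rewrite linear0. Qed.
Lemma im_tauB m m' : im_tau m -> im_tau m' -> im_tau (m - m').
Proof. by move=> [n ->] [n' ->]; exists (n - n'); rewrite linearB. Qed.
Lemma im_tau_sum I r (P : pred I) f :
  (forall i, P i -> im_tau (f i)) -> im_tau (\sum_(i <- r | P i) f i).
Proof. by move=> H; apply: big_ind => //; [exact: im_tau0|exact: im_tauD]. Qed.

(** A generating family of least size is independent, because a relation allows one member to be
    eliminated. *)
Lemma coker_dim_exists (I : finType) (e : I -> M) :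
  (forall m, exists (a : I ->
    F) (m' : M), m = \sum_i cst (a i) *: e i + tau m') ->
  exists d, coker_dim tau d.
Proof.
move=> gen_e.
pose gen k := exists e : 'I_k -> M, forall m, exists (a : 'I_k -> F) (m' : M),
  m = \sum_i cst (a i) *: e i + tau m'.
have ex_gen : exists k, `[< gen k >].
  exists #|I|; apply/asboolP; exists (fun i => e (enum_val i)) => m.
  have [a [m' ->]] := gen_e m; exists (fun i => a (enum_val i)), m';
    congr (_ + _).
  by rewrite (reindex (@enum_val I predT)) //=; exact/onW_bij/enum_val_bij.
case: (ex_minnP ex_gen) => k /asboolP[{gen_e}e gen_e] mink.
exists k, e; split=> // a m' am' i; apply: contrapT => /eqP ai0.
case: k e gen_e mink a am' i ai0 => [|k] e gen_e mink a am' i ai0;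
  first by case: i ai0.
suff /asboolP/mink : gen k by rewrite ltnn.
exists (fun j => e (lift i j)) => m.
have [b [m'' ->]] := gen_e m; pose r := b i / a i.
exists (fun j => b (lift i j) - r * a (lift i j)), (m'' + cst r *: m').
rewrite linearD linearZ /= -am' !(bigD1_ord i) //=.
under [in RHS]eq_bigr do rewrite rmorphB rmorphM scalerBl -scalerA.
rewrite sumrB -scaler_sumr scalerDr scalerA -rmorphM divfK //.
move: (cst (b i) *: _) (\sum_(_ < k) _) (tau m'') (cst r *: _) => x y z t.
by rewrite (addrA z) [z + x]addrC addrACA addNr addr0 addrCA addrA.
Qed.

Hypothesis nilp : forall a, char_ideal c a ->
  exists n, forall m, im_tau (a ^+ n *: m).

(** The characteristic ideal acts on the [d]-dimensional cokernel through commuting nilpotent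
    matrices, any [d] of which have product zero. So nilpotency of single elements gives the
    condition on J^d. *)
Lemma char_ideal_coker d : coker_dim tau d ->
  forall a, ideal_pow (char_ideal c) d a -> forall m, im_tau (a *: m).
Proof.
move=> [e [gen_e indep_e]].
pose E (x : 'rV[F]_d) : M := \sum_i cst (x ord0 i) *: e i.
have EB x y : E (x - y) = E x - E y.
  by rewrite /E -sumrB; apply: eq_bigr => i _; rewrite !mxE rmorphB scalerBl.
have E0 x : im_tau (E x) -> x = 0.
  by move=> [m' /indep_e x0]; apply/rowP => i; rewrite mxE x0.
have genE m : exists x, im_tau (m - E x).
  have [a [m' ->]] := gen_e m; exists (\row_i a i), m'.
  rewrite addrAC (_ : E _ = \sum_i cst (a i) *: e i) ?subrr ?add0r //.
  by apply: eq_bigr => i _; rewrite mxE.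
have /choice[N NP] a : exists N : 'M[F]_d, forall x, im_tau (a *: E x - E (x *m
  N)).
  have /choice[R RP] i := genE (a *: e i).
  exists (\matrix_i R i) => x.
  have -> : a *: E x - E (x *m \matrix_i R i) =
      \sum_i cst (x ord0 i) *: (a *: e i - E (R i)).
    rewrite /E scaler_sumr.
    under [in RHS]eq_bigr do rewrite scalerBr scalerA mulrC -scalerA.
    rewrite sumrB; congr (_ - _); under [in RHS]eq_bigr do rewrite scaler_sumr.
    rewrite exchange_big; apply: eq_bigr => j _ /=.
    rewrite mxE rmorph_sum scaler_suml; apply: eq_bigr => i _.
    by rewrite !mxE rmorphM scalerA.
  by apply: im_tau_sum => i _; exact: im_tauZ.
have NE a b x : im_tau (a *: (b *: E x) - E (x *m N b *m N a)).
  have := im_tauD (im_tauZ a (NP b x)) (NP a (x *m N b)).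
  by rewrite scalerBr addrA subrK.
have mx_eq (X Y : 'M[F]_d) : (forall x : 'rV_d, im_tau (E (x *m X) - E (x *m
  Y))) -> X = Y.
  move=> H; apply/row_matrixP => i; apply/eqP; rewrite -subr_eq0; apply/eqP/E0.
  by rewrite EB !rowE.
have comm a b : N a * N b = N b * N a.
  apply: mx_eq => x; have := im_tauB (NE a b x) (NE b a x).
  rewrite !scalerA mulrC opprB addrC addrA subrK -!mulmxA => H.
  by have := im_tauZ (-1) H; rewrite scaleN1r opprB.
have N_prod (s : seq A) x : im_tau ((\prod_(a <- s) a) *: E x - E (x *m
  \prod_(X <- map N s) X)).
  elim: s x => [|a s IH] x.
    by rewrite !big_nil scale1r mulmx1 subrr; exact: im_tau0.
  rewrite /= !big_cons mulrC -scalerA.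
  have := im_tauD (im_tauZ (\prod_(a <- s) a) (NP a x)) (IH (x *m N a)).
  by rewrite scalerBr addrA subrK mulmxA.
have N_nilp a : char_ideal c a -> exists n, N a ^+ n = 0.
  move=> /nilp[n an]; exists n; apply: mx_eq => x.
  have := im_tauB (an (E x)) (N_prod (nseq n a) x).
  rewrite map_nseq !big_nseq !iter_mulr_1 subKr => H.
  have E00 : E 0 = 0 by rewrite -(subrr 0) EB subrr.
  by rewrite mulmx0 E00 subr0.
have prod0 (s : 'I_d -> A) m : (forall j, char_ideal c (s j)) ->
    im_tau ((\prod_j s j) *: m).
  move=> sJ; have [x mx] := genE m.
  have := N_prod [seq s j | j <- enum 'I_d] x.
  have -> : \prod_(X <- map N [seq s j | j <- enum 'I_d]) X = 0.
    apply/eqP; rewrite -mxrank_eq0 -leqn0.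
    apply: leq_trans (prod_commuting_nilpotent_rank _ _) _.
    - by move=> _ _ /mapP[a _ ->] /mapP[b _ ->].
    - by move=> _ /mapP[_ /mapP[j _ ->] ->]; exact: N_nilp.
    - by rewrite 2!size_map size_enum_ord subnn.
  rewrite big_map big_enum /= mulmx0 => H.
  have := im_tauD (im_tauZ (\prod_j s j) mx) H.
  have -> : E 0 = 0 by rewrite /E big1 // => i _; rewrite mxE rmorph0 scale0r.
  by rewrite scalerBr addrA subrK subr0.
move=> _ [n [b [s [sJ ->]]]] m; rewrite scaler_suml; apply: im_tau_sum => i _.
by have [s' [s'J ->]] := sJ i; rewrite -scalerA; apply: im_tauZ; exact: prod0.
Qed.

End Cokernel.

(** * The motive attached to a lattice and a matrix *)

Section LatticeModule.
Variables (F : finFieldType) (C : curve F) (n r : nat).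
Local Notation Q := (funfield C).
Local Notation A := (coord_ring C).

(** A separate name for Q^r, so that it can carry a module structure over A beside the one over
    Q. *)
Definition row_module : Type := 'rV[Q]_r.
HB.instance Definition _ := GRing.Zmodule.on row_module.

Definition row_scale (a : A) (v : row_module) : row_module :=
  coord_val a *: (v : 'rV[Q]_r).

Fact row_scaleA a b v : row_scale a (row_scale b v) = row_scale (a * b) v.
Proof. exact: scalerA. Qed.
Fact row_scale1 : left_id 1 row_scale.
Proof. by move=> v; exact: scale1r. Qed.
Fact row_scaleDr : right_distributive row_scale +%R.
Proof. by move=> a v w; exact: scalerDr. Qed.
Fact row_scaleDl v : {morph row_scale^~ v : a b / a + b}.
Proof. by move=> a b; exact: scalerDl. Qed.
HB.instance Definition _ := GRing.Zmodule_isLmodule.Build A row_module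
  row_scaleA row_scale1 row_scaleDr row_scaleDl.

Variable G : 'M[Q]_(n, r).

Definition in_lattice : pred row_module := fun v => `[< mxspan coords G v >].

Fact in_lattice_submod : submod_closed in_lattice.
Proof.
have Ar := @coords_subring F C; split; first exact/asboolP/mxspan0.
move=> a v w /asboolP Gv /asboolP Gw; apply/asboolP.
apply: (mxspanD Ar) => //; apply: (mxspanZ Ar) => //; exact: coord_valA.
Qed.

Record lattice := Lattice { lattice_val;
  lattice_valP : lattice_val \in in_lattice }.

HB.instance Definition _ := [isSub for lattice_val].
HB.instance Definition _ := [Choice of lattice by <:].
HB.instance Definition _ :=
  GRing.SubChoice_isSubLmodule.Build A row_module in_lattice lattice
    (GRing.submod_closed_semi in_lattice_submod).

Definition lattice_row (v : lattice) : 'rV[Q]_r := lattice_val v.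
Fact lattice_row_additive : zmod_morphism lattice_row.
Proof. by []. Qed.
HB.instance Definition _ :=
  GRing.isZmodMorphism.Build lattice 'rV[Q]_r lattice_row lattice_row_additive.

Lemma lattice_rowZ (a : A) v : lattice_row (a *: v) = coord_val a *:
  lattice_row v.
Proof. by []. Qed.

Lemma lattice_row_inj : injective lattice_row.
Proof. exact: val_inj. Qed.

Lemma lattice_rowP v : mxspan coords G v <-> exists m, lattice_row m = v.
Proof.
split=> [Gv|[m <-]]; last exact/asboolP/(lattice_valP m).
by exists (Lattice (asboolT Gv : v \in in_lattice)).
Qed.

Lemma lattice_row_sum I (s : seq I) (f : I -> lattice) :
  lattice_row (\sum_(i <- s) f i) = \sum_(i <- s) lattice_row (f i).
Proof. exact: raddf_sum. Qed.

Section Tau.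
Variables (T : 'M[Q]_r) (H : 'M[Q]_n).
Hypotheses (HA : mxin coords H) (GT : G *m T = H *m G).

Lemma lattice_stable v : mxspan coords G v -> mxspan coords G (v *m T).
Proof.
move=> /mxspanP[a Aa ->]; apply/mxspanP; exists (a *m H).
  exact: (mxinM (@coords_subring F C)).
by rewrite -mulmxA GT mulmxA.
Qed.

Fact lattice_tau_subproof (v : lattice) :
  (lattice_row v *m T : row_module) \in in_lattice.
Proof. by apply/asboolP/lattice_stable/lattice_rowP; exists v. Qed.

Definition lattice_tau (v : lattice) : lattice :=
  Lattice (lattice_tau_subproof v).

Fact lattice_tau_linear : linear lattice_tau.
Proof.
move=> a v w; apply: lattice_row_inj.
change ((coord_val a *: lattice_row v + lattice_row w) *m T =
  coord_val a *: (lattice_row v *m T) + lattice_row w *m T).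
by rewrite mulmxDl scalemxAl.
Qed.
HB.instance Definition _ :=
  GRing.isLinear.Build A lattice lattice _ lattice_tau lattice_tau_linear.

Lemma lattice_row_tau v : lattice_row (lattice_tau v) = lattice_row v *m T.
Proof. by []. Qed.

End Tau.
End LatticeModule.

Definition realizes (F : finFieldType) (C : curve F)
    (c : {rmorphism coord_ring C -> F}) (N : motive c) n r
    (psi : N -> 'rV[funfield C]_r) (G : 'M[funfield C]_(n, r))
    (T : 'M[funfield C]_r) : Prop :=
  [/\ forall a x y, psi (a *: x + y) = coord_val a *: psi x + psi y,
      injective psi,
      forall v, mxspan coords G v <-> exists m, psi m = v
    & forall m, psi (tau N m) = psi m *m T].

(** The purity condition at infinity for a stalk whose basis consists of the rows of [e]. *)
Definition infty_twist (F : finFieldType) (C : curve F) r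
    (e T : 'M[funfield C]_r) k l : Prop :=
  set_bij (local_span (infty C) e)
    [set v | exists2 t, ord (infty C) t = 1 &
       local_span (infty C) e (t ^+ k *: v)]
    (fun v => v *m T ^+ l).

Section LatticeMotive.
Variables (F : finFieldType) (C : curve F) (c : {rmorphism coord_ring C -> F}).
Local Notation Q := (funfield C).
Local Notation A := (coord_ring C).
Hypothesis infty_pole : exists2 x : Q, coords x & ord (infty C) x < 0.
Let Ar := @coords_subring F C.

(** The [f] away from which the lattice is free generate the unit ideal: a place P over a proper
    ideal is excluded, since a local basis at P remains a basis away from some [f] outside m_P. *)
Lemma lattice_locally_free n r (G : 'M[Q]_(n, r)) :
  row_full G -> locally_free (lattice G) r.
Proof.
move=> fullG; pose s : set A := [set f | free_away (lattice G) r f].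
exists s; split=> //; apply: contrapT => s1.
pose I : set Q := [set x | exists2 a : A, ideal_gen s a & coord_val a = x].
have sI f : s f -> I (coord_val f).
  move=> sf; exists f => //; exists 1%N, (fun=> 1), (fun=> f).
  by rewrite big_ord1 mul1r.
have free_s h (f : A) : rowsub h G \in unitmx -> coord_val f != 0 ->
    mxin coords (coord_val f *: (G *m invmx (rowsub h G))) -> s f.
  move=> unit_h f0 fX.
  have /choice[e eP] i : exists m : lattice G, lattice_row m = row (h i) G.
    exact/lattice_rowP/(mxspan_row Ar).
  have eE (a : 'I_r -> A) :
      lattice_row (\sum_i a i *: e i) = (\row_i coord_val (a i)) *m rowsub h G.
    rewrite lattice_row_sum mulmx_sum_row; apply: eq_bigr => i _.
    by rewrite lattice_rowZ eP !mxE row_rowsub.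
  exists e; split.
    move=> m; have [b Ab mE] : exists2 b, mxin coords b & lattice_row m = b *m
      G.
      by apply/mxspanP/lattice_rowP; exists m.
    set Y := _ *: _ in fX.
    have bY j : coords ((b *m Y) ord0 j) by exact: (mxinM Ar).
    have /choice[a aP] j := coords_val (bY j).
    exists 1%N, a; apply: lattice_row_inj; rewrite eE lattice_rowZ expr1 mE.
    rewrite (_ : \row_i _ = b *m Y); last by apply/rowP => j; rewrite mxE aP.
    by rewrite -scalemxAr -scalemxAl mulmxA mulmxKV.
  move=> k a /(congr1 (@lattice_row _ _ _ _ _));
    rewrite lattice_rowZ raddf0 eE => E i.
  exists 0%N; rewrite expr0 mul1r; apply: val_inj => /=.
  have fk0 : coord_val (f ^+ k) != 0 by rewrite rmorphXn expf_neq0.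
  move/eqP: E; rewrite scaler_eq0 (negPf fk0) /= => /eqP.
  move=> /(congr1 (mulmxr (invmx (rowsub h G)))).
  by rewrite /= mulmxK // mul0mx => /rowP/(_ i); rewrite !mxE.
have locP P : affine_points C P ->
  exists2 f : A, s f & ~ max_ideal P (coord_val f).
  move=> Pa; have [h [unit_h XP]] := local_basis P fullG.
  have [f [Af mf fX]] := local_ring_denominator_fin infty_pole Pa
    (fun ij : 'I_n * 'I_r => XP ij.1 ij.2).
  have [f' f'E] := coords_val Af; exists f'; last by rewrite f'E.
  apply: (free_s h) => //; last first.
    by move=> i j; rewrite mxE f'E; exact: (fX (i, j)).
  by rewrite f'E; apply/eqP => f0; apply: mf; rewrite f0; left.
have Ii : is_ideal coords I.
  split.
  - by move=> _ [a _ <-]; exact: coord_valA.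
  - by exists 0 => //; exists 0%N, (fun=> 0), (fun=> 0); rewrite big_ord0;
    split=> // -[].
  - move=> _ _ [a [k [b [t [st ->]]]] <-] [a' [k' [b' [t' [st' ->]]]] <-].
    exists (\sum_i b i * t i - \sum_i b' i * t' i); last by rewrite rmorphB.
    exists (k + k')%N, (fun i : 'I_(k + k') =>
      match fintype.split i with inl i => b i | inr i => - b' i end),
      (fun i : 'I_(k + k') => match fintype.split i with inl i =>
        t i | inr i => t' i end); split.
      by move=> i; case: (fintype.split i).
    rewrite big_split_ord /=; congr (_ + _).
      apply: eq_bigr => i _;
        by rewrite -[lshift _ _]/(unsplit (inl i)) unsplitK.
    rewrite -sumrN; apply: eq_bigr => i _.
    by rewrite -[rshift _ _]/(unsplit (inr i)) unsplitK mulNr.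
  - move=> x _ Ax [a [k [b [t [st ->]]]] <-]; have [y <-] := coords_val Ax.
    exists (y * \sum_i b i * t i); last by rewrite rmorphM.
    exists k, (fun i => y * b i), t; split=> //.
    by rewrite mulr_sumr; apply: eq_bigr => i _; rewrite mulrA.
have [f0 f0s f00] : exists2 f0 : A, s f0 & coord_val f0 != 0.
  have [a [Aa a0 aX]] := coords_frac_mx infty_pole
    (G *m invmx (rowsub (fullrankfun fullG) G)).
  have [f fE] := coords_val Aa; exists f; rewrite ?fE //.
  by apply: (free_s (fullrankfun fullG)); rewrite ?fE ?fullrowsub_unit.
have [|P Pa IP] := place_over_ideal infty_pole Ii (sI _ f0s) f00.
  by move=> [a sa a1]; apply: s1; rewrite (_ : 1 = a) //; apply: val_inj;
    exact: esym a1.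
by have [f sf] := locP P Pa; apply; exact/IP/sI.
Qed.

(** Two generating systems of Q^r span the same module at all but finitely many places, so the stalk
    at infinity can be prescribed independently of the lattice. *)
Lemma lattice_bundle n r (G : 'M[Q]_(n, r)) (e : 'M[Q]_r) :
  row_full G -> e \in unitmx ->
  exists B : bundle C r, stalk B (infty C) = local_span (infty C) e /\
    forall P, affine_points C P -> stalk B P = mxspan (local_ring P) G.
Proof.
move=> fullG unit_e.
pose st P : set 'rV[Q]_r := if pselect (P = infty C) then local_span (infty C) e
  else mxspan (local_ring P) G.
have st_oo : st (infty C) = local_span (infty C) e by rewrite /st;
  case: pselect.
have st_aff P : affine_points C P -> st P = mxspan (local_ring P) G.
  by rewrite /st; case: pselect.
have loc P : exists (U : set (place (base_emb C))) (f : 'M[Q]_r),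
    [/\ finite_set (~` U), U P, f \in unitmx
      & forall P', U P' -> st P' = local_span P' f].
  have [->|Pa] := pselect (P = infty C).
    have /row_fullP[B BG] := fullG.
    pose X := G *m invmx e; pose Y := e *m B.
    exists [set P' | P' = infty C \/ mxin (local_ring P') X /\
      mxin (local_ring P') Y], e.
    split=> //; [|by left|].
    - apply: (@sub_finite_set _ _ ([set P' | ~ mxin (local_ring P') X] `|`
          [set P' | ~ mxin (local_ring P') Y])).
        move=> P' /= /not_orP[_]; have [XP|] :=
          pselect (mxin (local_ring P') X); last by left.
        by move=> XY; right=> YP; apply: XY.
      by rewrite finite_setU; split; exact: finite_poles_mx.
    - move=> P' [->|[XP YP]]; first exact: st_oo.
      have [->|P'a] := pselect (P' = infty C); first exact: st_oo.
      have Or := local_ring_subring P'.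
      rewrite st_aff //; apply/seteqP; split.
        by apply: (mxspan_sub Or XP); rewrite mulmxKV.
      by apply: (mxspan_sub Or YP); rewrite -mulmxA BG mulmx1.
  have [h [unit_h XP]] := local_basis P fullG.
  pose X := G *m invmx (rowsub h G).
  exists [set P' | affine_points C P' /\ mxin (local_ring P') X], (rowsub h G).
  split=> //.
    apply: (@sub_finite_set _ _ ([set infty C] `|` [set P' | ~ mxin (local_ring
      P') X])).
      move=> P' /= /not_andP[P'oo|]; [left|by right].
      by apply: contrapT => P'a; apply: P'oo.
    by rewrite finite_setU; split; [exact: finite_set1|exact: finite_poles_mx].
  by move=> P' [P'a XP']; rewrite st_aff //; exact: local_basis_span.
exists (Bundle loc); split=> //.
Qed.

(** A nonzero [a] in A carries the lattice into the image of T, so the cokernel is finitely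
    generated over the finite ring A/aA. *)
Lemma lattice_coker_gen n r (G : 'M[Q]_(n, r)) T H (HA : mxin coords H)
    (GT : G *m T = H *m G) :
  row_full G -> T \in unitmx ->
  exists d, coker_dim (lattice_tau HA GT) d.
Proof.
move=> /row_fullP[B BG] unit_T.
have [a [Aa a0 aX]] := coords_frac_mx infty_pole (G *m invmx T *m B).
have aT v : mxspan coords G v ->
    exists m : lattice G, a *: v = lattice_row (lattice_tau HA GT m).
  move=> /mxspanP[b Ab vE].
  have [m mE] : exists m : lattice G, lattice_row m = b *m (a *: (G *m invmx T
    *m B)) *m G.
    by apply/lattice_rowP/mxspanP; eexists; first exact: (mxinM Ar Ab aX).
  exists m; rewrite lattice_row_tau mE vE -!mulmxA -!scalemxAl -!scalemxAr;
    congr (_ *: _).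
  by rewrite -!mulmxA (mulmxA B) BG mul1mx mulVmx // mulmx1.
have [s sP] := coords_fin_quotient Aa a0.
have /choice[g gP] j : exists m : lattice G, lattice_row m = row j G.
  exact/lattice_rowP/(mxspan_row Ar).
have /choice[z zP] (i : 'I_(size s)) : exists z : A, coords s`_i ->
  coord_val z = s`_i.
  have [/coords_val[z zE]|ns] := pselect (coords s`_i); first by exists z.
  by exists 0.
apply: (@coker_dim_exists _ _ _ _ ('I_n * 'I_(size s))%type (fun ij =>
  z ij.2 *: g ij.1)).
move=> m; have [b Ab mE] : exists2 b, mxin coords b & lattice_row m = b *m G.
  by apply/mxspanP/lattice_rowP; exists m.
have /choice[k kP] j : exists k : 'I_(size s), coords s`_k /\
  coords ((b ord0 j - s`_k) / a).
  have [y ys yP] := sP _ (Ab ord0 j); have lt := ys; rewrite -index_mem in lt.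
  by exists (Ordinal lt); rewrite /= nth_index.
have [m' m'E] : exists m' : lattice G, lattice_row m - \sum_j coord_val (z (k
  j)) *: row j G =
    lattice_row (lattice_tau HA GT m').
  have -> : lattice_row m - \sum_j coord_val (z (k j)) *: row j G =
      a *: ((\row_j ((b ord0 j - s`_(k j)) / a)) *m G).
    rewrite mE !mulmx_sum_row -sumrB scaler_sumr; apply: eq_bigr => j _.
    by have [/zP -> _] := kP j;
      rewrite mxE scalerA -scalerBl mulrCA mulfV ?mulr1.
  apply: aT; apply/mxspanP; eexists; last by [].
  by move=> i j; rewrite ord1 mxE; case: (kP j).
exists (fun ij => if ij.2 == k ij.1 then 1 else 0), m'.
apply: lattice_row_inj; rewrite raddfD raddf_sum.
rewrite -[LHS](subrK (\sum_j coord_val (z (k j)) *: row j G)) m'E addrC.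
congr (_ + _); apply/esym.
rewrite -(pair_bigA _ (fun i j =>
  lattice_row (coord_cst C (if j == k i then 1 else 0) *: (z j *: g i)))) /=.
apply: eq_bigr => i _; rewrite (bigD1 (k i)) //= eqxx big1 ?addr0.
  by rewrite rmorph1 scale1r; apply: etrans (lattice_rowZ _ _) _; rewrite gP.
by move=> j /negPf->; rewrite rmorph0 scale0r.
Qed.

Lemma lattice_motive n r (G : 'M[Q]_(n, r)) T H e k l :
  row_full G -> T \in unitmx -> mxin coords H -> G *m T = H *m G ->
  (forall a, char_ideal c a -> exists m, forall v, mxspan coords G v ->
     exists2 w, mxspan coords G w & coord_val a ^+ m *: v = w *m T) ->
  e \in unitmx -> (0 < k)%N -> (0 < l)%N -> infty_twist e T k l ->
  exists (N : motive c) (psi : N -> 'rV[Q]_r), realizes psi G T.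
Proof.
move=> fullG unit_T HA GT nilp unit_e k0 l0 twist.
pose tau := lattice_tau HA GT.
(* The dimension of the motive is whatever the cokernel has; the condition on the characteristic
   then follows from nilpotency. *)
have [d tau_d] := lattice_coker_gen HA GT fullG unit_T.
have tau_inj : injective tau.
  move=> v w /(congr1 (@lattice_row _ _ _ _ _)); rewrite !lattice_row_tau.
  by move=> /(can_inj (mulmxK unit_T)) /lattice_row_inj.
have tau_char : forall a, ideal_pow (char_ideal c) d a ->
    forall m, exists m', a *: m = tau m'.
  apply: (char_ideal_coker _ tau_d) => a /nilp[m am]; exists m => v.
  have [|w /lattice_rowP[w' <-] E] := am (lattice_row v);
    first by apply/lattice_rowP; exists v.
  by exists w'; apply: lattice_row_inj;
    rewrite lattice_row_tau -E lattice_rowZ rmorphXn.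
have tau_pure : is_pure tau r.
  have [B [Boo Baff]] := lattice_bundle fullG unit_e.
  exists B, (@lattice_row F C n r G), T; split=> //; last first.
    by exists k, l; split=> //; rewrite /twisted_stalk Boo.
  have secE v : sections B (affine_points C) v <-> mxspan coords G v.
    split=> [sv|Gv P Pa]; last by rewrite Baff //; apply: mxspan_mono Gv;
      exact: coords_local.
    by apply: (mxspan_local_global infty_pole) => // P Pa; rewrite -Baff //;
      exact: sv.
  split.
  - by move=> v _; apply/secE/lattice_rowP; exists v.
  - by move=> v w _ _; exact: lattice_row_inj.
  - by move=> v /secE/lattice_rowP[m <-]; exists m.
exists (Motive (lattice_locally_free fullG) tau_inj tau_d tau_char tau_pure),
  (@lattice_row F C n r G).
split=> //; [exact: lattice_row_inj|exact: lattice_rowP].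
Qed.

End LatticeMotive.

(** * The matrix of a motive *)

Lemma expr_add_ideal (A : comNzRingType) (I : A -> Prop) (x y : A) p q :
  I 0 -> (forall a b, I a -> I b -> I (a + b)) -> (forall a b, I b ->
    I (a * b)) ->
  I (x ^+ p) -> I (y ^+ q) -> I ((x + y) ^+ (p + q)).
Proof.
move=> I0 ID IM Ix Iy; rewrite exprDn; apply: big_ind => // i _.
rewrite -mulr_natl; apply: (IM).
have [le_pi|lt_ip] := leqP p (p + q - i).
  by rewrite -(subnK le_pi) exprD mulrC mulrA; exact: IM.
have le_qi : (q <= i)%N by lia.
by rewrite -(subnK le_qi) exprD mulrA; exact: IM.
Qed.

(** The union of the local bases generates. For fixed [m], the [x] with [x m] in its span form an
    ideal that contains a power of each f_i, hence a power of 1 = sum of b_i f_i. *)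
Lemma locally_free_generated (A : comNzRingType) (M : lmodType A) r :
  locally_free M r -> exists n (g : 'I_n -> M), forall m, exists a : 'I_n -> A,
    m = \sum_i a i *: g i.
Proof.
move=> [s [[k [b [f [sf f1]]]] free_s]].
have /choice[e eP] i := free_s _ (sf i).
pose ge (ij : 'I_k * 'I_r) := e ij.1 ij.2.
suff gen m : exists a : 'I_k * 'I_r -> A, m = \sum_ij a ij *: ge ij.
  exists #|{: 'I_k * 'I_r}|, (fun i => ge (enum_val i)) => m.
  have [a ->] := gen m; exists (fun i => a (enum_val i)).
  by rewrite (reindex (@enum_val _ predT)) //=; exact/onW_bij/enum_val_bij.
pose I x := exists a : 'I_k * 'I_r -> A, x *: m = \sum_ij a ij *: ge ij.
have I0 : I 0.
  by exists (fun=> 0); rewrite scale0r big1 // => ij _; rewrite scale0r.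
have ID x y : I x -> I y -> I (x + y).
  move=> [a ax] [a' ay]; exists (fun ij => a ij + a' ij).
  by rewrite scalerDl ax ay -big_split; apply: eq_bigr => ij _ /=;
    rewrite scalerDl.
have IM x y : I y -> I (x * y).
  move=> [a ay]; exists (fun ij => x * a ij).
  by rewrite -scalerA ay scaler_sumr; apply: eq_bigr => ij _; rewrite scalerA.
have If i : exists p, I (f i ^+ p).
  have [p [a fm]] := (eP i).1 m; exists p.
  exists (fun ij => if ij.1 == i then a ij.2 else 0).
  rewrite fm -(pair_bigA _ (fun i' j =>
    (if i' == i then a j else 0) *: e i' j)) /=.
  rewrite [RHS](bigD1 i) //= eqxx [X in _ = _ + X]big1 ?addr0 // => i' /negPf->.
  by rewrite big1 // => j _; rewrite scale0r.
suff [p] : exists p, I ((\sum_i b i * f i) ^+ p).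
  by rewrite -f1 expr1n => -[a]; rewrite scale1r; exists a.
apply: (big_ind (fun x => exists p, I (x ^+ p))).
- by exists 1%N; rewrite expr1.
- by move=> x y [p Ip] [q Iq]; exists (p + q)%N; exact: expr_add_ideal.
- by move=> i _; have [p Ip] := If i; exists p; rewrite exprMn; exact: IM.
Qed.

Lemma horner_mx_sum (R : comNzRingType) n (X : 'M[R]_n.+1) p :
  horner_mx X p = \sum_(j < size p) p`_j *: X ^+ j.
Proof.
rewrite -{1}[p]coefK poly_def raddf_sum; apply: eq_bigr => j _.
by rewrite /= linearZ /= rmorphXn /= horner_mx_X.
Qed.

Section CharPolySubring.
Variables (Q : fieldType) (S : set Q).
Hypothesis Sr : is_subring S.

Let poly_in (p : {poly Q}) := forall i, S p`_i.

Let poly_inM p q : poly_in p -> poly_in q -> poly_in (p * q).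
Proof.
by move=> Sp Sq i; rewrite coefM; apply: (subring_sum Sr) => j _;
  exact: (subringM Sr).
Qed.

Let poly_inC a : S a -> poly_in a%:P.
Proof. by move=> Sa i; rewrite coefC; case: eqP => // _;
  exact: (subring0 Sr). Qed.

Lemma char_poly_in n (X : 'M[Q]_n) : mxin S X -> forall i, S (char_poly X)`_i.
Proof.
move=> SX; rewrite -/(poly_in _) /char_poly.
have in_sum I (s : seq I) (f : I -> {poly Q}) : (forall i, poly_in (f i)) ->
    poly_in (\sum_(i <- s) f i).
  by move=> Sf i; rewrite coef_sum; apply: (subring_sum Sr) => j _; exact: Sf.
have S1 := subring1 Sr.
apply: in_sum => s; apply: poly_inM.
  rewrite -signr_odd; case: odd; rewrite ?expr0 ?expr1; last exact: poly_inC.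
  by rewrite -polyCN; apply: poly_inC; exact: (subringN Sr).
apply: (big_ind poly_in) => [||i _]; [exact: poly_inC|exact: poly_inM|].
move=> j; rewrite !mxE coefB coefMn coefX coefC; apply: (subringB Sr).
  by do 2![case: eqP => _]; rewrite ?mulr1n ?mulr0n ?mul0rn //;
    exact: (subring0 Sr).
by case: eqP => _; [exact: SX|exact: (subring0 Sr)].
Qed.

End CharPolySubring.

(** * Purity at infinity in matrix form *)

Section InftyTwist.
Variables (F : finFieldType) (C : curve F) (r : nat).
Local Notation Q := (funfield C).
Variables (e T : 'M[Q]_r) (k l : nat).
Hypotheses (unit_e : e \in unitmx) (twist : infty_twist e T k l).

(** Uniformizers differ by units, so a single [t] describes the twist; surjectivity onto the twisted
    stalk supplies the inverse [W] over the local ring. In the basis [e], T^l is t^-k times a matrix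
    invertible over that ring. *)
Lemma infty_twist_matrix t : ord (infty C) t = 1 -> t != 0 ->
  exists U W : 'M[Q]_r, [/\ mxin (local_ring (infty C)) U,
    mxin (local_ring (infty C)) W, W *m U = 1%:M
    & t ^+ k *: (e *m T ^+ l) = U *m e].
Proof.
move=> ot t0; have Or := local_ring_subring (infty C);
  have tk0 : t ^+ k != 0 by rewrite expf_neq0.
case: twist => tw_fun _ tw_surj.
have row_e i : local_span (infty C) e (row i e) by exact: (mxspan_row Or).
have /choice[u uP] i : exists u : 'rV[Q]_r, mxin (local_ring (infty C)) u /\
    t ^+ k *: (row i e *m T ^+ l) = u *m e.
  have [t' ot' /mxspanP[u uO uE]] := tw_fun _ (row_e i).
  have t'0 : t' != 0 by apply: contra_eq_neq ot' => ->; rewrite ord_zero.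
  exists ((t / t') ^+ k *: u); split.
    apply: (mxinZ Or) => //; apply: (subringX Or).
    by rewrite /local_ring /= ord_mul ?invr_eq0 // ord_inv // ot ot' subrr.
  rewrite -scalemxAl -uE scalerA; congr (_ *: _).
  by rewrite -exprMn divfK.
have /choice[w wP] i : exists w : 'rV[Q]_r, mxin (local_ring (infty C)) w /\
    t ^- k *: row i e = w *m e *m T ^+ l.
  have [|v /mxspanP[w wO ->] wE] := tw_surj (t ^- k *: row i e).
    by exists t => //=; rewrite scalerA mulfV // scale1r; exact: row_e.
  by exists w.
exists (\matrix_i u i), (\matrix_i w i).
have UE : t ^+ k *: (e *m T ^+ l) = (\matrix_i u i) *m e.
  apply/row_matrixP => i; rewrite row_mul rowK -(uP i).2 -row_mul.
  by apply/rowP => j; rewrite !mxE.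
split=> //.
- by move=> i j; rewrite mxE; exact: (uP i).1.
- by move=> i j; rewrite mxE; exact: (wP i).1.
have WE : t ^- k *: e = (\matrix_i w i) *m e *m T ^+ l.
  apply/row_matrixP => i; rewrite !row_mul rowK -(wP i).2.
  by apply/rowP => j; rewrite !mxE.
apply: (can_inj (mulmxK unit_e));
  rewrite -mulmxA -UE mul1mx -scalemxAr mulmxA -WE.
by rewrite scalerA mulfV // scale1r.
Qed.

Lemma infty_twist_unit : (0 < l)%N -> T \in unitmx.
Proof.
move=> l0; have [t t0 ot] := ord_onto (infty C).
have [U [W [_ _ WU UE]]] := infty_twist_matrix ot t0.
have unit_U : U \in unitmx by case/mulmx1_unit: WU.
have : t ^+ k *: (e *m T ^+ l) \in unitmx by rewrite UE unitmx_mul unit_U.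
rewrite unitmxE detZ unitrM => /andP[_]; rewrite -unitmxE unitmx_mul =>
  /andP[_].
by rewrite -(prednK l0) exprS -mulmxE unitmx_mul => /andP[].
Qed.

(* A relation v S^N + a_(N-1) v S^(N-1) + ... = 0 for S = T^l, with the a_i   *)
(* regular at oo, is impossible: S lowers orders at oo by exactly k > 0.      *)
Lemma infty_twist_pole n (G : 'M[Q]_(n, r)) (H : 'M[Q]_n) : (0 < k)%N ->
  mxin (local_ring (infty C)) H -> G *m T = H *m G -> G = 0.
Proof.
move=> k0 HO GT; apply: contrapT => /eqP G0.
have Or := local_ring_subring (infty C); have mi := max_ideal_ideal (infty C).
have [t t0 ot] := ord_onto (infty C).
have [U [W [UO WO WU UE]]] := infty_twist_matrix ot t0.
case: n G H HO GT G0 => [|n] G H HO GT G0; first by rewrite flatmx0 eqxx in G0.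
have [i Gi] : exists i, row i G != 0.
  apply: contrapT => Gi; case/eqP: G0; apply/row_matrixP => i; rewrite row0.
  by apply: contrapT => /eqP Gi0; apply: Gi; exists i.
pose p := char_poly (H ^+ l); pose N := n.+1.
have pO : forall j, local_ring (infty C) p`_j by apply: (char_poly_in Or);
  exact: mxin_mxX.
have GTl j : G *m (T ^+ l) ^+ j = (H ^+ l) ^+ j *m G.
  rewrite -!exprM; elim: (l * j)%N => [|m IH]; first by rewrite mulmx1 mul1mx.
  by rewrite exprSr -mulmxE mulmxA IH -mulmxA GT mulmxA mulmxE -exprSr.
pose y := row i G *m invmx e.
have yUj j : row i G *m (T ^+ l) ^+ j = t ^- (k * j) *: (y *m U ^+ j *m e).
  elim: j => [|j IH]; first by rewrite muln0 invr1 scale1r !mulmx1 mulmxKV.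
  rewrite exprSr -mulmxE mulmxA IH -!scalemxAl -!mulmxA.
  have -> : e *m T ^+ l = t ^- k *: (U *m e) by rewrite -UE scalerA mulVf
    ?scale1r ?expf_neq0.
  by rewrite -!scalemxAr scalerA mulnS -invfM -exprD addnC exprSr -mulmxE
    !mulmxA.
have rel : \sum_(j < N.+1) p`_j *: (t ^- (k * j) *: (y *m U ^+ j)) = 0.
  apply: (can_inj (mulmxK unit_e)); rewrite mul0mx mulmx_suml.
  have CH : \sum_(j < N.+1) p`_j *: (H ^+ l) ^+ j = 0.
    by rewrite -[RHS](Cayley_Hamilton (H ^+ l)) horner_mx_sum size_char_poly.
  transitivity (row i ((\sum_(j < N.+1) p`_j *: (H ^+ l) ^+ j) *m G)).
    rewrite mulmx_suml raddf_sum; apply: eq_bigr => j _ /=.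
    rewrite -[in RHS]scalemxAl -GTl -!scalemxAl -yUj -row_mul.
    by apply/rowP => j'; rewrite !mxE.
  by rewrite CH mul0mx row0.
have UW m : U ^+ m *m W ^+ m = 1%:M.
  elim: m => [|m IH]; first by rewrite mulmx1.
  rewrite exprSr exprS -!mulmxE -mulmxA (mulmxA U) (mulmx1C WU) mul1mx.
  exact: IH.
(* Multiplication by t^(kN) and W^N isolates the leading term; every other term keeps a positive
   power of [t]. *)
have yE : y = - \sum_(j < N) (p`_j * t ^+ (k * (N - j))) *: (y *m U ^+ j *m W
  ^+ N).
  have tkN : t ^+ (k * N) != 0 by rewrite expf_neq0.
  move: rel; rewrite big_ord_recr /=.
  have -> : p`_N = 1.
    by have := char_poly_monic (H ^+ l);
      rewrite monicE lead_coefE size_char_poly => /eqP.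
  rewrite scale1r addrC => /eqP; rewrite addr_eq0 => /eqP E.
  transitivity (t ^+ (k * N) *: (t ^- (k * N) *: (y *m U ^+ N) *m W ^+ N)).
    by rewrite -scalemxAl scalerA mulfV // scale1r -mulmxA UW mulmx1.
  rewrite E mulNmx scalerN mulmx_suml scaler_sumr; congr (- _).
  apply: eq_bigr => j _; rewrite -!scalemxAl !scalerA; congr (_ *: _).
  rewrite mulrCA; congr (_ * _); rewrite mulnBr expfB_cond //.
  by rewrite (negPf t0) leq_mul2l ltnW ?orbT.
have y0 : y != 0.
  by apply: contraNneq Gi => y0;
    rewrite -[row i G](mulmxKV unit_e) -/y y0 mul0mx.
have /rV0Pn[s0 ys0] := y0.
(* Dividing by a coordinate of least order makes the vector regular with a coordinate equal to 1,
   which the relation forces into the maximal ideal. *)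
case: (@arg_minP _ _ _ s0 (fun s => y 0 s != 0) (fun s =>
  ord (infty C) (y 0 s)) ys0).
move=> s ys min_s; apply: (@max_ideal_proper _ _ (infty C)).
pose z := (y 0 s)^-1 *: y.
have zO : mxin (local_ring (infty C)) z.
  move=> i' j; rewrite ord1 mxE; have [->|yj] := eqVneq (y 0 j) 0.
    by rewrite mulr0; exact: (subring0 Or).
  by rewrite /local_ring /= ord_mul ?invr_eq0 // ord_inv // addrC subr_ge0;
    exact: min_s.
have z1 : z 0 s = 1 by rewrite mxE mulVf.
have zE : z = - \sum_(j < N) (p`_j * t ^+ (k * (N - j))) *: (z *m U ^+ j *m W
  ^+ N).
  rewrite /z [X in _ *: X = _]yE scalerN scaler_sumr; congr (- _);
    apply: eq_bigr => j _.
  by rewrite -!scalemxAl !scalerA mulrC.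
rewrite -z1 zE mxE; apply: (idealN mi); rewrite summxE;
  apply: (ideal_sum mi) => j _.
rewrite mxE; apply: (idealMr mi); last first.
  by apply: (mxinM Or); [apply: (mxinM Or) => //|]; exact: mxin_mxX.
apply: (idealM mi); first exact: pO.
right; rewrite ord_exp ot -[_ *+ _]/(_%:R) natz ltz_nat muln_gt0 k0 subn_gt0.
exact: ltn_ord.
Qed.

End InftyTwist.

(** * Motives as lattices with an endomorphism *)

Section GoodLattice.
Variables (F : finFieldType) (C : curve F) (c : {rmorphism coord_ring C -> F}).
Local Notation Q := (funfield C).
Local Notation A := (coord_ring C).
Let Ar := @coords_subring F C.

(** The characteristic condition without the dimension, a form that can be carried over to other
    lattices stable under the same T. *)
Definition locally_nilpotent n r (G : 'M[Q]_(n, r)) (T : 'M[Q]_r) : Prop :=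
  forall a, char_ideal c a -> exists m, forall v, mxspan coords G v ->
    exists2 w, mxspan coords G w & coord_val a ^+ m *: v = w *m T.

Definition pure_at_infty r (T : 'M[Q]_r) : Prop :=
  exists (e : 'M[Q]_r) k l,
    [/\ e \in unitmx, (0 < k)%N, (0 < l)%N & infty_twist e T k l].

Definition motivic n r (G : 'M[Q]_(n, r)) (T : 'M[Q]_r) : Prop :=
  [/\ row_full G, exists2 H, mxin coords H & G *m T = H *m G,
      locally_nilpotent G T & pure_at_infty T].

Lemma pure_at_infty_unit r (T : 'M[Q]_r) : pure_at_infty T -> T \in unitmx.
Proof. by move=> [e [k [l [unit_e _ l0 tw]]]];
  exact: (infty_twist_unit unit_e tw l0). Qed.

Lemma motivic_realized n r (G : 'M[Q]_(n, r)) T :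
  (exists2 x : Q, coords x & ord (infty C) x < 0) -> motivic G T ->
  exists (N : motive c) (psi : N -> 'rV[Q]_r), realizes psi G T.
Proof.
move=> pole [fullG [H HA GT] nilp [e [k [l [unit_e k0 l0 tw]]]]].
have unit_T := infty_twist_unit unit_e tw l0.
exact: (lattice_motive pole fullG unit_T HA GT nilp unit_e k0 l0 tw).
Qed.

Lemma stable_matrix n r (G : 'M[Q]_(n, r)) (S : 'M[Q]_r) :
  (forall v, mxspan coords G v -> mxspan coords G (v *m S)) ->
  exists2 H, mxin coords H & G *m S = H *m G.
Proof.
move=> GS; have /choice[H HP] i : exists h : 'rV[Q]_n, mxin coords h /\
  row i G *m S = h *m G.
  by have /mxspanP[h Ah hE] := GS _ (mxspan_row Ar G i); exists h.
exists (\matrix_i H i); first by move=> i j; rewrite mxE; exact: (HP i).1.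
by apply/row_matrixP => i; rewrite !row_mul rowK (HP i).2.
Qed.

Lemma realizes_stable (N : motive c) n r (psi : N ->
  'rV[Q]_r) (G : 'M[Q]_(n, r)) T :
  realizes psi G T -> exists2 H, mxin coords H & G *m T = H *m G.
Proof.
move=> [_ _ psiP psiT]; apply: stable_matrix => v /psiP[m <-].
by apply/psiP; exists (tau N m); rewrite psiT.
Qed.

Lemma realizes_nilpotent (N : motive c) n r (psi : N ->
  'rV[Q]_r) (G : 'M[Q]_(n, r)) T :
  realizes psi G T -> locally_nilpotent G T.
Proof.
move=> [psiL _ psiP psiT] a Ja; exists (dimension N) => v /psiP[m <-].
have Jpow : ideal_pow (char_ideal c) (dimension N) (a ^+ dimension N).
  exists 1%N, (fun=> 1), (fun=> a ^+ dimension N); split;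
    last by rewrite big_ord1 mul1r.
  move=> _; exists (fun=> a); split=> //.
  by rewrite prodr_const card_ord.
have [m' m'E] := mot_char Jpow m.
exists (psi m'); first by apply/psiP; exists m'.
have psi0 : psi 0 = 0.
  have := psiL 1 0 0; rewrite scaler0 addr0 rmorph1 scale1r => /eqP.
  by rewrite eq_sym addrC -subr_eq0 addrK => /eqP.
by rewrite -psiT -m'E -[a ^+ _ *: m]addr0 psiL psi0 addr0 rmorphXn.
Qed.

Section MotiveLattice.
Variable M : motive c.
Hypothesis nzM : ~ is_zero M.

Lemma motive_lattice : exists n (G : 'M[Q]_(n, rank M)) T (phi : M ->
  'rV[Q]_(rank M)),
  [/\ realizes phi G T, G != 0 & pure_at_infty T].
Proof.
have [n [g gP]] := locally_free_generated (mot_locally_free M).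
have [B [phi [T [phiZ phi_bij phiT [k [l [k0 l0 tw]]]]]]] := mot_pure M.
have [U [e [_ Uoo unit_e stE]]] := stalk_locally_free B (infty C).
pose G : 'M[Q]_(n, rank M) := \matrix_i phi (g i).
have phiE (a : 'I_n ->
  A) : phi (\sum_i a i *: g i) = (\row_i coord_val (a i)) *m G.
  rewrite raddf_sum mulmx_sum_row; apply: eq_bigr => i _ /=.
  by rewrite phiZ mxE rowK.
have phi_inj : injective phi.
  by move=> x y E; case: phi_bij => _ /(_ x y (mem_set I) (mem_set I) E).
exists n, G, T, phi; split.
- split=> //; first by move=> a x y; rewrite raddfD phiZ.
  move=> v; split=> [/mxspanP[a Aa ->]|[m <-]].
    have /choice[b bP] i := coords_val (Aa ord0 i).
    exists (\sum_i b i *: g i); rewrite phiE; congr (_ *m _).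
    by apply/rowP => i; rewrite mxE bP.
  have [a ->] := gP m; apply/mxspanP; exists (\row_i coord_val (a i));
    last exact: phiE.
  by move=> i j; rewrite mxE; exact: coord_valA.
- apply/eqP => G0; apply: nzM => m; apply: phi_inj; have [a ->] := gP m.
  by rewrite phiE G0 mulmx0 raddf0.
exists e, k, l; split=> //.
by have := tw; rewrite /infty_twist /twisted_stalk stE.
Qed.

(** Otherwise the matrix of tau on generators would be regular at infinity, and [infty_twist_pole]
    would make the motive zero. *)
Lemma motive_infty_pole : exists2 x : Q, coords x & ord (infty C) x < 0.
Proof.
have [n [G [T [phi [real G0 [e [k [l [unit_e k0 l0 tw]]]]]]]]] :=
  motive_lattice.
have [H HA GT] := realizes_stable real.
apply: contrapT => nopole; case/eqP: G0.
apply: (infty_twist_pole unit_e tw k0 _ GT) => i j.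
rewrite /local_ring /= leNgt; apply/negP => neg; apply: nopole.
by exists (H i j).
Qed.

(** The point left is that the lattice spans Q^r: a basis of a localisation M[1/f] with [f] nonzero
    stays independent over Q, as denominators can be cleared and A is a domain. *)
Lemma motive_motivic : exists n (G : 'M[Q]_(n, rank M)) T (phi : M ->
  'rV[Q]_(rank M)),
  [/\ realizes phi G T, motivic G T & (0 < rank M)%N].
Proof.
have pole := motive_infty_pole.
have [n [G [T [phi [real G0 pure]]]]] := motive_lattice.
exists n, G, T, phi; split=> //; last first.
  rewrite lt0n; apply: contraNneq G0 => r0; move: G {real}; rewrite r0 => G.
  by rewrite thinmx0.
split=> //; [|exact: realizes_stable real|exact: realizes_nilpotent real].
have [phiL phi_inj phiP _] := real.
have phi0 : phi 0 = 0.
  have := phiL 1 0 0; rewrite scaler0 addr0 rmorph1 scale1r => /eqP.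
  by rewrite eq_sym addrC -subr_eq0 addrK => /eqP.
have phiD x y : phi (x + y) = phi x + phi y.
  by rewrite -[x]scale1r phiL rmorph1 !scale1r.
have phiZ a x : phi (a *: x) = coord_val a *: phi x.
  by rewrite -[a *: x]addr0 phiL phi0 addr0.
have [s [[k [b [f [sf f1]]]] free_s]] := mot_locally_free M.
have [i fi0] : exists i, f i != 0.
  apply: contrapT => nf; have /eqP := f1; rewrite big1 ?oner_eq0 // => i _.
  suff -> : f i = 0 by rewrite mulr0.
  by apply: contrapT => /eqP fi; apply: nf; exists i.
have [E [_ indepE]] := free_s _ (sf i).
pose Em := \matrix_j phi (E j).
have phi_sum (a : 'I_(rank M) -> A) :
    phi (\sum_j a j *: E j) = (\row_j coord_val (a j)) *m Em.
  rewrite mulmx_sum_row (big_morph phi phiD phi0); apply: eq_bigr => j _.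
  by rewrite phiZ mxE rowK.
have val_eq0 (a : A) : coord_val a = 0 -> a = 0 by move=> a0; apply: val_inj.
have unitE : row_free Em.
  apply/inj_row_free => v vE.
  have [a [Aa a0 av]] := coords_frac_mx pole v.
  have /choice[w wE] j := coords_val (av ord0 j).
  have w0 j : w j = 0.
    have [|k' fk] := indepE 0%N w _ j.
      rewrite expr0 scale1r; apply: phi_inj; rewrite phi_sum phi0.
      rewrite (_ : \row_j _ = a *: v); first by rewrite -scalemxAl vE scaler0.
      by apply/rowP => j'; rewrite mxE wE.
    apply/val_eq0; move: (congr1 (@coord_val F C) fk);
      rewrite rmorphM rmorphXn rmorph0.
    move/eqP; rewrite mulf_eq0 expf_eq0 =>
      /orP[/andP[_ /eqP/val_eq0 fi]|/eqP//].
    by rewrite fi eqxx in fi0.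
  apply/rowP => j; have := wE j; rewrite w0 rmorph0 !mxE => /esym/eqP.
  by rewrite mulf_eq0 (negPf a0) /= => /eqP.
have sub : (Em <= G)%MS.
  apply/row_subP => j; rewrite rowK.
  have /mxspanP[x _ ->] : mxspan coords G (phi (E j)) by apply/phiP;
    exists (E j).
  exact: submxMl.
rewrite -sub1mx; apply: submx_trans sub.
by rewrite sub1mx row_full_unit -row_free_unit.
Qed.

End MotiveLattice.
End GoodLattice.

(** * Simple motives *)

Section Realizes.
Variables (F : finFieldType) (C : curve F) (c : {rmorphism coord_ring C -> F}).
Local Notation Q := (funfield C).
Variables (N : motive c) (n r : nat) (psi : N ->
  'rV[Q]_r) (G : 'M[Q]_(n, r)) (T : 'M[Q]_r).
Hypothesis real : realizes psi G T.

Lemma realizes_inj : injective psi. Proof. by case: real. Qed.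

Lemma realizesP v : mxspan coords G v <-> exists m, psi m = v.
Proof. by case: real => _ _ + _; exact. Qed.

Lemma realizes_tau m : psi (tau N m) = psi m *m T.
Proof. by case: real. Qed.

Lemma realizesD x y : psi (x + y) = psi x + psi y.
Proof. by case: real => psiL _ _ _;
  rewrite -[x]scale1r psiL rmorph1 !scale1r. Qed.

Lemma realizes0 : psi 0 = 0.
Proof. by apply: (addrI (psi 0)); rewrite -realizesD !addr0. Qed.

Lemma realizesZ a x : psi (a *: x) = coord_val a *: psi x.
Proof. by case: real => psiL _ _ _;
  rewrite -[a *: x]addr0 psiL realizes0 addr0. Qed.

Lemma realizes_sum k (a : 'I_k -> coord_ring C) (f : 'I_k -> N) :
  psi (\sum_i a i *: f i) = (\row_i coord_val (a i)) *m \matrix_i psi (f i).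
Proof.
rewrite mulmx_sum_row (big_morph psi realizesD realizes0); apply: eq_bigr =>
  j _.
by rewrite realizesZ mxE rowK.
Qed.

Lemma realizes_gen : exists g : 'I_n -> N, forall i, psi (g i) = row i G.
Proof.
have /choice[g gP] i : exists m, psi m = row i G.
  by apply/realizesP; exact: (mxspan_row (@coords_subring F C)).
by exists g.
Qed.

End Realizes.

Section Simple.
Variables (F : finFieldType) (C : curve F) (c : {rmorphism coord_ring C -> F}).
Local Notation Q := (funfield C).
Let Ar := @coords_subring F C.

(** If r' were smaller, the images of the generators would satisfy an extra relation over Q; with
    denominators cleared it is a relation over A, and the isomorphism carries it back. *)
Lemma realizes_rank (M N : motive c) n r (phi : M ->
  'rV[Q]_r) (G : 'M[Q]_(n, r)) T
    n' r' (psi : N -> 'rV[Q]_r') (G' : 'M[Q]_(n', r')) T' :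
  (exists2 x : Q, coords x & ord (infty C) x < 0) ->
  realizes phi G T -> row_full G -> realizes psi G' T' -> mot_isom N M ->
    (r <= r')%N.
Proof.
move=> pole real fullG real' [g [g' gK g'K]].
have [f fP] := realizes_gen real.
pose Y := \matrix_i psi (g' (f i)).
have -> : r = \rank G by apply/eqP; rewrite eq_sym.
apply: leq_trans (rank_leq_col Y); rewrite leqNgt; apply/negP => lt_rank.
have /row_subPn[i ker_i] : ~~ (kermx Y <= kermx G)%MS.
  apply/negP => /mxrankS; rewrite !mxrank_ker.
  have := rank_leq_row G; lia.
have uY : row i (kermx Y) *m Y = 0 by apply/sub_kermxP; exact: row_sub.
set u := row i (kermx Y) in ker_i uY.
have [a [Aa a0 au]] := coords_frac_mx pole u.
have /choice[b bE] j := coords_val (au ord0 j).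
have bu : \row_j coord_val (b j) = a *: u by apply/rowP => j; rewrite mxE bE.
have /asboolP[glin gtau] := hom_funP g.
have g0 : g 0 = 0.
  by have := glin (-1) 0 0; rewrite scaleN1r addNr scaleN1r addNr.
have gD x y : g (x + y) = g x + g y by have := glin 1 x y; rewrite !scale1r.
have gZ k x : g (k *: x) = k *: g x by have := glin k x 0;
  rewrite addr0 g0 addr0.
have sum0 : \sum_j b j *: g' (f j) = 0.
  apply: (realizes_inj real');
    rewrite (realizes_sum real') bu -scalemxAl uY scaler0.
  by rewrite (realizes0 real').
have := congr1 (fun x => phi (g x)) sum0.
rewrite (big_morph g gD g0); under eq_bigr do rewrite gZ g'K.
rewrite (realizes_sum real) g0 (realizes0 real) bu -scalemxAl => /eqP.
rewrite scaler_eq0 (negPf a0) /= => /eqP E; case/negP: ker_i; apply/sub_kermxP.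
by rewrite -[RHS]E; congr (_ *m _); apply/row_matrixP => j; rewrite rowK fP.
Qed.

Variables (n r : nat) (G : 'M[Q]_(n, r)) (T : 'M[Q]_r).
Hypothesis mot : motivic c G T.

(** Everything is pushed forward along the projection [K]. The image of the stalk at infinity is
    again free by [local_basis], and T' is invertible because T is and [K] is onto. *)
Lemma motivic_quotient r' (K : 'M[Q]_(r, r')) (T' : 'M[Q]_r') :
  row_full K -> T *m K = K *m T' -> motivic c (G *m K) T'.
Proof.
move=> fullK TK.
case: mot => fullG [H HA GT] nilp [e [k [l [unit_e k0 l0 tw]]]].
have /row_fullP[B BG] := fullG; have /row_fullP[L LK] := fullK.
have unit_T := infty_twist_unit unit_e tw l0.
have unit_T' : T' \in unitmx.
  rewrite -row_full_unit -col_leq_rank.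
  apply: leq_trans (mxrankM_maxr K T'); rewrite -TK.
  have : (\rank K <= \rank (T *m K))%N.
    by rewrite -{1}(mulKmx unit_T K); exact: mxrankM_maxr.
  by rewrite (eqP fullK).
have TlK m : T ^+ m *m K = K *m T' ^+ m.
  elim: m => [|m IH]; first by rewrite mul1mx mulmx1.
  by rewrite exprS -mulmxE -mulmxA IH mulmxA TK -mulmxA mulmxE -exprS.
split.
- by apply/row_fullP; exists (L *m B); rewrite -mulmxA (mulmxA B) BG mul1mx.
- by exists H => //; rewrite -mulmxA -TK mulmxA GT -mulmxA.
- move=> a /nilp[m am]; exists m => _ /mxspanP[b Ab ->].
  have [|w /mxspanP[w' Aw' ->] wE] := am (b *m G); first by apply/mxspanP;
    exists b.
  exists (w' *m (G *m K)); first by apply/mxspanP; exists w'.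
  by rewrite mulmxA scalemxAl wE -!mulmxA TK.
have Or := local_ring_subring (infty C).
have full_eK : row_full (e *m K).
  by apply/row_fullP; exists (L *m invmx e);
    rewrite -mulmxA (mulmxA (invmx e)) mulVmx // mul1mx.
have [h [unit_h XP]] := local_basis (infty C) full_eK.
exists (rowsub h (e *m K)), k, l; split=> //.
have E := local_basis_span unit_h XP.
rewrite /infty_twist -E; case: tw => tw_fun _ tw_surj; split.
- move=> _ /mxspanP[x xO ->].
  have [|t ot /mxspanP[y yO yE]] := tw_fun (x *m e); first by apply/mxspanP;
    exists x.
  exists t => //; apply/mxspanP; exists y => //.
  by rewrite !mulmxA -yE -[X in _ *: X]mulmxA -TlK -scalemxAl mulmxA.
- move=> v w _ _ /(congr1 (mulmxr (invmx (T' ^+ l)))) /=.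
  have unit_Tl : T' ^+ l \in unitmx by rewrite unitmxE -unitmxE; elim: (l) =>
    [|m]; rewrite ?unitmx1 // exprS -mulmxE unitmx_mul unit_T'.
  by rewrite !mulmxK.
- move=> v /= [t ot] /mxspanP[x xO xE].
  have t0 : t != 0 by apply: contra_eq_neq ot => ->; rewrite ord_zero.
  have [|y /mxspanP[y' y'O ->] yE] := tw_surj (t ^- k *: (x *m e)).
    exists t => //; rewrite /= scalerA mulfV ?expf_neq0 // scale1r.
    by apply/mxspanP; exists x.
  exists (y' *m (e *m K)); first by apply/mxspanP; exists y'.
  rewrite mulmxA -[X in X = _]mulmxA -TlK mulmxA yE -scalemxAl -mulmxA -xE.
  by rewrite scalerA mulVf ?scale1r // expf_neq0.
Qed.

Variables (M : motive c) (phi : M -> 'rV[Q]_r).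
Hypothesis real : realizes phi G T.
Hypothesis simpleM : simple_motive M.

(** A stable W other than 0 and Q^r gives a factor motive that is nonzero and of smaller rank,
    against simplicity. *)
Lemma simple_irreducible (W : 'M[Q]_r) : (W *m T <= W)%MS ->
  W = 0 \/ row_full W.
Proof.
move=> WT; apply: contrapT => /not_orP[/eqP W0 /negP Wfull].
have pole := motive_infty_pole simpleM.1.
(* [K] is the projection of Q^r onto Q^r / W in coordinates, with kernel W. *)
have [K fullK KE] : exists2 K : 'M[Q]_(r, \rank (cokermx W)), row_full K &
    forall m (v : 'M[Q]_(m, r)), (v <= W)%MS = (v *m K == 0).
  exists (col_base (cokermx W)); first exact: col_base_full.
  move=> m v; rewrite submxE -{1}(mulmx_base (cokermx W)) mulmxA.
  apply/eqP/eqP => [|->]; last by rewrite mul0mx.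
  have /row_freeP[R RR] := row_base_free (cokermx W).
  by move=> /(congr1 (mulmxr R)); rewrite /= -mulmxA RR mulmx1 mul0mx.
have /row_fullP[L LK] := fullK.
have TK : T *m K = K *m (L *m T *m K).
  apply/eqP; rewrite -subr_eq0 -mulmxA !mulmxA -!mulmxBl; apply/eqP.
  have : ((1%:M - K *m L) *m T *m K == 0).
    rewrite -KE; apply: submx_trans WT; apply: submxMr.
    by rewrite KE mulmxBl mul1mx -mulmxA LK mulmx1 subrr.
  by move=> /eqP H; rewrite (mulmxBl 1%:M) mul1mx in H.
have mot' := motivic_quotient fullK TK.
have [N [psi real']] := motivic_realized pole mot'.
have /choice[f fP] m : exists x, psi x = phi m *m K.
  apply/(realizesP real');
    have /(realizesP real)/mxspanP[b Ab ->] : exists m', phi m' = phi m by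
      exists m.
  by apply/mxspanP; exists b; rewrite ?mulmxA.
have f_hom : f \in @is_hom F C c M N.
  apply/asboolP; split=> [a x y|m]; apply: (realizes_inj real').
    rewrite (realizesD real') (realizesZ real') !fP (realizesD real) (realizesZ
      real).
    by rewrite mulmxDl scalemxAl.
  by rewrite fP (realizes_tau real) (realizes_tau real') fP -mulmxA TK mulmxA.
have rK : (0 < \rank (cokermx W))%N.
  by rewrite mxrank_coker subn_gt0 ltn_neqAle Wfull rank_leq_row.
have ltK : (\rank (cokermx W) < r)%N.
  rewrite mxrank_coker; have := rank_leq_col W.
  by rewrite -mxrank_eq0 -lt0n in W0; lia.
have [|zN|isoN] := simpleM.2 N.
- exists (MotHom f_hom) => x /=.
  have /(realizesP real')/mxspanP[b Ab xE] : exists x', psi x' = psi x by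
    exists x.
  have [m mE] : exists m, phi m = b *m G by apply/(realizesP real)/mxspanP;
    exists b.
  by exists m; apply: (realizes_inj real'); rewrite fP mE xE mulmxA.
- have [g gP] := realizes_gen real'.
  have G0 : G *m K = 0.
    by apply/row_matrixP => i; rewrite -gP (zN (g i)) (realizes0 real') row0.
  by case: mot' => /eqP + _ _ _; rewrite G0 mxrank0 => rK0; rewrite -rK0 in rK.
- case: mot => fullG _ _ _.
  by have := realizes_rank pole real fullG real' isoN; rewrite leqNgt ltK.
Qed.

End Simple.

(** * The field generated by an irreducible matrix *)

Section IrreducibleField.
Variables (Q : fieldType) (n : nat) (T : 'M[Q]_n.+1).
Hypothesis irr : forall W : 'M[Q]_n.+1, (W *m T <= W)%MS -> W = 0 \/ row_full W.

Let chi := char_poly T.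

Let horner_mx_mod p : horner_mx T (p %% chi) = horner_mx T p.
Proof.
rewrite [in RHS](divp_eq p chi) rmorphD rmorphM /= (Cayley_Hamilton T).
by rewrite mulr0 add0r.
Qed.

Let chi_neq0 : chi != 0. Proof. exact: monic_neq0 (char_poly_monic T). Qed.

Definition krylov (v : 'rV[Q]_n.+1) : 'M[Q]_n.+1 := \matrix_i (v *m T ^+ i).

Lemma horner_krylov v (p : {poly Q}) : (size p <= n.+1)%N ->
  v *m horner_mx T p = (\row_(i < n.+1) p`_i) *m krylov v.
Proof.
move=> sp; rewrite horner_mx_sum [RHS]mulmx_sum_row mulmx_sumr.
rewrite (big_ord_widen n.+1 (fun i => v *m (p`_i *: T ^+ i))) // big_mkcond /=.
apply: eq_bigr => i _; rewrite mxE rowK -scalemxAr; case: ltnP => // le_pi.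
by rewrite nth_default // scale0r.
Qed.

(** By Cayley-Hamilton the span of the v T^i, i at most n, is T-stable, so every nonzero vector is
    cyclic. *)
Lemma krylov_unit v : v != 0 -> krylov v \in unitmx.
Proof.
move=> v0; have subK m : (v *m T ^+ m <= krylov v)%MS.
  have -> : T ^+ m = horner_mx T ('X^m %% chi).
    by rewrite horner_mx_mod rmorphXn /= horner_mx_X.
  rewrite horner_krylov ?submxMl // -ltnS.
  by rewrite -(size_char_poly T) ltn_modp chi_neq0.
have [|K0|] := irr (W := krylov v).
- apply/row_subP => i; rewrite row_mul rowK -mulmxA mulmxE -exprSr; exact: subK.
- by case/eqP: v0; have /row_matrixP/(_ ord0) := K0; rewrite rowK row0 mulmx1.
- by rewrite row_full_unit.
Qed.

Let v0 : 'rV[Q]_n.+1 := delta_mx 0 0.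
Let v0_neq0 : v0 != 0.
Proof. by apply/eqP => /rowP/(_ 0); rewrite !mxE !eqxx => /eqP;
  rewrite oner_eq0. Qed.

(** p(T) commutes with T, so its kernel is stable; it is not everything, since the coordinates of v0
    p(T) in the Krylov basis are the coefficients of p. *)
Lemma horner_mx_unit (p : {poly Q}) : p != 0 -> (size p <= n.+1)%N ->
  horner_mx T p \in unitmx.
Proof.
move=> p0 sp; set X := horner_mx T p.
have XT : X *m T = T *m X by exact: (comm_horner_mx p (commr_refl T)).
have X0 : X != 0.
  apply: contraNneq p0 => X0; have := horner_krylov v0 sp;
    rewrite -/X X0 mulmx0.
  move=> /esym /(congr1 (mulmxr (invmx (krylov v0)))).
  rewrite /= mul0mx mulmxK ?krylov_unit // => /rowP pv; apply/eqP/polyP => i.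
  rewrite coef0; have [lt_in|le_ni] := ltnP i n.+1; last first.
    by rewrite nth_default // (leq_trans sp).
  by have := pv (Ordinal lt_in); rewrite !mxE.
rewrite -row_free_unit -kermx_eq0.
have [|->|full] := irr (W := kermx X); [|by rewrite eqxx|].
  by apply/sub_kermxP; rewrite -mulmxA -XT mulmxA mulmx_ker mul0mx.
case/eqP: X0; have : (1%:M <= kermx X)%MS by rewrite sub1mx.
by move=> /sub_kermxP; rewrite mul1mx.
Qed.

(** In a proper factorisation both factors would be invertible at T, but their product vanishes
    there. *)
Lemma char_poly_irreducible : irreducible_poly chi.
Proof.
split=> [|q q1 q_chi]; first by rewrite size_char_poly.
rewrite -(dvdp_size_eqp q_chi); apply: contraT => neq_size.
have [h chiE] := dvdpP _ _ q_chi.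
have [h0 q0] : h != 0 /\ q != 0.
  by move: chi_neq0; rewrite chiE mulf_eq0 => /norP[].
have size_hq : (size h + size q)%N = n.+3.
  have := size_mul h0 q0; rewrite -chiE size_char_poly => ->.
  by rewrite prednK // addn_gt0 size_poly_gt0 h0.
rewrite size_char_poly in neq_size.
have sq : (0 < size q)%N by rewrite size_poly_gt0.
have le_q : (size q <= n.+2)%N by have := dvdp_leq chi_neq0 q_chi;
  rewrite size_char_poly.
have hU : horner_mx T h \in unitmx by apply: horner_mx_unit => //;
  move: (size h) (size q) size_hq q1 sq => a b; lia.
have qU : horner_mx T q \in unitmx by apply: horner_mx_unit => //;
  move: (size q) neq_size le_q => b; lia.
have := Cayley_Hamilton T; rewrite -/chi chiE rmorphM /= => hq0.
have : horner_mx T h *m horner_mx T q \in unitmx by rewrite unitmx_mul hU.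
by rewrite mulmxE hq0 unitmxE det0 unitr0.
Qed.

(** E is Q[X] modulo the characteristic polynomial, and theta sends v0 p(T) to p(z). *)
Theorem irreducible_field : exists (E : fieldExtType Q) (z : E) (theta :
  'rV[Q]_n.+1 -> E),
  [/\ <<1%AS; z>>%VS = fullv, linear theta, bijective theta
    & forall v, theta (v *m T) = z * theta v].
Proof.
have [E dimE [z z_root z_gen]] := irredp_FAdjoin char_poly_irreducible.
pose theta (v : 'rV[Q]_n.+1) : E :=
  \sum_i (v *m invmx (krylov v0)) 0 i *: z ^+ i.
have theta_lin : linear theta.
  move=> a v w; rewrite /theta scaler_sumr -big_split; apply: eq_bigr => i _ /=.
  by rewrite mulmxDl -scalemxAl !mxE scalerDl scalerA.
have Kv0 : krylov v0 \in unitmx by exact: krylov_unit.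
have theta_poly (p : {poly Q}) : theta (v0 *m horner_mx T p) = (map_poly
  (in_alg E) p).[z].
  have -> : (map_poly (in_alg E) p).[z] = (map_poly (in_alg E) (p %%
    chi)%R).[z].
    rewrite [in LHS](divp_eq p chi) rmorphD rmorphM hornerD hornerM.
    by rewrite (rootP z_root) mulr0 add0r.
  rewrite -horner_mx_mod.
  have sp : (size (p %% chi)%R <= n.+1)%N by rewrite -ltnS -(size_char_poly T)
    ltn_modp chi_neq0.
  rewrite horner_krylov // /theta mulmxK // (@horner_coef_wide _ n.+1);
    last first.
    by rewrite size_map_poly.
  by apply: eq_bigr => i _; rewrite mxE coef_map /= mulr_algl.
have theta_surj y : exists v, theta v = y.
  have : y \in <<1%AS; z>>%VS by rewrite z_gen memvf.
  move=> /Fadjoin_polyP[q /polyOver1P[p ->] ->].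
  by exists (v0 *m horner_mx T p).
have poly_v v : exists p, v = v0 *m horner_mx T p.
  exists (rVpoly (v *m invmx (krylov v0))).
  rewrite horner_krylov ?size_poly // -[LHS](mulmxKV Kv0); congr (_ *m _).
  by apply/rowP => i; rewrite [RHS]mxE coef_rVpoly_ord.
have thetaT v : theta (v *m T) = z * theta v.
  have [p ->] := poly_v v; rewrite -mulmxA mulmxE.
  have -> : horner_mx T p * T = horner_mx T (p * 'X) by rewrite rmorphM /=
    horner_mx_X.
  by rewrite !theta_poly rmorphM /= map_polyX hornerMX mulrC.
exists E, z, theta; split=> //.
have theta0 : theta 0 = 0.
  by have := theta_lin (-1) 0 0; rewrite !scaleN1r !addNr.
have thetaD x y : theta (x + y) = theta x + theta y.
  by have := theta_lin 1 x y; rewrite !scale1r.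
have thetaZ a x : theta (a *: x) = a *: theta x.
  by have := theta_lin a x 0; rewrite theta0 !addr0.
(* A nonzero [v] killed by theta would be cyclic, so [v0], a combination of the v T^i, would be
   killed too; but theta sends [v0] to 1. *)
have theta_eq0 v : theta v = 0 -> v = 0.
  move=> v_0; apply: contrapT => /eqP /krylov_unit Kv.
  have : theta v0 = 0.
    rewrite -(mulmxKV Kv v0) mulmx_sum_row (big_morph theta thetaD theta0).
    apply: big1 => i _; rewrite thetaZ rowK.
    suff -> : theta (v *m T ^+ i) = 0 by rewrite scaler0.
    elim: (i : nat) => [|j IH]; first by rewrite mulmx1.
    by rewrite exprSr -mulmxE mulmxA thetaT IH mulr0.
  have := theta_poly 1; rewrite rmorph1 mulmx1 rmorph1 hornerC => -> /eqP.
  by rewrite oner_eq0.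
have theta_inj : injective theta.
  move=> v w E'; apply/eqP; rewrite -subr_eq0; apply/eqP/theta_eq0.
  by rewrite -scaleN1r thetaD thetaZ E' scaleN1r subrr.
have /choice[g gP] := theta_surj.
by exists g => [v|y] //; apply: theta_inj; rewrite gP.
Qed.

End IrreducibleField.

Lemma Cayley_Hamilton_sum (R : comNzRingType) n (X : 'M[R]_n) :
  \sum_(j < n.+1) (char_poly X)`_j *: X ^+ j = 0.
Proof.
case: n X => [|n] X; first by apply/matrixP => -[].
by rewrite -[RHS](Cayley_Hamilton X) horner_mx_sum size_char_poly.
Qed.

Lemma char_poly_similar (K : fieldType) n (e X Y : 'M[K]_n) :
  e \in unitmx -> e *m X = Y *m e -> char_poly X = char_poly Y.
Proof.
move=> unit_e eX; pose ec := map_mx polyC e.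
have E : ec *m char_poly_mx X = char_poly_mx Y *m ec.
  rewrite /char_poly_mx mulmxBr mulmxBl -!map_mxM eX; congr (_ - _).
  by rewrite scalar_mxC.
have ec0 : \det ec != 0.
  by rewrite det_map_mx polyC_eq0 -unitfE -unitmxE.
by apply: (mulfI ec0); rewrite -det_mulmx E det_mulmx mulrC.
Qed.

(** * Characteristic polynomials over A and lattices in E *)

Section LatticeMatrix.
Variables (F : finFieldType) (C : curve F).
Local Notation Q := (funfield C).
Let Ar := @coords_subring F C.

(* Over each local ring the lattice is free, so S is there similar to a       *)
(* matrix with entries in that ring.                                          *)
Lemma char_poly_coords n r (G : 'M[Q]_(n, r)) (S : 'M[Q]_r) H :
  row_full G -> mxin coords H -> G *m S = H *m G ->
  forall i, coords (char_poly S)`_i.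
Proof.
move=> fullG HA GS i; apply/coordsP => P Pa.
have Or := local_ring_subring P.
have [h [unit_h XP]] := local_basis P fullG; set e := rowsub h G in unit_h XP.
pose Z := rowsub h H *m (G *m invmx e).
have eS : e *m S = Z *m e.
  by rewrite /Z -!mulmxA mulVmx // mulmx1 /e !mul_rowsub_mx GS.
rewrite (char_poly_similar unit_h eS); apply: (char_poly_in Or).
apply: (mxinM Or) => //; apply: mxin_rowsub => a b;
  exact: coords_local (HA a b).
Qed.

(* For b in the characteristic ideal the matrix X = b^m T^-1 stabilises G, so *)
(* its characteristic polynomial has coefficients in A; multiplied by         *)
(* T^(r-1), the Cayley-Hamilton relation for X expresses b^(mr) T^-1 as a     *)
(* polynomial in T over A.                                                    *)
Lemma motivic_transfer (c : {rmorphism coord_ring C -> F}) n n' r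
    (G : 'M[Q]_(n, r)) (G' : 'M[Q]_(n', r)) T :
  motivic c G T -> row_full G' ->
  (forall v, mxspan coords G' v -> mxspan coords G' (v *m T)) -> motivic c G' T.
Proof.
move=> [fullG _ nilp pure] fullG' stab'.
have unit_T := pure_at_infty_unit pure.
split=> //; first exact: stable_matrix.
move=> a /nilp[m am]; exists (m * r)%N => v Gv.
pose b := coord_val a ^+ m; pose X := b *: invmx T.
have [Y YA GX] : exists2 Y, mxin coords Y & G *m X = Y *m G.
  apply: stable_matrix => w /am[w' Gw' E].
  by rewrite -scalemxAr scalemxAl E mulmxK.
have chiA := char_poly_coords fullG YA GX.
have Ab : coords b by apply: (subringX Ar); exact: coord_valA.
have stabX j w : mxspan coords G' w -> mxspan coords G' (w *m T ^+ j).
  elim: j w => [|j IH] w Gw; first by rewrite mulmx1.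
  by rewrite exprS -mulmxE mulmxA; apply/IH/stab'.
pose w := - \sum_(j < r) ((char_poly X)`_j * b ^+ j) *: (v *m T ^+ (r.-1 - j)).
exists w.
  rewrite /w -scaleN1r; apply: (mxspanZ Ar).
    by apply: (subringN Ar); exact: (subring1 Ar).
  apply: big_ind; [exact: mxspan0|exact: mxspanD|move=> j _].
  apply: (mxspanZ Ar); last exact: stabX.
  by apply: (subringM Ar) => //; exact: (subringX Ar).
have CH := Cayley_Hamilton_sum X.
have XT j i : (j <= i)%N -> X ^+ j *m T ^+ i = b ^+ j *: T ^+ (i - j).
  move=> le_ji; rewrite -{1}(subnKC le_ji); move: (i - j)%N => {le_ji}k.
  elim: j => [|j IH]; first by rewrite add0n mul1mx scale1r.
  have XT1 : X *m T = b *: 1%:M by rewrite -scalemxAl mulVmx.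
  rewrite exprSr addSn exprS -!mulmxE -mulmxA (mulmxA X) XT1 -scalemxAl mul1mx.
  by rewrite -scalemxAr IH scalerA -exprS.
clearbody X.
have := congr1 (fun Z => v *m Z *m T ^+ r) CH.
rewrite big_ord_recr /= mulmx0 mul0mx.
have -> : (char_poly X)`_r = 1.
  by have := char_poly_monic X; rewrite monicE lead_coefE size_char_poly =>
    /eqP.
rewrite scale1r mulmxDr mulmxDl addrC => /eqP; rewrite addr_eq0 => /eqP.
rewrite -mulmxA XT // subnn mulmx_sumr mulmx_suml -scalemxAr mulmx1 exprM => ->.
rewrite mulNmx mulmx_suml; congr (- _); apply: eq_bigr => j _.
rewrite -scalemxAr -scalemxAl -mulmxA XT; last exact: ltnW.
rewrite -scalemxAr scalerA -scalemxAl; congr (_ *: _).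
rewrite -mulmxA; congr (_ *m _); rewrite mulmxE -exprSr; congr (_ ^+ _).
by have := ltn_ord j; lia.
Qed.

Variables (E : fieldExtType Q).

Lemma A_lattice_matrix d (kappa : E -> 'rV[Q]_d) (L : set E) :
  linear kappa -> bijective kappa -> A_lattice L ->
  exists n (G : 'M[Q]_(n, d)), row_full G /\ forall y, L y <->
    mxspan coords G (kappa y).
Proof.
move=> klin [kappa' kK k'K] [n [b [b_span ->]]].
have k0 : kappa 0 = 0 by have := klin (-1) 0 0; rewrite !scaleN1r !addNr.
have kD x y : kappa (x + y) = kappa x + kappa y by have := klin 1 x y;
  rewrite !scale1r.
have kZ a x : kappa (a *: x) = a *: kappa x by have := klin a x 0;
  rewrite k0 !addr0.
pose G := \matrix_i kappa (tnth b i).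
have kE (a : 'I_n -> Q) : kappa (\sum_i a i *: tnth b i) = (\row_i a i) *m G.
  rewrite (big_morph kappa kD k0) mulmx_sum_row; apply: eq_bigr => i _.
  by rewrite kZ mxE rowK.
exists n, G; split.
  apply/row_fullP; exists (\matrix_j \row_i coord b i (kappa' (delta_mx 0 j))).
  apply/row_matrixP => j; rewrite row_mul rowK -kE row1 -[RHS]k'K;
    congr (kappa _).
  have : kappa' (delta_mx 0 j) \in <<b>>%VS by rewrite b_span memvf.
  by move=> /coord_span {2}->; apply: eq_bigr => i _; rewrite (tnth_nth 0).
move=> y; split=> [[a ->]|].
  by rewrite kE; apply/mxspanP; eexists; last by []; move=> i j; rewrite mxE;
    exact: coord_valA.
move=> /mxspanP[a Aa ka]; have /choice[a' a'E] i := coords_val (Aa ord0 i).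
exists a'; apply: (can_inj kK); rewrite ka kE; congr (_ *m _).
by apply/rowP => i; rewrite mxE a'E.
Qed.

Lemma A_latticeD (L : set E) x y : A_lattice L -> L x -> L y -> L (x + y).
Proof.
move=> [n [b [_ ->]]] [a ->] [a' ->]; exists (fun i => a i + a' i).
by rewrite -big_split; apply: eq_bigr => i _; exact: (esym (scalerDl _ _ _)).
Qed.

Lemma A_latticeZ (L : set E) (a : coord_ring C) x : A_lattice L -> L x ->
  L (coord_val a *: x).
Proof.
move=> [n [b [_ ->]]] [a' ->]; exists (fun i => a * a' i).
by rewrite scaler_sumr; apply: eq_bigr => i _; rewrite scalerA.
Qed.

Lemma A_lattice0 (L : set E) : A_lattice L -> L 0.
Proof.
move=> [n [b [_ ->]]]; exists (fun=> 0).
by rewrite big1 // => i _; rewrite rmorph0 scale0r.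
Qed.

Lemma A_lattice_sum (L : set E) I (s : seq I) (P : pred I) f :
  A_lattice L -> (forall i, P i -> L (f i)) -> L (\sum_(i <- s | P i) f i).
Proof.
move=> Ll Lf; apply: big_ind => //; first exact: A_lattice0.
by move=> x y; exact: A_latticeD.
Qed.

Hypothesis pole : exists2 x : Q, coords x & ord (infty C) x < 0.

(** Only the finitely many coordinates of x times the generators of L need a common denominator. *)
Lemma A_lattice_scale (L L' : set E) (x : E) : A_lattice L -> A_lattice L' ->
  exists2 a : coord_ring C, a != 0 & forall y, L y ->
    L' (coord_val a *: (x * y)).
Proof.
move=> [n [b [_ ->]]] Ll'; have [n' [b' [b'_span L'E]]] := Ll'.
pose q i j := coord b' j (x * tnth b i).
have [a [Aa a0 aq]] := coords_frac_fin pole (fun ij : 'I_n * 'I_n' =>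
  q ij.1 ij.2).
have [a' a'E] := coords_val Aa.
exists a'; first by apply: contraNneq a0 => a'0; rewrite -a'E a'0 rmorph0.
move=> _ [w ->]; rewrite mulr_sumr scaler_sumr; apply: A_lattice_sum => // i _.
rewrite -scalerAr scalerA mulrC -scalerA; apply: A_latticeZ => //.
have : x * tnth b i \in <<b'>>%VS by rewrite b'_span memvf.
move=> /coord_span ->; rewrite scaler_sumr L'E.
have /choice[z zE] j := coords_val (aq (i, j)).
exists z; apply: eq_bigr => j _.
by rewrite scalerA a'E zE (tnth_nth 0 b').
Qed.

(** Multiplication by pi preserves R, so its characteristic polynomial has coefficients in A. The
    Cayley-Hamilton relation divided by pi expresses the constant term over pi, which is N(pi)/pi up
    to sign, as a polynomial in pi over A. *)
Lemma order_norm (R : set E) (pi : E) : A_order R -> R pi -> pi != 0 ->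
  R ((field_norm pi)%:A / pi).
Proof.
move=> [Rl R1 RM] Rpi pi0.
pose d := \dim {:E}; pose e := vbasis {:E}.
have e_basis : basis_of {:E} e := vbasisP _.
pose B : 'M[Q]_d := passmx.mxof e e (amull pi).
pose kappa := passmx.rVof e.
have kB y : kappa (pi * y) = kappa y *m B.
  by rewrite /kappa /B -passmx.rVof_app // lfunE.
have k_lin : linear kappa by exact: passmx.rVof_linear.
have k_bij : bijective kappa.
  by exists (passmx.vecof e); [exact: passmx.rVofK|exact: passmx.vecofK].
have [n [G [fullG GP]]] := A_lattice_matrix k_lin k_bij Rl.
have [k' kK k'K] := k_bij.
have [H HA GB] : exists2 H, mxin coords H & G *m B = H *m G.
  apply: stable_matrix => v; rewrite -[v]k'K => /GP Rv.
  by rewrite -kB; apply/GP; exact: RM.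
have bA := char_poly_coords fullG HA GB; set chi := char_poly B in bA.
have chi_pi : \sum_(j < d.+1) chi`_j *: pi ^+ j = 0.
  apply: (can_inj kK).
  have k0 : kappa 0 = 0 by have := k_lin (-1) 0 0; rewrite !scaleN1r !addNr.
  have kD x y : kappa (x + y) = kappa x + kappa y by have := k_lin 1 x y;
    rewrite !scale1r.
  have kZ a x : kappa (a *: x) = a *: kappa x by have := k_lin a x 0;
    rewrite k0 !addr0.
  rewrite k0 (big_morph kappa kD k0) -[RHS](mulmx0 _ (kappa 1))
    -(Cayley_Hamilton_sum B) mulmx_sumr.
  apply: eq_bigr => j _; rewrite kZ -scalemxAr; congr (_ *: _).
  elim: (j : nat) => [|i IH]; first by rewrite mulmx1.
  by rewrite exprS kB exprSr -mulmxE mulmxA -IH.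
have Rpow j : R (pi ^+ j).
  by elim: j => [//|j IH]; rewrite exprS; exact: RM.
have RZ q y : coords q -> R y -> R (q *: y).
  by move=> /coords_val[a <-]; exact: A_latticeZ.
have -> : (field_norm pi)%:A / pi =
    ((-1) ^+ d * -1) *: \sum_(j < d) chi`_j.+1 *: pi ^+ j.
  have -> : field_norm pi = (-1) ^+ d * chi`_0.
    by rewrite /chi char_poly_det signrMK.
  apply: (mulIf pi0); rewrite divfK // -scalerAl mulr_suml.
  move: chi_pi; rewrite big_ord_recl expr0 => /eqP; rewrite addr_eq0 => /eqP E0.
  rewrite -scalerA E0 -scalerA scaleN1r; congr (_ *: - _).
  by apply: eq_bigr => j _; rewrite -scalerAl -exprSr.
apply: (RZ).
  have Am1 : coords (-1 : Q) by apply: (subringN Ar); exact: (subring1 Ar).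
  by apply: (subringM Ar) => //; exact: (subringX Ar).
by apply: A_lattice_sum => // j _; exact: RZ.
Qed.

End LatticeMatrix.

(** * Lattices in E and isogenies *)

Section Embeddings.
Variables (F : finFieldType) (C : curve F) (c : {rmorphism coord_ring C -> F}).
Local Notation Q := (funfield C).
Local Notation A := (coord_ring C).
Variables (E : fieldExtType Q) (z : E).
Hypothesis z_gen : <<1%AS; z>>%VS = fullv.
Hypothesis pole : exists2 x : Q, coords x & ord (infty C) x < 0.

(** The counterpart of [realizes] once Q^r is identified with E, T becoming multiplication by
    [z]. *)
Definition embeds (N : motive c) (psi : N -> E) (L : set E) : Prop :=
  [/\ forall a x y, psi (a *: x + y) = coord_val a *: psi x + psi y,
      injective psi,
      forall y, L y <-> exists m, psi m = y
    & forall m, psi (tau N m) = z * psi m].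

Section Embeds.
Variables (N : motive c) (psi : N -> E) (L : set E).
Hypothesis emb : embeds psi L.

Lemma embeds_inj : injective psi. Proof. by case: emb. Qed.
Lemma embedsP y : L y <-> exists m, psi m = y.
Proof. by case: emb => _ _ + _; exact. Qed.
Lemma embeds_mem m : L (psi m). Proof. by apply/embedsP; exists m. Qed.
Lemma embeds_tau m : psi (tau N m) = z * psi m. Proof. by case: emb. Qed.
Lemma embedsD x y : psi (x + y) = psi x + psi y.
Proof. by case: emb => psiL _ _ _;
  rewrite -[x]scale1r psiL rmorph1 !scale1r. Qed.
Lemma embeds0 : psi 0 = 0.
Proof. by apply: (addrI (psi 0)); rewrite -embedsD !addr0. Qed.
Lemma embedsZ a x : psi (a *: x) = coord_val a *: psi x.
Proof. by case: emb => psiL _ _ _;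
  rewrite -[a *: x]addr0 psiL embeds0 addr0. Qed.
Lemma embeds_sum I (s : seq I) (f : I -> N) :
  psi (\sum_(i <- s) f i) = \sum_(i <- s) psi (f i).
Proof. exact: (big_morph psi embedsD embeds0). Qed.
Lemma embeds_iter m k : psi (iter k (tau N) m) = z ^+ k * psi m.
Proof.
by elim: k => [|k IH] /=; rewrite ?mul1r // embeds_tau IH exprS mulrA.
Qed.
End Embeds.

Section HomFacts.
Variables (N N' : motive c) (f : Defs.hom N N').
Lemma hom_linear : linear f. Proof. by have /asboolP[] := hom_funP f. Qed.
Lemma hom_tau m : f (tau N m) = tau N' (f m).
Proof. by have /asboolP[_ ->] := hom_funP f. Qed.
Lemma hom_add x y : f (x + y) = f x + f y.
Proof. by have := hom_linear 1 x y; rewrite !scale1r. Qed.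
Lemma hom_zero : f 0 = 0.
Proof. by apply: (addrI (f 0)); rewrite -hom_add !addr0. Qed.
Lemma hom_scale a x : f (a *: x) = a *: f x.
Proof. by rewrite -[a *: x]addr0 hom_linear hom_zero addr0. Qed.
Lemma hom_iter m k : f (iter k (tau N) m) = iter k (tau N') (f m).
Proof. by elim: k => //= k IH; rewrite hom_tau IH. Qed.
End HomFacts.

(* Every element of E is a polynomial in z, and homomorphisms commute with    *)
(* tau, which is multiplication by z: so they are multiplications.            *)
Lemma hom_mult (N N' : motive c) psi psi' L L' (f : Defs.hom N N') :
  embeds (N := N) psi L -> embeds (N := N') psi' L' ->
  exists e, forall m, psi' (f m) = e * psi m.
Proof.
move=> emb emb'; have [zN|] := pselect (is_zero N).
  by exists 0 => m; rewrite (zN m) hom_zero (embeds0 emb') mul0r.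
move=> /existsNP[m0 /eqP m00].
have p0 : psi m0 != 0 by rewrite -(embeds0 emb) (inj_eq (embeds_inj emb)).
exists (psi' (f m0) / psi m0) => m.
have : psi m / psi m0 \in <<1%AS; z>>%VS by rewrite z_gen memvf.
move=> /Fadjoin_polyP[q /polyOver1P[p ->] pE].
have [a [Aa a0 ap]] := coords_frac_fin pole (fun i : 'I_(size p) => p`_i).
have /choice[b bE] i := coords_val (ap i); have [a' a'E] := coords_val Aa.
have am : a' *: m = \sum_i b i *: iter i (tau N) m0.
  apply: (embeds_inj emb); rewrite (embedsZ emb) (embeds_sum emb) a'E.
  rewrite -[psi m](divfK p0) pE (horner_coef_wide _ (size_poly _ _)) mulr_suml
    scaler_sumr.
  apply: eq_bigr => i _; rewrite (embedsZ emb) (embeds_iter emb) bE coef_map /=.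
  by rewrite mulr_algl -scalerAl scalerA.
have fam : a' *: f m = \sum_i b i *: iter i (tau N') (f m0).
  rewrite -hom_scale am (big_morph f (hom_add f) (hom_zero f)).
  by apply: eq_bigr => i _; rewrite hom_scale hom_iter.
have key : (a *: psi' (f m)) * psi m0 = (a *: psi m) * psi' (f m0).
  rewrite -a'E -(embedsZ emb) -(embedsZ emb') am fam (embeds_sum emb)
    (embeds_sum emb').
  rewrite !mulr_suml; apply: eq_bigr => i _.
  rewrite (embedsZ emb) (embedsZ emb') (embeds_iter emb) (embeds_iter emb').
  by rewrite -!scalerAl mulrAC.
apply: (mulIf p0); apply: (scalerI a0); rewrite scalerAl key mulrAC divfK //.
by rewrite -scalerAl mulrC.
Qed.

Lemma mult_hom (N N' : motive c) psi psi' L L' e :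
  embeds (N := N) psi L -> embeds (N := N') psi' L' ->
  (forall x, L x -> L' (e * x)) ->
    exists f : Defs.hom N N', forall m, psi' (f m) = e * psi m.
Proof.
move=> emb emb' eL.
have /choice[f fP] m : exists m', psi' m' = e * psi m.
  by apply/(embedsP emb')/eL/(embeds_mem emb).
have f_hom : f \in @is_hom F C c N N'.
  apply/asboolP; split=> [a x y|m]; apply: (embeds_inj emb').
    rewrite (embedsD emb') (embedsZ emb') !fP (embedsD emb) (embedsZ emb).
    by rewrite mulrDr scalerAr.
  by rewrite (embeds_tau emb') !fP (embeds_tau emb) mulrCA.
by exists (MotHom f_hom).
Qed.

Lemma embeds_shift (N N' : motive c) psi L (f : Defs.hom N' N) :
  embeds (N := N) psi L -> injective f ->
  embeds (psi \o f) [set y | exists m, psi (f m) = y].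
Proof.
move=> emb f_inj; split=> //=.
- by move=> a x y; rewrite hom_linear (embedsD emb) (embedsZ emb).
- by apply: inj_comp => //; exact: (embeds_inj emb).
- by move=> m; rewrite hom_tau (embeds_tau emb).
Qed.

Lemma embeds_lattice_iso (N N' : motive c) psi psi' L L' (f : Defs.hom N N') R :
  embeds (N := N) psi L -> embeds (N := N') psi' L' -> bijective f ->
  lattice_iso R L L'.
Proof.
move=> emb emb' [g gK fK]; have [e eP] := hom_mult f emb emb'.
exists (fun x => e * x); split; last 2 first.
- by move=> x y _ _; rewrite mulrDr.
- by move=> a x _ _; rewrite mulrCA.
split.
- move=> _ /(embedsP emb)[m <-]; rewrite /= -eP; exact: (embeds_mem emb').
- move=> x y /set_mem/(embedsP emb)[m <-] /set_mem/(embedsP emb)[m' <-].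
  by rewrite -!eP => /(embeds_inj emb')/(can_inj gK)->.
- move=> _ /(embedsP emb')[m <-]; exists (psi (g m));
  first exact: (embeds_mem emb).
  by rewrite -eP fK.
Qed.

(** Some nonzero A-multiple of x/y lies in R, so linearity over R moves this ratio across [phi]: the
    map is multiplication by phi(y)/y. *)
Lemma module_hom_mult (R L : set E) (phi : E -> E) :
  A_lattice L -> A_lattice R -> R 1 ->
  (forall a x, R a -> L x -> phi (a * x) = a * phi x) ->
  forall x y : E, L x -> L y -> y * phi x = x * phi y.
Proof.
move=> Ll Rl R1 phiM x y Lx Ly.
have [->|y0] := eqVneq y 0.
  have phi0 : phi 0 = 0 by have := phiM 0 x (A_lattice0 Rl) Lx; rewrite !mul0r.
  by rewrite phi0 mul0r mulr0.
have [a a0 aR] := A_lattice_scale pole (x / y) Rl Rl.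
have a0' : coord_val a != 0 by apply: contra_neq a0 => a0; apply: val_inj.
have Ra : R (coord_val a *: (x / y)) by have := aR 1 R1; rewrite mulr1.
have Ra1 : R ((coord_val a)%:A) by exact: A_latticeZ.
have := phiM _ _ Ra Ly;
  rewrite -scalerAl divfK // -[coord_val a *: x]mulr_algl phiM //.
rewrite mulr_algl -scalerAl => /(scalerI a0') ->.
by rewrite mulrA [y * _]mulrC divfK.
Qed.

End Embeddings.

(** * Endomorphism rings and isogeny classes *)

Section SimpleMotive.
Variables (F : finFieldType) (C : curve F) (c : {rmorphism coord_ring C -> F}).
Local Notation Q := (funfield C).
Local Notation A := (coord_ring C).
Variables (E : fieldExtType Q) (z : E).
Hypothesis z_gen : <<1%AS; z>>%VS = fullv.
Hypothesis pole : exists2 x : Q, coords x & ord (infty C) x < 0.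

Lemma coord_val_neq0 (a : A) : a != 0 -> coord_val a != 0.
Proof. by apply: contra_neq => a0; apply: val_inj. Qed.

(** The image is finitely generated since the motive is, and it spans E because it contains nonzero
    multiples of the generators of [L0]. *)
Lemma embeds_A_lattice (N : motive c) (psi : N -> E) L (L0 : set E) :
  embeds z psi L -> A_lattice L0 ->
  (forall y, L0 y -> exists2 a : A, a != 0 & L (coord_val a *: y)) ->
    A_lattice L.
Proof.
move=> emb [n0 [b0 [b0_span L0E]]] L0L.
have [n [g gP]] := locally_free_generated (mot_locally_free N).
pose b := [tuple psi (g i) | i < n].
have LE : L = [set x | exists a : 'I_n ->
  A, x = \sum_i coord_val (a i) *: tnth b i].
  apply/seteqP; split=> [_ /(embedsP emb)[m <-]|_ [a ->]].
    have [a ->] := gP m; exists a; rewrite (embeds_sum emb).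
    by apply: eq_bigr => i _; rewrite (embedsZ emb) tnth_mktuple.
  apply/(embedsP emb); exists (\sum_i a i *: g i); rewrite (embeds_sum emb).
  by apply: eq_bigr => i _; rewrite (embedsZ emb) tnth_mktuple.
exists n, b; split=> //; apply/eqP; rewrite eqEsubv subvf -b0_span /=.
apply/span_subvP => y /tnthP[i ->].
have L0b : L0 (tnth b0 i).
  rewrite L0E; exists (fun k => if k == i then 1 else 0).
  rewrite (bigD1 i) //= eqxx rmorph1 scale1r big1 ?addr0 // => k /negPf->.
  by rewrite rmorph0 scale0r.
have [a a0] := L0L _ L0b; rewrite LE => -[w wE].
rewrite -[tnth b0 i](scalerK (coord_val_neq0 a0)) wE.
apply/memvZ/memv_suml => k _; apply/memvZ/memv_span; exact: mem_tnth.
Qed.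

Variables (M : motive c) (psi : M -> E) (Lambda : set E).
Hypothesis emb : embeds z psi Lambda.
Hypothesis nzM : ~ is_zero M.

Lemma nonzero_image : exists m, psi m != 0.
Proof.
move/existsNP: nzM => [m /eqP m0]; exists m.
by rewrite -(embeds0 emb) (inj_eq (embeds_inj emb)).
Qed.

(** The scalar of an endomorphism is determined by its effect on one vector with nonzero image; this
    uniqueness makes [j] a ring morphism. *)
Lemma endo_scalar : exists j : {rmorphism endo M -> E},
  forall (f : endo M) m, psi (f m) = j f * psi m.
Proof.
have /choice[j0 j0P] (f : endo M) := hom_mult z_gen pole f emb emb.
have [m0 p0] := nonzero_image.
have j_uniq (f : endo M) e : psi (f m0) = e * psi m0 -> j0 f = e.
  by rewrite j0P => /(mulIf p0).
have jB : zmod_morphism j0.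
  move=> f g; apply: j_uniq; rewrite mulrBl -!j0P.
  change (psi (f m0 - g m0) = psi (f m0) - psi (g m0)).
  by rewrite -scaleN1r (embedsD emb) (embedsZ emb) rmorphN rmorph1 scaleN1r.
have jM : monoid_morphism j0.
  split; first by apply: j_uniq; rewrite mul1r.
  move=> f g; apply: j_uniq.
  change (psi (f (g m0)) = j0 f * j0 g * psi m0).
  by rewrite !j0P mulrA.
pose jA := GRing.isZmodMorphism.Build _ _ j0 jB.
pose jMm := GRing.isMonoidMorphism.Build _ _ j0 jM.
pose j : {rmorphism endo M -> E} := HB.pack j0 jA jMm.
by exists j.
Qed.

Hypothesis LambdaL : A_lattice Lambda.
Variable j : {rmorphism endo M -> E}.
Hypothesis jP : forall (f : endo M) m, psi (f m) = j f * psi m.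

Lemma endo_scalarP (f : endo M) e : (forall m, psi (f m) = e * psi m) ->
  j f = e.
Proof.
by have [m0 p0] := nonzero_image; move=> /(_ m0); rewrite jP => /(mulIf p0).
Qed.

Lemma endo_scalar_inj : injective j.
Proof.
move=> f g jfg; apply: val_inj; apply/funext => m; apply: (embeds_inj emb).
by rewrite !jP jfg.
Qed.

Lemma endo_frob : j (frob M) = z.
Proof. by apply: endo_scalarP => m; exact: (embeds_tau emb m). Qed.

Lemma endo_fraction_algebra : fraction_algebra j.
Proof.
split.
- move=> a f; apply: endo_scalarP => m.
  by rewrite -scalerAl -jP -(embedsZ emb).
- move=> f jf0; exists 1; first exact: oner_neq0.
  by rewrite scale1r; apply: endo_scalar_inj; rewrite jf0 rmorph0.
move=> x; have [a a0 aL] := A_lattice_scale pole x LambdaL LambdaL.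
exists a => //; have [|f fP] := mult_hom (e := coord_val a *: x) emb emb.
  by move=> y /aL; rewrite scalerAl.
by exists f; rewrite (endo_scalarP fP) (scalerK (coord_val_neq0 a0)).
Qed.

Section Isogeny.
Variables (M' : motive c) (f : Defs.hom M' M).
Hypothesis iso_f : isogeny f.

Let L : set E := [set y | exists m, psi (f m) = y].

Lemma isogeny_embeds : embeds z (psi \o f) L.
Proof. by apply: embeds_shift emb _; case: iso_f. Qed.

Lemma isogeny_lattice : A_lattice L.
Proof.
apply: (embeds_A_lattice isogeny_embeds LambdaL) => y /(embedsP emb)[m <-].
have [a a0 [m' m'E]] := iso_f.2 m; exists a => //.
by exists m'; rewrite -m'E (embedsZ emb).
Qed.

(** In E the conjugate of [u] by f is the scalar of [u] itself. Conversely, for x in the order, [g]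
    is multiplication by an [a] carrying Lambda into L, and [h] is multiplication by [x a]. *)
Lemma isogeny_End_image : End_image j f = order_of L.
Proof.
have emb' := isogeny_embeds; have Ll := isogeny_lattice.
apply/seteqP; split=> x.
  move=> [u [a [g [h [a0 fg hE ->]]]]] _ [m <-].
  have [e eP] := hom_mult z_gen pole u emb' emb'.
  have jh : j h = coord_val a *: e.
    apply: endo_scalarP => m'; rewrite hE; have /= -> := eP (g m').
    by rewrite fg (embedsZ emb) -scalerAr scalerAl.
  rewrite (_ : _ *: j h = e); first by exists (u m); exact: eP.
  by rewrite jh (scalerK (coord_val_neq0 a0)).
move=> xL.
have [a a0 aL] := A_lattice_scale pole 1 LambdaL Ll.
have [|u uP] := mult_hom (e := x) emb' emb'; first by move=> y; exact: xL.
have [|g gP] := mult_hom (e := (coord_val a)%:A) emb emb'.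
  by move=> y /aL; rewrite mul1r mulr_algl.
have [|h hP] := mult_hom (e := x * (coord_val a)%:A) emb emb.
  move=> y Ly; rewrite -mulrA.
  have [m <-] : L (x * ((coord_val a)%:A * y)).
    by apply: xL; rewrite mulr_algl; have := aL y Ly; rewrite mul1r.
  exact: (embeds_mem emb).
exists u, a, g, h; split=> //.
- move=> m; apply: (embeds_inj emb); have /= -> := gP m.
  by rewrite (embedsZ emb) mulr_algl.
- move=> m; apply: (embeds_inj emb); rewrite hP.
  by have /= -> := uP (g m); have /= -> := gP m; rewrite mulrA.
by rewrite (endo_scalarP hP) mulrC mulr_algl (scalerK (coord_val_neq0 a0)).
Qed.
End Isogeny.

(** Commensurability turns multiplication by a suitable [a] in A into an isogeny, and L and aL have
    the same order. *)
Lemma scaled_isogeny (N : motive c) (psi' : N -> E) L :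
  embeds z psi' L -> A_lattice L ->
  exists2 f : Defs.hom N M, isogeny f & End_image j f = order_of L.
Proof.
move=> emb' Ll; have [a a0 aL] := A_lattice_scale pole 1 Ll LambdaL.
have a0' := coord_val_neq0 a0.
have [|f fP] := mult_hom (e := (coord_val a)%:A) emb' emb.
  by move=> y /aL; rewrite mul1r mulr_algl.
have iso_f : isogeny f.
  split.
    move=> m m' /(congr1 psi); rewrite !fP !mulr_algl => /(scalerI a0').
    exact: (embeds_inj emb').
  move=> m; have [b b0 bL] := A_lattice_scale pole 1 LambdaL Ll.
  exists (a * b).
    apply: contraNneq (mulf_neq0 a0' (coord_val_neq0 b0)) => ab0.
    by rewrite -rmorphM ab0 rmorph0.
  have /(embedsP emb')[m' m'E] : L (coord_val b *: psi m).
    by have := bL _ (embeds_mem emb m); rewrite mul1r.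
  exists m'; apply: (embeds_inj emb).
  by rewrite fP m'E (embedsZ emb) mulr_algl scalerA rmorphM.
exists f => //; rewrite (isogeny_End_image iso_f).
apply/seteqP; split=> x xL y.
  move=> /(embedsP emb')[m <-]; have [|m' m'E] := xL (psi (f m));
    first by exists m.
  apply/(embedsP emb'); exists m'.
  by move: m'E; rewrite !fP !mulr_algl -scalerAr => /(scalerI a0').
move=> [m <-]; have /(embedsP emb')[m' m'E] := xL _ (embeds_mem emb' m).
by exists m'; rewrite !fP m'E mulrCA.
Qed.

Hypothesis realize : forall L : set E, A_lattice L -> (forall x, L x ->
  L (z * x)) ->
  exists (N : motive c) (psi' : N -> E), embeds z psi' L.

Lemma order_realized (R : set E) : A_order R -> R z ->
  exists M' : motive c, isogenous_with_End j R M'.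
Proof.
move=> [Rl R1 RM] Rz; have [|N [psi' emb']] := realize Rl; first by move=> x;
  exact: RM.
have [f iso_f fE] := scaled_isogeny emb' Rl.
exists N, f; split=> //; rewrite fE; apply/seteqP; split=> x; last by move=>
  Rx y; exact: RM.
by move=> /(_ 1 R1); rewrite mulr1.
Qed.

Lemma isogeny_classes (R : set E) : A_order R -> R z ->
  exists Phi : motive c -> set E,
    bijection_of_classes (isogenous_with_End j R) (@mot_isom F C c)
      (@lattice_with_order F C E R) (@lattice_iso F C E R) Phi.
Proof.
move=> Ro Rz; have [Rl R1 RM] := Ro.
(* Phi depends on a chosen isogeny for each motive; outside the class considered its value is the
   empty set, a mere default. *)
have /choice[Phi PhiP] (N : motive c) : exists L, isogenous_with_End j R N ->
    exists f : Defs.hom N M, [/\ isogeny f, End_image j f = R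
      & L = [set y | exists m, psi (f m) = y]].
  have [[f [iso_f fR]]|no] := pselect (isogenous_with_End j R N).
    by exists [set y | exists m, psi (f m) = y] => _; exists f.
  by exists set0.
have Phi_lat N : isogenous_with_End j R N ->
    exists psi' : N -> E, [/\
      embeds z psi' (Phi N), A_lattice (Phi N) & order_of (Phi N) = R].
  move=> /PhiP[f [iso_f fR ->]]; exists (psi \o f); split.
  - exact: isogeny_embeds.
  - exact: isogeny_lattice.
  - by rewrite -isogeny_End_image.
exists Phi; split.
- by move=> N /Phi_lat[psi' []].
- move=> N N' /Phi_lat[psi1 [emb1 L1 o1]] /Phi_lat[psi2 [emb2 L2 _]]; split.
    by move=> [f f_bij];
      exact: (embeds_lattice_iso z_gen pole R emb1 emb2 f_bij).
  move=> [phi [[phi_fun phi_inj phi_surj] phiD phiM]].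
  have mult := module_hom_mult pole L1 Rl R1 phiM.
  (* An R-isomorphism of lattices is multiplication by one scalar [e], and so comes from a
     homomorphism of motives. *)
  have [e eP] : exists e, forall x, Phi N x -> phi x = e * x.
    have [[y [Ly y0]]|none] := pselect (exists y, Phi N y /\ y != 0).
      exists (phi y / y) => x Lx; apply: (mulfI y0).
      by rewrite (mult x y Lx Ly) mulrC mulrA [y * _]mulrC divfK.
    have L0 := A_lattice0 L1.
    have phi0 : phi 0 = 0.
      by have := phiM 0 0 (A_lattice0 Rl) L0; rewrite !mul0r.
    exists 0 => x Lx; have -> : x = 0 by apply: contrapT => /eqP x0;
      apply: none; exists x.
    by rewrite phi0 mul0r.
  have [|f fP] := mult_hom (e := e) emb1 emb2.
    by move=> x Lx; rewrite -eP //; exact: phi_fun.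
  exists f.
  have f_inj : injective f.
    move=> m m' /(congr1 psi2); rewrite !fP.
    rewrite -!eP; try exact: (embeds_mem emb1).
    move=> /phi_inj H; apply: (embeds_inj emb1); apply: H; apply: mem_set;
      exact: (embeds_mem emb1).
  have /choice[g gP] m : exists m', f m' = m.
    have [x Lx xE] := phi_surj _ (embeds_mem emb2 m).
    have [m' m'E] := (embedsP emb1 x).1 Lx.
    by exists m'; apply: (embeds_inj emb2); rewrite fP m'E -eP.
  by exists g => m //; apply: f_inj; rewrite gP.
move=> L [Ll Lo].
have [|N [psi' emb']] := realize Ll; first by move=> x Lx; rewrite -Lo in Rz;
  exact: Rz.
have [f iso_f fE] := scaled_isogeny emb' Ll.
have isoN : isogenous_with_End j R N by exists f; rewrite fE.
(* The isogeny chosen by Phi need not be the one just built; the two images of the same motive are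
   compared through its identity map. *)
exists N => //; have [psi1 [emb1 L1 _]] := Phi_lat N isoN.
have id_bij : bijective (hom_id N) by exists id.
exact: (embeds_lattice_iso z_gen pole R emb1 emb' id_bij).
Qed.

End SimpleMotive.

(** * Passage from row vectors to E *)

Section MatrixLattice.
Variables (F : finFieldType) (C : curve F).
Local Notation Q := (funfield C).
Variables (E : fieldExtType Q) (r : nat) (theta : 'rV[Q]_r -> E).
Hypotheses (theta_lin : linear theta) (theta_bij : bijective theta).

Lemma matrix_A_lattice n (G : 'M[Q]_(n, r)) : row_full G ->
  A_lattice [set theta v | v in mxspan coords G].
Proof.
move=> /row_fullP[B BG].
have t0 : theta 0 = 0 by have := theta_lin (-1) 0 0; rewrite !scaleN1r !addNr.
have tD x y : theta (x + y) = theta x + theta y by have := theta_lin 1 x y;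
  rewrite !scale1r.
have tZ a x : theta (a *: x) = a *: theta x by have := theta_lin a x 0;
  rewrite t0 !addr0.
pose b := [tuple theta (row i G) | i < n].
have tE (a : 'rV[Q]_n) : theta (a *m G) = \sum_i a 0 i *: tnth b i.
  rewrite mulmx_sum_row (big_morph theta tD t0); apply: eq_bigr => i _.
  by rewrite tZ tnth_mktuple.
exists n, b; split.
  apply/eqP; rewrite eqEsubv subvf /=; apply/subvP => y _.
  have [theta' tK t'K] := theta_bij.
  rewrite -[y]t'K -[theta' y]mulmx1 -BG mulmxA tE.
  apply: memv_suml => i _; apply/memvZ/memv_span; exact: mem_tnth.
apply/seteqP; split=> [_ [_ /mxspanP[a Aa ->] <-]|_ [a ->]].
  have /choice[a' a'E] i := coords_val (Aa ord0 i).
  by exists a'; rewrite tE; apply: eq_bigr => i _; rewrite a'E.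
exists ((\row_i coord_val (a i)) *m G).
  by apply/mxspanP; eexists; last by []; move=> i k; rewrite mxE;
    exact: coord_valA.
by rewrite tE; apply: eq_bigr => i _; rewrite mxE.
Qed.

Lemma realizes_embeds (c : {rmorphism coord_ring C -> F}) (N : motive c) n
    (phi : N -> 'rV[Q]_r) (G : 'M[Q]_(n, r)) T z :
  (forall v, theta (v *m T) = z * theta v) -> realizes phi G T ->
  embeds z (theta \o phi) [set theta v | v in mxspan coords G].
Proof.
move=> thetaT real; split=> /=.
- by move=> a x y; rewrite (realizesD real) (realizesZ real) theta_lin.
- by apply: inj_comp (bij_inj theta_bij) (realizes_inj real).
- move=> y; split=> [[v /(realizesP real)[m <-] <-]|[m <-]]; first by exists m.
  by exists (phi m) => //; apply/(realizesP real); exists m.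
- by move=> m; rewrite (realizes_tau real) thetaT.
Qed.

End MatrixLattice.

Theorem theorem10p11 (F : finFieldType) (C : curve F)
    (c : {rmorphism coord_ring C -> F})
    (hc : forall a : F, c (coord_cst C a) = a)
    (M : motive c) (r d : nat) (hr : rank M = r) (hd : dimension M = d)
    (hM : simple_motive M) :
  (forall f g : endo M, f * g = g * f) /\
  exists (E : fieldExtType (funfield C)) (j : {rmorphism endo M -> E}),
    let pi : E := j (frob M) in
    [/\ fraction_algebra j,
        <<1%AS; pi>>%VS = fullv,
        forall R : set E, A_order R -> R pi ->
          (exists M' : motive c, isogenous_with_End j R M') /\
          R ((field_norm pi)%:A / pi)
      & forall R : set E, A_order R -> R pi ->
          exists Phi : motive c -> set E,
            bijection_of_classes
              (isogenous_with_End j R) (@mot_isom F C c)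
              (@lattice_with_order F C E R) (@lattice_iso F C E R) Phi].
Proof.
have pole := motive_infty_pole hM.1.
have [n [G [T [phi [real mot r0]]]]] := motive_motivic hM.1.
have irr := simple_irreducible mot real hM.
(* The positive rank is written as a successor, the form in which polynomials in a matrix are
   available. *)
move: G T phi r0 real mot irr; case: (rank M) => // r' G T phi _ real mot irr.
have [E [z [theta [z_gen theta_lin theta_bij thetaT]]]] :=
  irreducible_field irr.
have [fullG _ _ _] := mot.
have emb := realizes_embeds theta_lin theta_bij thetaT real.
have Ll := matrix_A_lattice theta_lin theta_bij fullG.
have [j jP] := endo_scalar z_gen pole emb hM.1.
have j_inj := endo_scalar_inj emb jP.
have jz := endo_frob emb hM.1 jP.
(* A [z]-stable lattice in E is a T-stable lattice in Q^r, and [motivic_transfer] makes it a motive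
   with the same characteristic. *)
have realize (L : set E) : A_lattice L -> (forall x, L x -> L (z * x)) ->
    exists (N : motive c) (psi' : N -> E), embeds z psi' L.
  move=> LL zL; have [kappa tK Kt] := theta_bij.
  have kappa_lin : linear kappa.
    by move=> a x y; apply: (can_inj tK); rewrite theta_lin !Kt.
  have kappa_bij : bijective kappa by exists theta.
  have [n' [G' [fullG' G'P]]] := A_lattice_matrix kappa_lin kappa_bij LL.
  have mot' : motivic c G' T.
    apply: (motivic_transfer mot fullG') => v; rewrite -[v]tK => /G'P Lv.
    by rewrite tK -[v *m T]tK thetaT; apply/G'P/zL.
  have [N [phi' real']] := motivic_realized pole mot'.
  exists N, (theta \o phi').
  rewrite (_ : L = [set theta v | v in mxspan coords G']).
    exact: realizes_embeds real'.
  apply/seteqP; split=> [y /G'P Gy|_ [v Gv <-]]; first by exists (kappa y);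
    rewrite ?Kt.
  by apply/G'P; rewrite tK.
split; first by move=> f g; apply: j_inj; rewrite !rmorphM mulrC.
exists E, j => /=; rewrite jz.
(* Were the Frobenius zero, injectivity of tau would make M zero. *)
have z0 : z != 0.
  rewrite -jz; apply/eqP => /eqP; rewrite -(rmorph0 j) (inj_eq j_inj) =>
    /eqP frob0.
  apply: hM.1 => m; apply: (@tau_inj _ _ _ M).
  have frobm x : tau M x = 0 by rewrite -[LHS]/(frob M x) frob0.
  by rewrite !frobm.
split=> //.
- exact: (endo_fraction_algebra pole emb hM.1 Ll jP).
- move=> R Ro Rz; split; last exact: order_norm.
  exact: (order_realized z_gen pole emb hM.1 Ll jP realize).
- by move=> R; exact: (isogeny_classes z_gen pole emb hM.1 Ll jP realize).
Qed.
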